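(* Let $0<q<1$, $\lambda=-\frac{1}{\ln q}$, and let $h$ be the function on $\tilde{\mathbb{C}}^*$ defined by $$h(x)=\frac{\sqrt{\kappa}}{2\pi i}\int_{\mathcal{C}}e^{\,t-\frac{1}{2\ln q}\log^2\frac{\sqrt q\,t}{x}}\,\frac{dt}{t},\qquad \kappa=-\frac{2\pi}{\ln q},$$ which is a solution of $y'(x)=y(qx)$. Let $V_n$ denote the Taylor coefficients at $\sigma=0$ of $$V(\sigma)=e^{\frac{\lambda}{2}\left(\ell(\sigma)^2+\sigma^2\ell(\sigma)+\frac{\sigma^4}{4}\right)}\,\ell'(\sigma)=\sum_{n\ge0}V_n\sigma^n .$$ Then, for every positive integer $N$, as $x\to\infty$ in $\tilde{\mathbb{C}}^*$, $$h(x)=\frac{1}{\sqrt{q\ln(q^{-1})}}\;e^{-\frac{\ln q}{2}\tilde\omega^2+(1+\ln q)\tilde\omega}\;\frac{1}{\sqrt{\tilde\omega}}\left(1+\sum_{n=1}^N\frac{(2n)!\,V_{2n}}{2^n\,n!}\Bigl(-\frac{1}{\tilde\omega}\Bigr)^n+O\Bigl(\frac{1}{\tilde\omega^{N+1}}\Bigr)\right),$$ where $\tilde\omega=\tilde\omega(q,x)=\lambda\,W\!\left(\frac{q^{-3/2}x}{\lambda}\right)$.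
   Context: $\tilde{\mathbb{C}}^*$ is the Riemann surface of the logarithm; $x\to\infty$ in $\tilde{\mathbb{C}}^*$ means $|x|\to+\infty$. $\mathcal{C}$ is a Hankel contour: a smooth contour that starts at infinity on the negative real axis, encircles the origin once in the positive direction ($\arg t$ going from $-\pi$ to $\pi$), and returns to negative infinity; $\log\frac{\sqrt q\,t}{x}=\log t+\frac12\ln q-\log x$. $W$ is the Lambert function, the solution analytic at $z=0$ of $W(z)e^{W(z)}=z$; it is considered on $\{z\in\tilde{\mathbb{C}}^*:|z|>1\}$ by analytic continuation from the positive real axis (where it is real and positive). The square root $\sqrt{\tilde\omega}$ is the continuous branch that is positive for $x>0$ large. $\ell$ is the germ of analytic function at $0$ with $\ell(0)=0$, $\ell'(0)=1$ and $\ell(z)=W(-e^{-1-z^2/2})+1$ near $0$, i.e. $(1-\ell(z))e^{\ell(z)}=e^{-z^2/2}$. *)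

(* Defs.v *)
From Stdlib Require Export Reals Factorial.
From Coquelicot Require Export Coquelicot.
Open Scope R_scope.

(* Points x of the Riemann surface of the logarithm are represented by
   u = log x, which identifies the surface with C.  Thus |x| = exp (Re u),
   arg x = Im u, multiplying x by a real c > 0 adds ln c to u, the positive
   real axis is {u real}, {|x| > 1} is {Re u > 0}, and |x| -> +oo is
   Re u -> +oo. *)

Definition Cexp (z : C) : C :=
  (exp (Re z) * cos (Im z), exp (Re z) * sin (Im z)).

Definition holomorphic_at (f : C -> C) (z : C) : Prop :=
  ex_derive (K := C_AbsRing) (V := C_NormedModule) f z.

Definition near_C (z : C) (P : C -> Prop) : Prop :=
  locally (T := C_UniformSpace) z P.

Definition lambda (q : R) : R := - (1 / ln q).

Definition kappa (q : R) : R := - (2 * PI / ln q).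

(* [g] is the lift tau |-> log t(tau) of a contour tau |-> t(tau) in C \ {0}. *)
Record hankel_contour (g : R -> C) : Prop := {
  hankel_diff : forall tau : R,
    ex_derive (fun s => Re (g s)) tau /\ ex_derive (fun s => Im (g s)) tau;
  hankel_C1 : forall tau : R,
    continuous (Derive (fun s => Re (g s))) tau /\
    continuous (Derive (fun s => Im (g s))) tau;
  hankel_start_mod : is_lim (fun s => Re (g s)) m_infty p_infty;
  hankel_end_mod : is_lim (fun s => Re (g s)) p_infty p_infty;
  hankel_start_arg : is_lim (fun s => Im (g s)) m_infty (- PI);
  hankel_end_arg : is_lim (fun s => Im (g s)) p_infty PI
}.

Definition path_derive (g : R -> C) (tau : R) : C :=
  (Derive (fun s => Re (g s)) tau, Derive (fun s => Im (g s)) tau).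

(* Along the contour log t = g tau, t = Cexp (g tau), and
   dt / t = d(log t) = g'(tau) dtau. *)
Definition h_integrand (q : R) (u : C) (g : R -> C) (tau : R) : C :=
  let log_t := g tau in
  let t := Cexp log_t in
  let L := (log_t + RtoC (1 / 2 * ln q) - u)%C in
  (Cexp (t - RtoC (1 / (2 * ln q)) * L ^ 2) * path_derive g tau)%C.

(* [h q g u] is h(x) at the point with log x = u. *)
Definition h (q : R) (g : R -> C) (u : C) : C :=
  (RtoC (sqrt (kappa q)) / (2 * RtoC PI * Ci) *
   RInt_gen (V := C_R_CompleteNormedModule) (h_integrand q u g)
     (Rbar_locally m_infty) (Rbar_locally p_infty))%C.

(* The Lambert function on a neighbourhood of [0, +oo) in C. *)
Definition lambert_near_positive_axis (W0 : C -> C) : Prop :=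
  (forall x : R, 0 <= x ->
     near_C (RtoC x)
       (fun z => holomorphic_at W0 z /\ (W0 z * Cexp (W0 z))%C = z)) /\
  (forall x : R, 0 < x -> exists w : R, 0 < w /\ W0 (RtoC x) = RtoC w).

(* [W u] is the Lambert function at the point z of the surface with log z = u. *)
Definition lambert_on_surface (W : C -> C) : Prop :=
  exists W0 : C -> C,
    lambert_near_positive_axis W0 /\
    (forall u : C, 0 < Re u -> holomorphic_at W u) /\
    (forall a : R, 0 < a -> W (RtoC a) = W0 (RtoC (exp a))).

(* The logarithm of q^(-3/2) x / lambda, where log x = u. *)
Definition omega_arg (q : R) (u : C) : C :=
  (u + RtoC (- (3 / 2) * ln q - ln (lambda q)))%C.

Definition omega (q : R) (W : C -> C) (u : C) : C :=
  (RtoC (lambda q) * W (omega_arg q u))%C.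

Definition sqrt_omega_branch (q : R) (W sq : C -> C) : Prop :=
  (forall u : C, 0 < Re (omega_arg q u) ->
     continuous (T := C_UniformSpace) (U := C_UniformSpace) sq u /\
     (sq u ^ 2)%C = omega q W u) /\
  (exists a0 : R, forall a : R, a0 < a ->
     exists r : R, 0 < r /\ sq (RtoC a) = RtoC r).

Record ell_germ (ell : C -> C) : Prop := {
  ell_holo : near_C (RtoC 0) (holomorphic_at ell);
  ell_0 : ell (RtoC 0) = RtoC 0;
  ell_deriv_0 : C_derive ell (RtoC 0) = RtoC 1;
  ell_eq : near_C (RtoC 0) (fun z =>
    ((1 - ell z) * Cexp (ell z))%C = Cexp (- (z ^ 2 / 2))%C)
}.

Definition V_fun (q : R) (ell : C -> C) (sigma : C) : C :=
  (Cexp (RtoC (lambda q / 2) *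
         (ell sigma ^ 2 + sigma ^ 2 * ell sigma + sigma ^ 4 / 4)) *
   C_derive ell sigma)%C.

Definition taylor_coeffs_at_0 (f : C -> C) (a : nat -> C) : Prop :=
  near_C (RtoC 0) (fun z =>
    is_pseries (K := C_AbsRing) (V := C_NormedModule) a z (f z)).

(* Main.v *)
Require Import Defs.
From Stdlib Require Import Lra Lia Psatz ClassicalEpsilon.

(** In the variable s = log t - log omega, the integrand of h becomes, up to an explicit factor,
    exp (omega psi s + lambda s^2 / 2 + s) ds with psi s = exp s - s - 1, where omega is the
    quantity of the statement (hankel_kernel_saddle). This is entire in s, so it has a primitive F,
    and h is the explicit factor times the jump of F between the two ends of the contour
    (h_as_jump); the contour itself no longer matters. As |omega| grows the jump is given by
    the saddle point s = 0.

    Near the saddle point the path is taken to be the image of a short segment under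
    sigma |-> log (1 - ell sigma). There psi s = sigma^2 / 2 and the integrand is
    - exp (omega sigma^2 / 2) V sigma (saddle_chart_germ). On the segment of steepest descent the
    exponential is a real Gaussian, and integrating the Taylor polynomial of V term by term gives
    the expansion, the even moments providing the factors (2n)! / (2^n n!) and the powers of
    - 1 / omega (local_contribution). The endpoints are joined to infinity by a straight ray
    followed by the line arg t = pi or - pi. With omega = a cis th, the real part of
    cis th * psi decreases along both, so that these parts are exponentially small in a = |omega|
    (upper_tail, lower_tail).

    The expansion is uniform in arg x, which is unbounded on the surface. This rests on the fact
    that for |x| large omega remains almost in the right half-plane (lambert_cos):
    |W z| exp (Re (W z)) = |z| is large, which excludes that W z is large and near the negative
    axis. Continuity from the real axis then identifies log omega and the
    square root of omega with their principal values (omega_polar).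

    The equation W exp W = exp v is given on the positive axis only, so it has to be continued to
    the half-plane, where W is merely complex differentiable. This is the identity theorem
    (identity_right_half_plane), proved from Goursat's theorem: the latter gives a primitive, which
    satisfies Cauchy's formula on circles centred on the real axis, hence has a Taylor expansion
    there, with zero coefficients. The same existence of primitives provides F. *)

Local Notation is_Cderive := (@is_derive C_AbsRing C_NormedModule).

(** * Complex derivatives *)

Ltac Cmod_triangle_le := eapply Rle_trans; [apply Cmod_triangle|].

Lemma Re_le_Cmod (z : C) : Re z <= Cmod z.
Proof. eapply Rle_trans; [apply Rle_abs|apply re_le_Cmod]. Qed.

Lemma im_le_Cmod (z : C) : Rabs (Im z) <= Cmod z.
Proof. eapply Rle_trans; [apply Rmax_r|apply (Rmax_Cmod z)]. Qed.

Lemma Cmod_le_abs (z : C) : Cmod z <= Rabs (Re z) + Rabs (Im z).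
Proof.
replace z with (RtoC (Re z) + Ci * RtoC (Im z))%C at 1
  by (destruct z; unfold RtoC, Ci, Cplus, Cmult; simpl; f_equal; ring).
Cmod_triangle_le.
rewrite Cmod_mult, 2!Cmod_R, Cmod_Ci. lra.
Qed.

Lemma Cmult_eq_0 (a b : C) : (a * b)%C = RtoC 0 -> a = RtoC 0 \/ b = RtoC 0.
Proof.
intros H. destruct (Ceq_dec a 0) as [Ha|Ha]; [now left|]. destruct (Ceq_dec b 0) as [Hb|Hb]; [now right|].
now elim (Cmult_neq_0 a b Ha Hb).
Qed.

Lemma shrunk_eps_lt (B eps : R) : 0 <= B -> 0 < eps -> eps / (B + 1) * B < eps.
Proof.
intros HB He. replace (eps / (B + 1) * B) with (eps * B / (B + 1)) by (field; lra).
apply Rlt_div_l; nra.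
Qed.

Lemma RtoC_neq_0 (x : R) : x <> 0 -> RtoC x <> RtoC 0.
Proof. intros Hx E. apply Hx. now apply RtoC_inj in E. Qed.

Lemma is_Cderive_eps (f : C -> C) (z l : C) :
  is_Cderive f z l <->
  forall eps, 0 < eps -> exists d, 0 < d /\ forall y, Cmod (y - z) < d ->
    Cmod (f y - f z - l * (y - z)) <= eps * Cmod (y - z).
Proof.
split.
- intros [_ H] eps He.
  destruct (H z (fun P HP => HP) (mkposreal eps He)) as [d Hd].
  exists d; split; [apply cond_pos|]; intros y Hy.
  specialize (Hd y Hy); simpl in Hd.
  rewrite Cmult_comm.
  exact Hd.
- intros H; split.
  + apply is_linear_scal_l.
  + intros x Hx eps.
    assert (Hxz : z = x).
    { apply (is_filter_lim_locally_unique (K := C_AbsRing) (V := AbsRing_NormedModule C_AbsRing)). exact Hx. }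
    subst x.
    destruct (H eps (cond_pos eps)) as [d [Hd0 Hd]].
    exists (mkposreal d Hd0); intros y Hy.
    specialize (Hd y Hy).
    rewrite Cmult_comm in Hd.
    exact Hd.
Qed.

Lemma is_Cderive_const (c z : C) : is_Cderive (fun _ => c) z (RtoC 0).
Proof. apply (is_derive_const (K := C_AbsRing) (V := C_NormedModule)). Qed.

Lemma is_Cderive_id (z : C) : is_Cderive (fun y => y) z (RtoC 1).
Proof.
apply is_Cderive_eps; intros eps He; exists 1; split; [lra|]; intros y _.
replace (y - z - 1 * (y - z))%C with (RtoC 0) by ring.
rewrite Cmod_0. apply Rmult_le_pos; [lra|apply Cmod_ge_0].
Qed.

Lemma is_Cderive_plus (f g : C -> C) (z a b : C) :
  is_Cderive f z a -> is_Cderive g z b -> is_Cderive (fun y => f y + g y)%C z (a + b)%C.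
Proof. exact (@is_derive_plus C_AbsRing C_NormedModule f g z a b). Qed.

Lemma is_Cderive_opp (f : C -> C) (z a : C) :
  is_Cderive f z a -> is_Cderive (fun y => - f y)%C z (- a)%C.
Proof. exact (@is_derive_opp C_AbsRing C_NormedModule f z a). Qed.

Lemma is_Cderive_minus (f g : C -> C) (z a b : C) :
  is_Cderive f z a -> is_Cderive g z b -> is_Cderive (fun y => f y - g y)%C z (a - b)%C.
Proof. exact (@is_derive_minus C_AbsRing C_NormedModule f g z a b). Qed.

Lemma is_Cderive_sub_const (c z : C) : is_Cderive (fun y => y - c)%C z (RtoC 1).
Proof.
replace (RtoC 1) with (1 - 0)%C by ring.
apply is_Cderive_minus; [apply is_Cderive_id|apply is_Cderive_const].
Qed.

Lemma is_Cderive_continuous_eps (f : C -> C) (z l : C) :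
  is_Cderive f z l ->
  forall eps, 0 < eps -> exists d, 0 < d /\ forall y, Cmod (y - z) < d -> Cmod (f y - f z) < eps.
Proof.
intros Hf eps He.
destruct (proj1 (is_Cderive_eps _ _ _) Hf 1 Rlt_0_1) as [d [Hd H]].
assert (Hl := Cmod_ge_0 l).
exists (Rmin d (eps / (2 * (Cmod l + 1)))); split.
{ apply Rmin_pos; trivial. apply Rdiv_lt_0_compat; lra. }
intros y Hy.
assert (H1 := H y (Rlt_le_trans _ _ _ Hy (Rmin_l _ _))).
assert (H2 := Rlt_le_trans _ _ _ Hy (Rmin_r _ _)).
replace (f y - f z)%C with ((f y - f z - l * (y - z)) + l * (y - z))%C by ring.
eapply Rle_lt_trans; [apply Cmod_triangle|].
rewrite Cmod_mult.
apply Rle_lt_trans with ((Cmod l + 1) * Cmod (y - z)); [lra|].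
apply Rmult_lt_compat_l with (r := Cmod l + 1) in H2; [|lra].
replace ((Cmod l + 1) * (eps / (2 * (Cmod l + 1)))) with (eps / 2) in H2 by (field; lra).
lra.
Qed.

Lemma is_Cderive_mult (f g : C -> C) (z a b : C) :
  is_Cderive f z a -> is_Cderive g z b ->
  is_Cderive (fun y => f y * g y)%C z (a * g z + f z * b)%C.
Proof.
intros Hf Hg.
assert (H : @is_derive C_AbsRing (AbsRing_NormedModule C_AbsRing) (fun y => f y * g y)%C z
              (a * g z + f z * b)%C).
{ apply (@is_derive_mult C_AbsRing f g z a b); [| |exact Cmult_comm].
  - split; [apply is_linear_scal_l|exact (proj2 Hf)].
  - split; [apply is_linear_scal_l|exact (proj2 Hg)]. }
split; [apply is_linear_scal_l|exact (proj2 H)].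
Qed.

Lemma is_Cderive_scal (c : C) (f : C -> C) (z a : C) :
  is_Cderive f z a -> is_Cderive (fun y => c * f y)%C z (c * a)%C.
Proof.
intros Hf. replace (c * a)%C with (0 * f z + c * a)%C by ring.
apply (is_Cderive_mult (fun _ => c)); trivial. apply is_Cderive_const.
Qed.

Lemma is_Cderive_comp (f g : C -> C) (z a b : C) :
  is_Cderive f (g z) a -> is_Cderive g z b -> is_Cderive (fun y => f (g y)) z (a * b)%C.
Proof.
intros Hf Hg. rewrite Cmult_comm.
apply (@is_derive_comp C_AbsRing C_NormedModule f g z a b Hf).
split; [apply is_linear_scal_l|exact (proj2 Hg)].
Qed.

Lemma is_Cderive_ext_eps (f g : C -> C) (z l : C) (r : R) :
  0 < r -> (forall y, Cmod (y - z) < r -> f y = g y) ->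
  is_Cderive f z l -> is_Cderive g z l.
Proof.
intros Hr He. apply is_derive_ext_loc. exists (mkposreal r Hr). exact He.
Qed.

Lemma is_Cderive_inv (z : C) : z <> RtoC 0 -> is_Cderive Cinv z (- / (z * z))%C.
Proof.
intros Hz.
assert (Hm : 0 < Cmod z) by (apply Cmod_gt_0; exact Hz).
apply is_Cderive_eps; intros eps He.
exists (Rmin (Cmod z / 2) (eps * (Cmod z ^ 3 / 2))); split.
{ apply Rmin_pos; [lra|]. apply Rmult_lt_0_compat; [lra|].
  apply Rdiv_lt_0_compat; [apply pow_lt; lra|lra]. }
intros y Hy.
assert (H1 := Rlt_le_trans _ _ _ Hy (Rmin_l _ _)).
assert (H2 := Rlt_le_trans _ _ _ Hy (Rmin_r _ _)).
assert (Hyz : Cmod z / 2 < Cmod y).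
{ assert (H := Cmod_triangle y (- (y - z))).
  replace (y + - (y - z))%C with z in H by ring. rewrite Cmod_opp in H. lra. }
assert (Hy0 : y <> 0) by (apply Cmod_gt_0; lra).
replace (/ y - / z - - / (z * z) * (y - z))%C with ((y - z) * (y - z) * / (y * (z * z)))%C
  by (field; split; assumption).
rewrite 2!Cmod_mult, Cmod_inv, 2!Cmod_mult by (repeat apply Cmult_neq_0; assumption).
rewrite (Rmult_comm eps), Rmult_assoc.
apply Rmult_le_compat_l; [apply Cmod_ge_0|].
apply Rle_div_l; [repeat apply Rmult_lt_0_compat; lra|].
apply Rle_trans with (eps * (Cmod z ^ 3 / 2)); [lra|].
apply Rmult_le_compat_l; [lra|].
replace (Cmod z ^ 3 / 2) with (Cmod z / 2 * (Cmod z * Cmod z)) by field.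
apply Rmult_le_compat_r; [apply Rmult_le_pos; lra|lra].
Qed.

Lemma is_Cderive_div (f g : C -> C) (z a b : C) :
  g z <> RtoC 0 -> is_Cderive f z a -> is_Cderive g z b ->
  is_Cderive (fun y => f y / g y)%C z ((a * g z - f z * b) / (g z * g z))%C.
Proof.
intros Hz Hf Hg.
replace ((a * g z - f z * b) / (g z * g z))%C
  with (a * / g z + f z * (- / (g z * g z) * b))%C by (field; assumption).
apply (is_Cderive_mult f (fun y => / g y)%C); trivial.
apply (is_Cderive_comp Cinv g); trivial. now apply is_Cderive_inv.
Qed.

(** * Curves in the complex plane *)

(** Written on the two components, so that the real-variable calculus (auto_derive, RInt, the
    mean value theorem) applies to each of them. *)
Definition curve_derive (g : R -> C) (t : R) (d : C) : Prop :=
  is_derive (fun s => Re (g s)) t (Re d) /\ is_derive (fun s => Im (g s)) t (Im d).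

Lemma curve_derive_eps (g : R -> C) (t : R) (d : C) :
  curve_derive g t d ->
  forall eps, 0 < eps -> exists r, 0 < r /\ forall s, Rabs (s - t) < r ->
    Cmod (g s - g t - RtoC (s - t) * d) <= eps * Rabs (s - t).
Proof.
intros [[_ Hr] [_ Hi]] eps He.
assert (He2 : 0 < eps / 2) by lra.
destruct (Hr t (fun P HP => HP) (mkposreal _ He2)) as [r1 Hr1].
destruct (Hi t (fun P HP => HP) (mkposreal _ He2)) as [r2 Hr2].
exists (Rmin r1 r2); split; [apply Rmin_pos; apply cond_pos|].
intros s Hs.
specialize (Hr1 s (Rlt_le_trans _ _ _ Hs (Rmin_l _ _))).
specialize (Hr2 s (Rlt_le_trans _ _ _ Hs (Rmin_r _ _))).
cbv [norm] in Hr1, Hr2; simpl in Hr1, Hr2.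
cbv [minus plus opp scal abs] in Hr1, Hr2; simpl in Hr1, Hr2.
cbv [mult] in Hr1, Hr2; simpl in Hr1, Hr2.
set (z := (g s - g t - RtoC (s - t) * d)%C).
assert (Hz1 : Rabs (Re z) <= eps / 2 * Rabs (s - t)).
{ replace (Re z) with (Re (g s) + - Re (g t) + - ((s + - t) * Re d)); [exact Hr1|].
  unfold z, Re; simpl; ring. }
assert (Hz2 : Rabs (Im z) <= eps / 2 * Rabs (s - t)).
{ replace (Im z) with (Im (g s) + - Im (g t) + - ((s + - t) * Im d)); [exact Hr2|].
  unfold z, Im; simpl; ring. }
eapply Rle_trans; [apply Cmod_le_abs|lra].
Qed.

Lemma curve_derive_of_eps (g : R -> C) (t : R) (d : C) :
  (forall eps, 0 < eps -> exists r, 0 < r /\ forall s, Rabs (s - t) < r ->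
    Cmod (g s - g t - RtoC (s - t) * d) <= eps * Rabs (s - t)) ->
  curve_derive g t d.
Proof.
intros H.
split; (split; [apply is_linear_scal_l|]); intros x Hx eps;
  (assert (Hxz : t = x)
   by (apply (is_filter_lim_locally_unique (K := R_AbsRing) (V := AbsRing_NormedModule R_AbsRing)); exact Hx));
  subst x; destruct (H eps (cond_pos eps)) as [r [Hr0 Hr]];
  exists (mkposreal r Hr0); intros s Hs; specialize (Hr s Hs);
  eapply Rle_trans; try exact Hr.
- eapply Rle_trans; [|apply re_le_Cmod]. apply Req_le.
  cbv [norm]; simpl. cbv [minus plus opp scal abs mult]; simpl. f_equal.
  unfold Re; simpl; cbv [mult]; simpl; ring.
- eapply Rle_trans; [|apply im_le_Cmod]. apply Req_le.
  cbv [norm]; simpl. cbv [minus plus opp scal abs mult]; simpl. f_equal.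
  unfold Im; simpl; cbv [mult]; simpl; ring.
Qed.

Lemma curve_derive_comp (F : C -> C) (g : R -> C) (t : R) (l d : C) :
  is_Cderive F (g t) l -> curve_derive g t d ->
  curve_derive (fun s => F (g s)) t (l * d)%C.
Proof.
intros HF Hg.
apply curve_derive_of_eps; intros eps He.
assert (Hl := Cmod_ge_0 l). assert (Hd := Cmod_ge_0 d).
set (e1 := Rmin 1 (eps / (2 * (Cmod l + 1)))).
assert (He1 : 0 < e1) by (apply Rmin_pos; [lra|apply Rdiv_lt_0_compat; lra]).
assert (He1l : e1 * (Cmod l + 1) <= eps / 2).
{ apply Rle_trans with (eps / (2 * (Cmod l + 1)) * (Cmod l + 1)).
  - apply Rmult_le_compat_r; [lra|apply Rmin_r].
  - apply Req_le; field; lra. }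
assert (He11 : e1 <= 1) by apply Rmin_l.
set (e2 := eps / (2 * (Cmod d + 1))).
assert (He2 : 0 < e2) by (apply Rdiv_lt_0_compat; lra).
destruct (proj1 (is_Cderive_eps _ _ _) HF e2 He2) as [r2 [Hr2 H2]].
destruct (curve_derive_eps _ _ _ Hg e1 He1) as [r1 [Hr1 H1]].
exists (Rmin r1 (r2 / (Cmod d + 1))); split.
{ apply Rmin_pos; trivial. apply Rdiv_lt_0_compat; lra. }
intros s Hs.
assert (Hs1 := H1 s (Rlt_le_trans _ _ _ Hs (Rmin_l _ _))).
assert (Hs2 := Rlt_le_trans _ _ _ Hs (Rmin_r _ _)).
assert (Ha := Rabs_pos (s - t)).
assert (Hgg : Cmod (g s - g t) <= (Cmod d + 1) * Rabs (s - t)).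
{ replace (g s - g t)%C with ((g s - g t - RtoC (s - t) * d) + RtoC (s - t) * d)%C by ring.
  Cmod_triangle_le. rewrite Cmod_mult, Cmod_R.
  apply Rle_trans with (1 * Rabs (s - t) + Rabs (s - t) * Cmod d); [|lra].
  apply Rplus_le_compat_r. eapply Rle_trans; [exact Hs1|].
  apply Rmult_le_compat_r; lra. }
assert (Hlt : Cmod (g s - g t) < r2).
{ eapply Rle_lt_trans; [exact Hgg|].
  apply Rmult_lt_compat_l with (r := Cmod d + 1) in Hs2; [|lra].
  replace ((Cmod d + 1) * (r2 / (Cmod d + 1))) with r2 in Hs2 by (field; lra). exact Hs2. }
specialize (H2 _ Hlt).
replace (F (g s) - F (g t) - RtoC (s - t) * (l * d))%C
  with ((F (g s) - F (g t) - l * (g s - g t)) + l * (g s - g t - RtoC (s - t) * d))%C by ring.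
Cmod_triangle_le. rewrite Cmod_mult.
apply Rle_trans with (e2 * ((Cmod d + 1) * Rabs (s - t)) + Cmod l * (e1 * Rabs (s - t))).
- apply Rplus_le_compat.
  + eapply Rle_trans; [exact H2|]. apply Rmult_le_compat_l; lra.
  + apply Rmult_le_compat_l; lra.
- replace (e2 * ((Cmod d + 1) * Rabs (s - t))) with (eps / 2 * Rabs (s - t))
    by (unfold e2; field; lra).
  assert (Cmod l * e1 * Rabs (s - t) <= eps / 2 * Rabs (s - t)).
  { apply Rmult_le_compat_r; [lra|]. nra. }
  nra.
Qed.

Lemma curve_derive_line (p d : C) (t : R) :
  curve_derive (fun s => p + RtoC s * d)%C t d.
Proof.
split; unfold Re, Im; simpl; auto_derive; trivial; ring.
Qed.

Lemma curve_derive_RtoC (f : R -> R) (t d : R) :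
  is_derive f t d -> curve_derive (fun s => RtoC (f s)) t (RtoC d).
Proof.
intros H. split; unfold Re, Im; simpl; [exact H|apply (is_derive_const (V := R_NormedModule))].
Qed.

Lemma curve_derive_plus (f g : R -> C) (t : R) (a b : C) :
  curve_derive f t a -> curve_derive g t b ->
  curve_derive (fun s => f s + g s)%C t (a + b)%C.
Proof.
intros [H1 H2] [H3 H4]; split.
- exact (is_derive_plus _ _ _ _ _ H1 H3).
- exact (is_derive_plus _ _ _ _ _ H2 H4).
Qed.

Lemma curve_derive_minus (f g : R -> C) (t : R) (a b : C) :
  curve_derive f t a -> curve_derive g t b ->
  curve_derive (fun s => f s - g s)%C t (a - b)%C.
Proof.
intros [H1 H2] [H3 H4]; split.
- exact (is_derive_minus _ _ _ _ _ H1 H3).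
- exact (is_derive_minus _ _ _ _ _ H2 H4).
Qed.

Lemma curve_derive_scal (c : C) (f : R -> C) (t : R) (a : C) :
  curve_derive f t a -> curve_derive (fun s => c * f s)%C t (c * a)%C.
Proof.
intros Hf. apply (curve_derive_comp (fun z => c * z)%C f); trivial.
assert (H := is_Cderive_scal c (fun y => y) (f t) 1 (is_Cderive_id _)).
replace (c * 1)%C with c in H by ring. exact H.
Qed.

Lemma curve_derive_ext (f g : R -> C) (t : R) (a : C) :
  (forall s, f s = g s) -> curve_derive f t a -> curve_derive g t a.
Proof.
intros He [H1 H2]; split.
- apply is_derive_ext with (2 := H1); intros; now rewrite He.
- apply is_derive_ext with (2 := H2); intros; now rewrite He.
Qed.

(** Majorizing by a derivative g' rather than by a constant lets this inequality replace every
    estimate of an integral below: a primitive of the integrand and one of the majorant suffice.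
    Proof: project onto the direction of f b - f a and apply
    the real mean value theorem to the projection minus g. *)
Lemma curve_mean_value (f f' : R -> C) (g g' : R -> R) (a b : R) :
  a <= b ->
  (forall t, a <= t <= b -> curve_derive f t (f' t)) ->
  (forall t, a <= t <= b -> is_derive g t (g' t)) ->
  (forall t, a <= t <= b -> Cmod (f' t) <= g' t) ->
  Cmod (f b - f a) <= g b - g a.
Proof.
intros Hab Hf Hg Hle.
destruct (Ceq_dec (f b - f a) 0) as [H0|H0].
{ rewrite H0, Cmod_0.
  destruct (MVT_gen g a b g') as [c [Hc1 Hc2]].
  - intros x Hx. rewrite Rmin_left, Rmax_right in Hx by lra. apply Hg; lra.
  - intros x Hx. rewrite Rmin_left, Rmax_right in Hx by lra.
    apply continuity_pt_filterlim. apply (ex_derive_continuous g). exists (g' x). apply Hg; lra.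
  - rewrite Hc2. rewrite Rmin_left, Rmax_right in Hc1 by lra.
    assert (H := Hle c Hc1). assert (H' := Cmod_ge_0 (f' c)).
    apply Rmult_le_pos; lra. }
set (e := (f b - f a)%C) in *.
assert (He : 0 < Cmod e) by now apply Cmod_gt_0.
(* u is the unit vector in the direction of e = f b - f a *)
set (u1 := Re e / Cmod e). set (u2 := Im e / Cmod e).
assert (Hu : u1 ^ 2 + u2 ^ 2 = 1).
{ unfold u1, u2. assert (H := Cmod2_alt e).
  replace ((Re e / Cmod e) ^ 2 + (Im e / Cmod e) ^ 2)
    with ((Re e ^ 2 + Im e ^ 2) / Cmod e ^ 2) by (field; lra).
  rewrite <- H. field. lra. }
set (phi := fun t => u1 * Re (f t) + u2 * Im (f t) - g t).
assert (Hphi : forall t, a <= t <= b ->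
  is_derive phi t (u1 * Re (f' t) + u2 * Im (f' t) - g' t)).
{ intros t Ht. destruct (Hf t Ht) as [H1 H2].
  apply (is_derive_minus (fun t => u1 * Re (f t) + u2 * Im (f t)) g); [|now apply Hg].
  apply (is_derive_plus (fun t => u1 * Re (f t)) (fun t => u2 * Im (f t))).
  - now apply is_derive_scal.
  - now apply is_derive_scal. }
destruct (MVT_gen phi a b (fun t => u1 * Re (f' t) + u2 * Im (f' t) - g' t)) as [c [Hc1 Hc2]].
- intros x Hx. rewrite Rmin_left, Rmax_right in Hx by lra. apply Hphi; lra.
- intros x Hx. rewrite Rmin_left, Rmax_right in Hx by lra.
  apply continuity_pt_filterlim. apply (ex_derive_continuous phi). eexists. apply Hphi; lra.
- rewrite Rmin_left, Rmax_right in Hc1 by lra.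
  assert (Hc3 := Hle c Hc1).
  assert (Hcs : u1 * Re (f' c) + u2 * Im (f' c) <= Cmod (f' c)).
  { apply Rle_trans with (Rabs (u1 * Re (f' c) + u2 * Im (f' c))); [apply Rle_abs|].
    rewrite <- (Rabs_pos_eq (Cmod (f' c))) by apply Cmod_ge_0.
    apply Rsqr_le_abs_0. unfold Rsqr.
    assert (H := Cmod2_alt (f' c)).
    replace (Cmod (f' c) * Cmod (f' c)) with (Cmod (f' c) ^ 2) by ring. rewrite H.
    set (x := Re (f' c)). set (y := Im (f' c)).
    replace (x ^ 2 + y ^ 2) with ((u1 ^ 2 + u2 ^ 2) * (x ^ 2 + y ^ 2)) by (rewrite Hu; ring).
    assert (0 <= (u1 * y - u2 * x) ^ 2) by apply pow2_ge_0. nra. }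
  assert (Hneg : (u1 * Re (f' c) + u2 * Im (f' c) - g' c) * (b - a) <= 0) by nra.
  rewrite <- Hc2 in Hneg. unfold phi in Hneg.
  assert (Hre : Re e = Re (f b) - Re (f a)) by (unfold e, Re; simpl; ring).
  assert (Him : Im e = Im (f b) - Im (f a)) by (unfold e, Im; simpl; ring).
  assert (Hmod : Cmod e = u1 * Re e + u2 * Im e).
  { unfold u1, u2. assert (H := Cmod2_alt e).
    replace (Re e / Cmod e * Re e + Im e / Cmod e * Im e) with ((Re e ^ 2 + Im e ^ 2) / Cmod e)
      by (field; lra).
    rewrite <- H. field. lra. }
  rewrite Hmod. rewrite Hre, Him. lra.
Qed.

Lemma segment_mean_value (F f : C -> C) (p q : C) (M : R) :
  (forall t, 0 <= t <= 1 -> is_Cderive F (p + RtoC t * (q - p))%C (f (p + RtoC t * (q - p))%C)) ->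
  (forall t, 0 <= t <= 1 -> Cmod (f (p + RtoC t * (q - p))%C) <= M) ->
  Cmod (F q - F p) <= M * Cmod (q - p).
Proof.
intros HF HM.
assert (H := curve_mean_value (fun t => F (p + RtoC t * (q - p))%C)
  (fun t => f (p + RtoC t * (q - p)) * (q - p))%C
  (fun t => M * Cmod (q - p) * t) (fun _ => M * Cmod (q - p)) 0 1).
cbv beta in H.
replace (p + RtoC 1 * (q - p))%C with q in H by ring.
replace (p + RtoC 0 * (q - p))%C with p in H by ring.
replace (M * Cmod (q - p)) with (M * Cmod (q - p) * 1 - M * Cmod (q - p) * 0) by ring.
apply H; [lra| | |].
- intros t Ht. apply (curve_derive_comp F (fun t => p + RtoC t * (q - p))%C).
  + now apply HF.
  + apply curve_derive_line.
- intros t Ht. auto_derive; trivial. ring.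
- intros t Ht. rewrite Cmod_mult. apply Rmult_le_compat_r; [apply Cmod_ge_0|]. now apply HM.
Qed.

(** * The exponential *)

Lemma exp_monotone (a b : R) : a <= b -> exp a <= exp b.
Proof. intros [H|H]; [left; now apply exp_increasing|right; now rewrite H]. Qed.

Lemma Cexp_plus (a b : C) : Cexp (a + b) = (Cexp a * Cexp b)%C.
Proof.
unfold Cexp, Re, Im; simpl. rewrite exp_plus, cos_plus, sin_plus.
unfold Cmult; simpl. f_equal; ring.
Qed.

Lemma Cexp_RtoC (x : R) : Cexp (RtoC x) = RtoC (exp x).
Proof.
unfold Cexp, RtoC, Re, Im; simpl. rewrite cos_0, sin_0. f_equal; ring.
Qed.

Lemma Cexp_0 : Cexp 0 = RtoC 1.
Proof. rewrite Cexp_RtoC, exp_0. reflexivity. Qed.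

Lemma Cmod_Cexp (z : C) : Cmod (Cexp z) = exp (Re z).
Proof.
unfold Cexp, Cmod; simpl.
replace (exp (Re z) * cos (Im z) * (exp (Re z) * cos (Im z) * 1) +
   exp (Re z) * sin (Im z) * (exp (Re z) * sin (Im z) * 1)) with (Rsqr (exp (Re z))).
- apply sqrt_Rsqr. left; apply exp_pos.
- assert (H := sin2_cos2 (Im z)). unfold Rsqr in *. nra.
Qed.

Lemma Cexp_neq_0 (z : C) : Cexp z <> 0.
Proof. apply Cmod_gt_0. rewrite Cmod_Cexp. apply exp_pos. Qed.

Lemma Cexp_opp (z : C) : Cexp (- z) = (/ Cexp z)%C.
Proof.
assert (H : (Cexp (- z) * Cexp z)%C = RtoC 1).
{ rewrite <- Cexp_plus. replace (- z + z)%C with (RtoC 0) by ring. apply Cexp_0. }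
replace (Cexp (- z)) with (Cexp (- z) * Cexp z * / Cexp z)%C by (field; apply Cexp_neq_0).
rewrite H. ring.
Qed.

Lemma curve_derive_Cexp_line (h : C) (t : R) :
  curve_derive (fun s => Cexp (RtoC s * h)) t (h * Cexp (RtoC t * h))%C.
Proof.
destruct h as [h1 h2].
apply curve_derive_ext with (fun s => (exp (s * h1) * cos (s * h2), exp (s * h1) * sin (s * h2))).
{ intros s. unfold Cexp, Re, Im; simpl.
  replace (s * h1 - 0 * h2) with (s * h1) by ring.
  replace (s * h2 + 0 * h1) with (s * h2) by ring. reflexivity. }
unfold Cexp, Re, Im, Cmult, RtoC; simpl.
replace (t * h1 - 0 * h2) with (t * h1) by ring.
replace (t * h2 + 0 * h1) with (t * h2) by ring.
split; unfold Re, Im; simpl; auto_derive; trivial; ring.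
Qed.

Lemma Cexp_line_bound (h : C) (t : R) : 0 <= t <= 1 -> Cmod (Cexp (RtoC t * h)) <= exp (Cmod h).
Proof.
intros Ht. rewrite Cmod_Cexp.
assert (H : Re (RtoC t * h) <= Cmod h).
{ eapply Rle_trans; [apply Re_le_Cmod|]. rewrite Cmod_mult, Cmod_R, Rabs_pos_eq by lra.
  assert (H := Cmod_ge_0 h). nra. }
destruct H as [H|H]; [left; now apply exp_increasing|right; now rewrite H].
Qed.

(** Each remainder is a primitive, along the segment from 0 to h, of h times the previous one, so
    that each inherits the bound of the previous one times |h|. *)
Lemma Cexp_taylor_line (h : C) (t : R) : 0 <= t <= 1 ->
  Cmod (Cexp (RtoC t * h) - 1) <= Cmod h * exp (Cmod h) /\
  Cmod (Cexp (RtoC t * h) - 1 - RtoC t * h) <= Cmod h ^ 2 * exp (Cmod h) /\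
  Cmod (Cexp (RtoC t * h) - 1 - RtoC t * h - (RtoC t * h) ^ 2 / 2) <= Cmod h ^ 3 * exp (Cmod h).
Proof.
set (K := exp (Cmod h)). assert (HK : 0 < K) by apply exp_pos.
assert (Hh := Cmod_ge_0 h).
assert (step : forall (f f' : R -> C) M, 0 <= M -> f 0 = RtoC 0 ->
  (forall t, 0 <= t <= 1 -> curve_derive f t (h * f' t)%C) ->
  (forall t, 0 <= t <= 1 -> Cmod (f' t) <= M) ->
  forall t, 0 <= t <= 1 -> Cmod (f t) <= Cmod h * M).
{ intros f f' M HM H0 Hf Hb s Hs.
  assert (H := curve_mean_value f (fun t => h * f' t)%C (fun t => Cmod h * M * t)
     (fun _ => Cmod h * M) 0 s).
  rewrite H0 in H. replace (f s - 0)%C with (f s) in H by ring.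
  apply Rle_trans with (Cmod h * M * s - Cmod h * M * 0).
  - apply H; [lra| | |].
    + intros u Hu; apply Hf; lra.
    + intros u Hu. auto_derive; trivial; ring.
    + intros u Hu. rewrite Cmod_mult. apply Rmult_le_compat_l; trivial. apply Hb; lra.
  - assert (0 <= Cmod h * M) by now apply Rmult_le_pos. nra. }
assert (E1 : forall t, 0 <= t <= 1 -> Cmod (Cexp (RtoC t * h) - 1) <= Cmod h * K).
{ apply (step _ (fun t => Cexp (RtoC t * h))).
  - lra.
  - replace (RtoC 0 * h)%C with (RtoC 0) by ring. rewrite Cexp_0. ring.
  - intros u Hu. replace (h * Cexp (RtoC u * h))%C with (h * Cexp (RtoC u * h) - 0)%C by ring.
    apply curve_derive_minus; [apply curve_derive_Cexp_line|].
    split; apply (is_derive_const (V := R_NormedModule)).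
  - intros u Hu. now apply Cexp_line_bound. }
assert (E2 : forall t, 0 <= t <= 1 ->
  Cmod (Cexp (RtoC t * h) - 1 - RtoC t * h) <= Cmod h * (Cmod h * K)).
{ apply (step _ (fun t => Cexp (RtoC t * h) - 1)%C).
  - apply Rmult_le_pos; lra.
  - replace (RtoC 0 * h)%C with (RtoC 0) by ring. rewrite Cexp_0. ring.
  - intros u Hu. replace (h * (Cexp (RtoC u * h) - 1))%C
      with (h * Cexp (RtoC u * h) - 0 - h)%C by ring.
    apply curve_derive_minus; [apply curve_derive_minus; [apply curve_derive_Cexp_line|]|].
    + split; apply (is_derive_const (V := R_NormedModule)).
    + apply curve_derive_ext with (2 := curve_derive_line 0 h u). intros; ring.
  - exact E1. }
assert (E3 : forall t, 0 <= t <= 1 ->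
  Cmod (Cexp (RtoC t * h) - 1 - RtoC t * h - (RtoC t * h) ^ 2 / 2)
    <= Cmod h * (Cmod h * (Cmod h * K))).
{ apply (step _ (fun t => Cexp (RtoC t * h) - 1 - RtoC t * h)%C).
  - repeat apply Rmult_le_pos; lra.
  - replace (RtoC 0 * h)%C with (RtoC 0) by ring. rewrite Cexp_0. field.
  - intros u Hu. replace (h * (Cexp (RtoC u * h) - 1 - RtoC u * h))%C
      with (h * Cexp (RtoC u * h) - 0 - h - RtoC u * (h * h))%C by ring.
    apply curve_derive_minus; [apply curve_derive_minus;
      [apply curve_derive_minus; [apply curve_derive_Cexp_line|]|]|].
    + split; apply (is_derive_const (V := R_NormedModule)).
    + apply curve_derive_ext with (2 := curve_derive_line 0 h u). intros; ring.
    + destruct h as [h1 h2].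
      split; unfold Re, Im; simpl; auto_derive; trivial; simpl; field.
  - exact E2. }
intros Ht; repeat split.
- now apply E1.
- replace (Cmod h ^ 2 * K) with (Cmod h * (Cmod h * K)) by ring. now apply E2.
- replace (Cmod h ^ 3 * K) with (Cmod h * (Cmod h * (Cmod h * K))) by ring. now apply E3.
Qed.

Lemma Cexp_taylor1 (h : C) : Cmod (Cexp h - 1 - h) <= Cmod h ^ 2 * exp (Cmod h).
Proof.
assert (H01 : 0 <= 1 <= 1) by lra.
destruct (Cexp_taylor_line h 1 H01) as [_ [H _]].
replace (RtoC 1 * h)%C with h in H by ring. exact H.
Qed.

Lemma Cexp_taylor2 (h : C) : Cmod (Cexp h - 1 - h - h ^ 2 / 2) <= Cmod h ^ 3 * exp (Cmod h).
Proof.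
assert (H01 : 0 <= 1 <= 1) by lra.
destruct (Cexp_taylor_line h 1 H01) as [_ [_ H]].
replace (RtoC 1 * h)%C with h in H by ring. exact H.
Qed.

Lemma is_Cderive_Cexp (z : C) : is_Cderive Cexp z (Cexp z).
Proof.
apply is_Cderive_eps; intros eps He.
assert (HM : 0 < Cmod (Cexp z)) by (rewrite Cmod_Cexp; apply exp_pos).
assert (He1 := exp_pos 1).
exists (Rmin 1 (eps / (Cmod (Cexp z) * exp 1))); split.
{ apply Rmin_pos; [lra|]. apply Rdiv_lt_0_compat; [lra|]. now apply Rmult_lt_0_compat. }
intros y Hy.
assert (H1 := Rlt_le_trans _ _ _ Hy (Rmin_l _ _)).
assert (H2 := Rlt_le_trans _ _ _ Hy (Rmin_r _ _)).
assert (H0 := Cmod_ge_0 (y - z)).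
replace (Cexp y) with (Cexp z * Cexp (y - z))%C
  by (rewrite <- Cexp_plus; f_equal; ring).
replace (Cexp z * Cexp (y - z) - Cexp z - Cexp z * (y - z))%C
  with (Cexp z * (Cexp (y - z) - 1 - (y - z)))%C by ring.
rewrite Cmod_mult.
apply Rle_trans with (Cmod (Cexp z) * (Cmod (y - z) ^ 2 * exp 1)).
- apply Rmult_le_compat_l; [lra|]. eapply Rle_trans; [apply Cexp_taylor1|].
  apply Rmult_le_compat_l; [apply pow2_ge_0|]. left; now apply exp_increasing.
- replace (Cmod (Cexp z) * (Cmod (y - z) ^ 2 * exp 1))
    with (Cmod (y - z) * (Cmod (Cexp z) * exp 1) * Cmod (y - z)) by ring.
  apply Rmult_le_compat_r; [lra|].
  left. apply Rlt_div_r in H2; [exact H2|]. now apply Rmult_lt_0_compat.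
Qed.

Lemma is_Cderive_Cexp_comp (f : C -> C) (z a : C) :
  is_Cderive f z a -> is_Cderive (fun y => Cexp (f y)) z (Cexp (f z) * a)%C.
Proof. intros Hf. apply (is_Cderive_comp Cexp f); trivial. apply is_Cderive_Cexp. Qed.

Lemma is_Cderive_eq (f : C -> C) (z a b : C) : is_Cderive f z a -> a = b -> is_Cderive f z b.
Proof. intros H <-; exact H. Qed.

Lemma is_Cderive_pow2 (f : C -> C) (z a : C) :
  is_Cderive f z a -> is_Cderive (fun y => f y ^ 2)%C z (2 * f z * a)%C.
Proof.
intros Hf. apply is_Cderive_eq with (a * (f z * 1) + f z * (a * 1 + f z * 0))%C; [|ring].
apply (is_Cderive_mult f (fun y => f y * 1)%C); trivial.
apply (is_Cderive_mult f (fun y => RtoC 1)); trivial. apply is_Cderive_const.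
Qed.

(** Differentiates a formula and leaves the comparison with the expected derivative. A match that
    backtracks is essential: the pattern for a constant factor also matches non-constant ones. *)
Ltac Cderive_step :=
  cbv beta;
  match goal with
  | H : is_derive ?f ?z _ |- is_derive ?f ?z _ => exact H
  | H : is_derive ?f ?z _ |- is_derive (fun y => ?f y) ?z _ => exact H
  | |- is_derive (fun y => y) _ _ => apply is_Cderive_id
  | |- is_derive (fun y => (@?f y + @?g y)%C) _ _ => eapply (is_Cderive_plus f g)
  | |- is_derive (fun y => (@?f y - @?g y)%C) _ _ => eapply (is_Cderive_minus f g)
  | |- is_derive (fun y => (- @?f y)%C) _ _ => eapply (is_Cderive_opp f)
  | |- is_derive (fun y => (?c * @?f y)%C) _ _ => eapply (is_Cderive_scal c f)
  | |- is_derive (fun y => (@?f y * @?g y)%C) _ _ => eapply (is_Cderive_mult f g)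
  | |- is_derive (fun y => (@?f y ^ 2)%C) _ _ => eapply (is_Cderive_pow2 f)
  | |- is_derive (fun y => (@?f y / @?g y)%C) _ _ => eapply (is_Cderive_div f g)
  | |- is_derive (fun y => Cexp (@?f y)) _ _ => eapply (is_Cderive_Cexp_comp f)
  | |- is_derive _ _ _ => apply is_Cderive_const
  end.
Ltac Cderive := eapply is_Cderive_eq; [repeat Cderive_step|cbv beta;
  match goal with |- ?a = ?b => change (@eq C a b) end].

(** * Integrals of complex-valued functions of a real variable *)

Local Notation is_CInt := (@is_RInt C_R_NormedModule).
Local Notation CInt := (@RInt C_R_CompleteNormedModule).

Definition curve_smooth_on (f : R -> C) (a b : R) : Prop :=
  forall t, Rmin a b <= t <= Rmax a b -> exists d, curve_derive f t d.

Lemma curve_derive_continuous (f : R -> C) (t : R) (d : C) : curve_derive f t d ->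
  continuous (U := C_UniformSpace) f t.
Proof.
intros [H1 H2].
apply (continuous_ext (fun s => (Re (f s), Im (f s)))).
{ intros s; now destruct (f s). }
apply (continuous_comp_2 (fun s => Re (f s)) (fun s => Im (f s)) (fun x y => (x, y))).
- apply (ex_derive_continuous (fun s => Re (f s))). eexists; exact H1.
- apply (ex_derive_continuous (fun s => Im (f s))). eexists; exact H2.
- apply continuous_ext with (fun x : R * R => x); [now intros []|apply continuous_id].
Qed.

Lemma CInt_correct (f : R -> C) (a b : R) :
  curve_smooth_on f a b -> is_CInt f a b (CInt f a b).
Proof.
intros H. apply (RInt_correct (V := C_R_CompleteNormedModule)).
apply (ex_RInt_continuous (V := C_R_CompleteNormedModule)).
intros t Ht. destruct (H t Ht) as [d Hd]. exact (curve_derive_continuous f t d Hd).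
Qed.

Lemma CInt_Chasles (f : R -> C) (a b c : R) :
  curve_smooth_on f a b -> curve_smooth_on f b c ->
  (CInt f a b + CInt f b c)%C = CInt f a c.
Proof.
intros H1 H2. apply (RInt_Chasles (V := C_R_CompleteNormedModule)).
- eexists; now apply CInt_correct.
- eexists; now apply CInt_correct.
Qed.

Lemma CInt_swap (f : R -> C) (a b : R) :
  curve_smooth_on f a b -> CInt f b a = (- CInt f a b)%C.
Proof.
intros H1. symmetry. apply (opp_RInt_swap (V := C_R_CompleteNormedModule)).
eexists; now apply CInt_correct.
Qed.

Lemma is_CInt_derive (F f : R -> C) (a b : R) :
  (forall t, Rmin a b <= t <= Rmax a b -> curve_derive F t (f t)) ->
  (forall t, Rmin a b <= t <= Rmax a b ->
     continuous (fun s => Re (f s)) t /\ continuous (fun s => Im (f s)) t) ->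
  is_CInt f a b (F b - F a)%C.
Proof.
intros HF Hf.
apply (is_RInt_fct_extend_pair (U := R_NormedModule) (V := R_NormedModule)).
- apply (is_RInt_derive (V := R_CompleteNormedModule) (fun t => Re (F t)) (fun t => Re (f t))).
  + intros t Ht. apply (HF t Ht).
  + intros t Ht. apply (Hf t Ht).
- apply (is_RInt_derive (V := R_CompleteNormedModule) (fun t => Im (F t)) (fun t => Im (f t))).
  + intros t Ht. apply (HF t Ht).
  + intros t Ht. apply (Hf t Ht).
Qed.

Lemma is_CInt_derive_smooth (F f : R -> C) (a b : R) :
  (forall t, Rmin a b <= t <= Rmax a b -> curve_derive F t (f t)) ->
  curve_smooth_on f a b -> is_CInt f a b (F b - F a)%C.
Proof.
intros HF Hf. apply is_CInt_derive; trivial.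
intros t Ht. destruct (Hf t Ht) as [d [H1 H2]]. split.
- apply (ex_derive_continuous (fun s => Re (f s))). eexists; exact H1.
- apply (ex_derive_continuous (fun s => Im (f s))). eexists; exact H2.
Qed.

Lemma is_CInt_bound (f : R -> C) (a b : R) (l : C) (M : R) :
  (forall t, Rmin a b <= t <= Rmax a b -> Cmod (f t) <= M) ->
  is_CInt f a b l -> Cmod l <= Rabs (b - a) * M.
Proof.
intros Hf Hl. rewrite Cmod_norm.
apply (norm_RInt_le_const_abs (V := C_R_NormedModule) f a b l M); trivial.
intros t Ht. rewrite <- Cmod_norm. now apply Hf.
Qed.

Lemma is_CInt_minus (f g : R -> C) (a b : R) (l m : C) :
  is_CInt f a b l -> is_CInt g a b m -> is_CInt (fun t => f t - g t)%C a b (l - m)%C.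
Proof. exact (is_RInt_minus (V := C_R_NormedModule) f g a b l m). Qed.

Lemma is_CInt_plus (f g : R -> C) (a b : R) (l m : C) :
  is_CInt f a b l -> is_CInt g a b m -> is_CInt (fun t => f t + g t)%C a b (l + m)%C.
Proof. exact (is_RInt_plus (V := C_R_NormedModule) f g a b l m). Qed.

Lemma is_CInt_Re (f : R -> C) (a b : R) (l : C) :
  is_CInt f a b l -> is_RInt (fun t => Re (f t)) a b (Re l).
Proof. exact (is_RInt_fct_extend_fst (U := R_NormedModule) (V := R_NormedModule) f a b l). Qed.

Lemma is_CInt_Im (f : R -> C) (a b : R) (l : C) :
  is_CInt f a b l -> is_RInt (fun t => Im (f t)) a b (Im l).
Proof. exact (is_RInt_fct_extend_snd (U := R_NormedModule) (V := R_NormedModule) f a b l). Qed.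

Lemma is_CInt_scal (c : C) (f : R -> C) (a b : R) (l : C) :
  is_CInt f a b l -> is_CInt (fun t => c * f t)%C a b (c * l)%C.
Proof.
intros H. assert (H1 := is_CInt_Re _ _ _ _ H). assert (H2 := is_CInt_Im _ _ _ _ H).
apply (is_RInt_fct_extend_pair (U := R_NormedModule) (V := R_NormedModule)).
- apply (is_RInt_minus (V := R_NormedModule) (fun t => fst c * Re (f t)) (fun t => snd c * Im (f t))).
  + now apply (is_RInt_scal (V := R_NormedModule)).
  + now apply (is_RInt_scal (V := R_NormedModule)).
- apply (is_RInt_plus (V := R_NormedModule) (fun t => fst c * Im (f t)) (fun t => snd c * Re (f t))).
  + now apply (is_RInt_scal (V := R_NormedModule)).
  + now apply (is_RInt_scal (V := R_NormedModule)).
Qed.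

Lemma is_CInt_ext (f g : R -> C) (a b : R) (l : C) :
  (forall t, f t = g t) -> is_CInt f a b l -> is_CInt g a b l.
Proof. intros H. apply is_RInt_ext. intros t _; apply H. Qed.

Lemma is_CInt_unique (f : R -> C) (a b : R) (l m : C) :
  is_CInt f a b l -> is_CInt f a b m -> l = m.
Proof.
intros H1 H2. rewrite <- (is_RInt_unique (V := C_R_CompleteNormedModule) _ _ _ _ H1).
exact (is_RInt_unique (V := C_R_CompleteNormedModule) _ _ _ _ H2).
Qed.

(** * Goursat's theorem *)

Definition horizontal_int (f : C -> C) (a b y : R) : C := CInt (fun x => f (x, y)) a b.
Definition vertical_int (f : C -> C) (x c d : R) : C := CInt (fun y => Ci * f (x, y))%C c d.

(** Boundary of the rectangle with vertical sides at a, b and horizontal sides at c, d,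
    counterclockwise when a <= b and c <= d. *)
Definition boundary_int (f : C -> C) (a b c d : R) : C :=
  (horizontal_int f a b c + vertical_int f b c d
   - horizontal_int f a b d - vertical_int f a c d)%C.

Definition holomorphic_on_rect (f : C -> C) (a b c d : R) : Prop :=
  forall x y, Rmin a b <= x <= Rmax a b -> Rmin c d <= y <= Rmax c d ->
    exists l, is_Cderive f (x, y) l.

Lemma curve_derive_horizontal (y x : R) : curve_derive (fun s => (s, y)) x (RtoC 1).
Proof. split; unfold Re, Im; simpl; auto_derive; trivial. Qed.

Lemma curve_derive_vertical (x y : R) : curve_derive (fun s => (x, s)) y Ci.
Proof. split; unfold Re, Im; simpl; auto_derive; trivial. Qed.

Lemma smooth_horizontal (f : C -> C) (a b c d y : R) :
  holomorphic_on_rect f a b c d -> Rmin c d <= y <= Rmax c d ->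
  curve_smooth_on (fun x => f (x, y)) a b.
Proof.
intros Hf Hy x Hx. destruct (Hf x y Hx Hy) as [l Hl].
exists (l * RtoC 1)%C. apply (curve_derive_comp f (fun s => (s, y))); trivial.
apply curve_derive_horizontal.
Qed.

Lemma smooth_vertical (f : C -> C) (a b c d x : R) :
  holomorphic_on_rect f a b c d -> Rmin a b <= x <= Rmax a b ->
  curve_smooth_on (fun y => Ci * f (x, y))%C c d.
Proof.
intros Hf Hx y Hy. destruct (Hf x y Hx Hy) as [l Hl].
exists (Ci * (l * Ci))%C. apply curve_derive_scal.
apply (curve_derive_comp f (fun s => (x, s))); trivial.
apply curve_derive_vertical.
Qed.

Lemma holomorphic_on_subrect (f : C -> C) (a b c d a' b' c' d' : R) :
  Rmin a b <= Rmin a' b' -> Rmax a' b' <= Rmax a b ->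
  Rmin c d <= Rmin c' d' -> Rmax c' d' <= Rmax c d ->
  holomorphic_on_rect f a b c d -> holomorphic_on_rect f a' b' c' d'.
Proof. intros H1 H2 H3 H4 Hf x y Hx Hy. apply Hf; lra. Qed.

Ltac subrect Hf := apply holomorphic_on_subrect with (5 := Hf);
  repeat (first [rewrite Rmin_left by lra | rewrite Rmax_right by lra]); lra.

Lemma boundary_int_split (f : C -> C) (a m b c n d : R) :
  a <= m <= b -> c <= n <= d -> holomorphic_on_rect f a b c d ->
  boundary_int f a b c d =
   (boundary_int f a m c n + boundary_int f m b c n
    + boundary_int f a m n d + boundary_int f m b n d)%C.
Proof.
intros Hm Hn Hf.
assert (Hh : forall y, c <= y <= d ->
  horizontal_int f a b y = (horizontal_int f a m y + horizontal_int f m b y)%C).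
{ intros y Hy. symmetry. apply CInt_Chasles; apply (smooth_horizontal f) with c d;
   try (rewrite Rmin_left, Rmax_right; lra);
   subrect Hf. }
assert (Hv : forall x, a <= x <= b ->
  vertical_int f x c d = (vertical_int f x c n + vertical_int f x n d)%C).
{ intros x Hx. symmetry. apply CInt_Chasles; apply (smooth_vertical f) with a b;
   try (rewrite Rmin_left, Rmax_right; lra);
   subrect Hf. }
unfold boundary_int.
rewrite (Hh c), (Hh d), (Hv a), (Hv b) by lra. ring.
Qed.

Lemma C_pair_decomposition (x y : R) : (x, y) = (RtoC x + Ci * RtoC y)%C.
Proof. unfold RtoC, Ci, Cplus, Cmult; simpl; f_equal; ring. Qed.

(** The affine part of f at (u, v) has a primitive, hence contributes nothing; what is left is an
    o(diameter) integrated over a boundary of length O(diameter). *)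
Lemma boundary_int_small (f : C -> C) (u v eps : R) (l : C) :
  0 < eps -> is_Cderive f (u, v) l ->
  exists delta, 0 < delta /\ forall a b c d,
    a <= u <= b -> c <= v <= d -> (b - a) + (d - c) < delta ->
    holomorphic_on_rect f a b c d ->
    Cmod (boundary_int f a b c d) <= 2 * eps * ((b - a) + (d - c)) ^ 2.
Proof.
intros He Hl.
destruct (proj1 (is_Cderive_eps _ _ _) Hl eps He) as [delta [Hd0 Hd]].
exists delta; split; trivial.
intros a b c d Hu Hv Hs Hf.
set (z0 := (u, v) : C) in *.
set (P := fun z : C => (f z0 * z + l * ((z - z0) * (z - z0)) / 2)%C).
set (P' := fun z : C => (f z0 + l * (z - z0))%C).
assert (HP : forall z, is_Cderive P z (P' z)).
{ intros z. unfold P, P'. Cderive; [|field]. apply RtoC_neq_0; lra. }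
assert (HP' : forall z, is_Cderive P' z l).
{ intros z. unfold P'. Cderive. ring. }
set (s := (b - a) + (d - c)) in *.
assert (Herr : forall x y, a <= x <= b -> c <= y <= d -> Cmod (f (x, y) - P' (x, y)) <= eps * s).
{ intros x y Hx Hy.
  assert (Hdist : Cmod ((x, y) - z0) <= s).
  { eapply Rle_trans; [apply Cmod_le_abs|]. unfold z0, Re, Im; simpl.
    unfold s. apply Rplus_le_compat; apply Rabs_le; lra. }
  replace (f (x, y) - P' (x, y))%C with (f (x, y) - f z0 - l * ((x, y) - z0))%C
    by (unfold P'; ring).
  eapply Rle_trans; [apply Hd; lra|]. apply Rmult_le_compat_l; lra. }
assert (Hh : forall y, c <= y <= d ->
  Cmod (horizontal_int f a b y - (P (b, y) - P (a, y))) <= (b - a) * (eps * s)).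
{ intros y Hy. rewrite <- (Rabs_pos_eq (b - a)) by lra.
  apply is_CInt_bound with (fun x => f (x, y) - P' (x, y))%C.
  - intros x. rewrite Rmin_left, Rmax_right by lra. intros Hx. now apply Herr.
  - apply (is_RInt_minus (V := C_R_NormedModule) (fun x => f (x, y)) (fun x => P' (x, y))).
    + apply CInt_correct. apply smooth_horizontal with (1 := Hf).
      rewrite Rmin_left, Rmax_right; lra.
    + apply (is_CInt_derive_smooth (fun x => P (x, y))).
      * intros t _. replace (P' (t, y)) with (P' (t, y) * 1)%C by ring.
        apply (curve_derive_comp P (fun x => (x, y))); [apply HP|apply curve_derive_horizontal].
      * intros t _. exists (l * 1)%C.
        apply (curve_derive_comp P' (fun x => (x, y))); [apply HP'|apply curve_derive_horizontal]. }
assert (Hvt : forall x, a <= x <= b ->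
  Cmod (vertical_int f x c d - (P (x, d) - P (x, c))) <= (d - c) * (eps * s)).
{ intros x Hx. rewrite <- (Rabs_pos_eq (d - c)) by lra.
  apply is_CInt_bound with (fun y => Ci * f (x, y) - Ci * P' (x, y))%C.
  - intros y. rewrite Rmin_left, Rmax_right by lra. intros Hy.
    replace (Ci * f (x, y) - Ci * P' (x, y))%C with (Ci * (f (x, y) - P' (x, y)))%C by ring.
    rewrite Cmod_mult, Cmod_Ci, Rmult_1_l. now apply Herr.
  - apply (is_RInt_minus (V := C_R_NormedModule) (fun y => Ci * f (x, y))%C
      (fun y => Ci * P' (x, y))%C).
    + apply CInt_correct. apply smooth_vertical with (1 := Hf).
      rewrite Rmin_left, Rmax_right; lra.
    + apply (is_CInt_derive_smooth (fun y => P (x, y))).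
      * intros t _. rewrite (Cmult_comm Ci).
        apply (curve_derive_comp P (fun y => (x, y))); [apply HP|apply curve_derive_vertical].
      * intros t _. exists (Ci * (l * Ci))%C. apply curve_derive_scal.
        apply (curve_derive_comp P' (fun y => (x, y))); [apply HP'|apply curve_derive_vertical]. }
assert (H1 := Hh c). assert (H2 := Hh d). assert (H3 := Hvt a). assert (H4 := Hvt b).
unfold boundary_int.
replace (horizontal_int f a b c + vertical_int f b c d
   - horizontal_int f a b d - vertical_int f a c d)%C
 with ((horizontal_int f a b c - (P (b, c) - P (a, c)))
   + (vertical_int f b c d - (P (b, d) - P (b, c)))
   + - (horizontal_int f a b d - (P (b, d) - P (a, d)))
   + - (vertical_int f a c d - (P (a, d) - P (a, c))))%C by ring.
Cmod_triangle_le.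
eapply Rle_trans; [apply Rplus_le_compat_r, Cmod_triangle|].
eapply Rle_trans; [apply Rplus_le_compat_r, Rplus_le_compat_r, Cmod_triangle|].
rewrite 2!Cmod_opp.
replace (2 * eps * s ^ 2) with (2 * ((b - a) + (d - c)) * (eps * s)) by (unfold s; ring).
lra.
Qed.

Lemma pow2_half_lt (s delta : R) : 0 < delta -> exists n : nat, s / 2 ^ n < delta.
Proof.
intros Hd.
destruct (Rle_lt_dec s 0) as [Hs|Hs].
- exists 0%nat. simpl. lra.
- destruct (Pow_x_infinity 2 ltac:(rewrite Rabs_pos_eq; lra) (s / delta + 1)) as [n Hn].
  exists n. specialize (Hn n (le_n n)).
  assert (Hp : 0 < 2 ^ n) by (apply pow_lt; lra).
  rewrite Rabs_pos_eq in Hn by lra.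
  apply Rlt_div_l; [lra|].
  assert (s / delta < 2 ^ n) by lra.
  apply Rlt_div_l in H; lra.
Qed.

(** Bisection: a rectangle violating the bound has a quarter violating it, because the boundary
    integral is additive while the right-hand side is quadratic in the size. The violating
    quarters shrink to a point, where boundary_int_small gives the contrary. *)
Lemma goursat_rect_le (f : C -> C) (a b c d eps : R) :
  a <= b -> c <= d -> 0 < eps -> holomorphic_on_rect f a b c d ->
  Cmod (boundary_int f a b c d) <= 2 * eps * ((b - a) + (d - c)) ^ 2.
Proof.
intros Hab Hcd He Hf.
apply Rnot_lt_le; intros Hbad0.
pose (p := fun n => (b - a) / 2 ^ n). pose (r := fun n => (d - c) / 2 ^ n).
assert (Hpow : forall n, 0 < 2 ^ n) by (intros; apply pow_lt; lra).
assert (Hp0 : forall n, 0 <= p n) by (intros n; apply Rle_div_r; [apply Hpow|lra]).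
assert (Hr0 : forall n, 0 <= r n) by (intros n; apply Rle_div_r; [apply Hpow|lra]).
assert (HpS : forall n, p n = 2 * p (S n))
  by (intros n; unfold p; simpl; field; apply Rgt_not_eq, Hpow).
assert (HrS : forall n, r n = 2 * r (S n))
  by (intros n; unfold r; simpl; field; apply Rgt_not_eq, Hpow).
pose (bad := fun (n : nat) (x y : R) =>
  a <= x /\ x + p n <= b /\ c <= y /\ y + r n <= d /\
  2 * eps * (p n + r n) ^ 2 < Cmod (boundary_int f x (x + p n) y (y + r n))).
assert (Hstep : forall n x y, bad n x y ->
  exists x' y', bad (S n) x' y' /\ x <= x' /\ x' + p (S n) <= x + p n
    /\ y <= y' /\ y' + r (S n) <= y + r n).
{ intros n x y (H1 & H2 & H3 & H4 & H5).
  assert (Hp := HpS n). assert (Hr := HrS n).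
  assert (Hp1 := Hp0 (S n)). assert (Hr1 := Hr0 (S n)).
  apply NNPP; intros Hno.
  assert (Hgood : forall x' y', x <= x' -> x' + p (S n) <= x + p n -> y <= y' ->
     y' + r (S n) <= y + r n ->
     Cmod (boundary_int f x' (x' + p (S n)) y' (y' + r (S n))) <= 2 * eps * (p (S n) + r (S n)) ^ 2).
  { intros x' y' G1 G2 G3 G4. apply Rnot_lt_le; intros G5. apply Hno.
    exists x', y'. unfold bad. repeat split; try lra. }
  rewrite (boundary_int_split f x (x + p (S n)) (x + p n) y (y + r (S n)) (y + r n)) in H5;
    try lra.
  2:{ subrect Hf. }
  assert (E1 : x + p n = (x + p (S n)) + p (S n)) by lra.
  assert (E2 : y + r n = (y + r (S n)) + r (S n)) by lra.
  rewrite E1, E2 in H5.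
  assert (B1 := Hgood x y). assert (B2 := Hgood (x + p (S n)) y).
  assert (B3 := Hgood x (y + r (S n))). assert (B4 := Hgood (x + p (S n)) (y + r (S n))).
  assert (T := Cmod_triangle).
  apply Rlt_not_le in H5; apply H5.
  eapply Rle_trans; [apply T|].
  eapply Rle_trans; [apply Rplus_le_compat_r, T|].
  eapply Rle_trans; [apply Rplus_le_compat_r, Rplus_le_compat_r, T|].
  rewrite Hp, Hr. nra. }
pose (T := { s : nat * (R * R) | bad (fst s) (fst (snd s)) (snd (snd s)) }).
assert (step : exists nxt : T -> T, forall s : T, let s' := nxt s in
   fst (proj1_sig s') = S (fst (proj1_sig s)) /\
   let x := fst (snd (proj1_sig s)) in let y := snd (snd (proj1_sig s)) in
   let x' := fst (snd (proj1_sig s')) in let y' := snd (snd (proj1_sig s')) in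
   let n := fst (proj1_sig s) in
   x <= x' /\ x' + p (S n) <= x + p n /\ y <= y' /\ y' + r (S n) <= y + r n).
{ assert (Hex : forall s : T, exists s' : T, fst (proj1_sig s') = S (fst (proj1_sig s)) /\
   let x := fst (snd (proj1_sig s)) in let y := snd (snd (proj1_sig s)) in
   let x' := fst (snd (proj1_sig s')) in let y' := snd (snd (proj1_sig s')) in
   let n := fst (proj1_sig s) in
   x <= x' /\ x' + p (S n) <= x + p n /\ y <= y' /\ y' + r (S n) <= y + r n).
  2:{ exists (fun s => proj1_sig (constructive_indefinite_description _ (Hex s))).
      intros s. exact (proj2_sig (constructive_indefinite_description _ (Hex s))). }
  intros [[n [x y]] Hs]; simpl in Hs.
  destruct (Hstep n x y Hs) as (x' & y' & Hb & Hrest).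
  exists (exist _ (S n, (x', y')) Hb). simpl. split; trivial. }
destruct step as [nxt Hnxt].
assert (Hbad : bad 0%nat a c).
{ unfold bad, p, r. simpl. unfold Rdiv. rewrite Rinv_1, !Rmult_1_r.
  replace (a + (b - a)) with b by ring. replace (c + (d - c)) with d by ring.
  repeat split; lra. }
pose (seq := fix seq n : T := match n with
   | O => exist _ (0%nat, (a, c)) Hbad | S m => nxt (seq m) end).
pose (xs := fun n => fst (snd (proj1_sig (seq n)))).
pose (ys := fun n => snd (snd (proj1_sig (seq n)))).
assert (Hidx : forall n, fst (proj1_sig (seq n)) = n).
{ induction n as [|n IH]; [reflexivity|].
  destruct (Hnxt (seq n)) as [E _]. rewrite IH in E. exact E. }
assert (Hbadn : forall n, bad n (xs n) (ys n)).
{ intros n. assert (H := proj2_sig (seq n)). cbv beta in H. rewrite Hidx in H. exact H. }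
assert (Hmono : forall n, xs n <= xs (S n) /\ xs (S n) + p (S n) <= xs n + p n /\
   ys n <= ys (S n) /\ ys (S n) + r (S n) <= ys n + r n).
{ intros n. destruct (Hnxt (seq n)) as [_ E]. cbv zeta in E.
  rewrite Hidx in E. exact E. }
assert (Hmon : forall n k, xs n <= xs (n + k)%nat /\ xs (n + k)%nat + p (n + k)%nat <= xs n + p n /\
   ys n <= ys (n + k)%nat /\ ys (n + k)%nat + r (n + k)%nat <= ys n + r n).
{ intros n k; induction k as [|k IH].
  - rewrite Nat.add_0_r. lra.
  - rewrite Nat.add_succ_r. assert (H := Hmono (n + k)%nat). lra. }
assert (lim : forall (z q : nat -> R), (forall n, 0 <= q n) ->
   (forall n k, z n <= z (n + k)%nat /\ z (n + k)%nat + q (n + k)%nat <= z n + q n) ->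
   exists u, forall n, z n <= u <= z n + q n).
{ intros z q Hq Hz.
  assert (Hzz : forall n m, z m <= z n + q n).
  { intros n m. destruct (Nat.le_ge_cases n m) as [Hnm|Hnm].
    - destruct (Hz n (m - n)%nat) as [_ H]. replace (n + (m - n))%nat with m in H by lia.
      specialize (Hq m). lra.
    - destruct (Hz m (n - m)%nat) as [H _]. replace (m + (n - m))%nat with n in H by lia.
      specialize (Hq n). lra. }
  destruct (completeness (fun x => exists n, x = z n)) as [u [Hu1 Hu2]].
  - exists (z 0%nat + q 0%nat). intros x [n ->]. apply Hzz.
  - exists (z 0%nat). now exists 0%nat.
  - exists u. intros n. split.
    + apply Hu1. now exists n.
    + apply Hu2. intros x [m ->]. apply Hzz. }
destruct (lim xs p Hp0) as [u Hu]; [intros n k; destruct (Hmon n k); tauto|].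
destruct (lim ys r Hr0) as [v Hv]; [intros n k; destruct (Hmon n k); tauto|].
assert (Hin : exists l, is_Cderive f (u, v) l).
{ apply Hf; rewrite Rmin_left, Rmax_right by lra.
  - destruct (Hbadn 0%nat) as (G1 & G2 & _). specialize (Hu 0%nat). lra.
  - destruct (Hbadn 0%nat) as (_ & _ & G1 & G2 & _). specialize (Hv 0%nat). lra. }
destruct Hin as [l Hl].
destruct (boundary_int_small f u v eps l He Hl) as [delta [Hd0 Hd]].
destruct (pow2_half_lt ((b - a) + (d - c)) delta Hd0) as [n Hn].
destruct (Hbadn n) as (G1 & G2 & G3 & G4 & G5).
assert (Hpn := Hp0 n). assert (Hrn := Hr0 n).
apply Rlt_not_le in G5; apply G5.
replace (p n + r n) with (xs n + p n - xs n + (ys n + r n - ys n)) by ring.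
apply Hd.
- apply Hu.
- apply Hv.
- replace (xs n + p n - xs n + (ys n + r n - ys n)) with (p n + r n) by ring.
  unfold p, r. rewrite <- Rdiv_plus_distr. exact Hn.
- subrect Hf.
Qed.

Lemma goursat_rect_ordered (f : C -> C) (a b c d : R) :
  a <= b -> c <= d -> holomorphic_on_rect f a b c d -> boundary_int f a b c d = RtoC 0.
Proof.
intros Hab Hcd Hf. apply Cmod_eq_0. apply Rle_antisym; [|apply Cmod_ge_0].
apply le_epsilon; intros eps He. rewrite Rplus_0_l.
set (s := (b - a) + (d - c)).
assert (Hs : 0 <= s ^ 2) by apply pow2_ge_0.
eapply Rle_trans.
- apply (goursat_rect_le f a b c d (eps / (2 * (s ^ 2 + 1)))); trivial.
  apply Rdiv_lt_0_compat; lra.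
- fold s. replace (2 * (eps / (2 * (s ^ 2 + 1))) * s ^ 2) with (eps * s ^ 2 / (s ^ 2 + 1))
    by (field; lra).
  apply Rle_div_l; [lra|]. nra.
Qed.

Lemma goursat_rect (f : C -> C) (a b c d : R) :
  holomorphic_on_rect f a b c d -> boundary_int f a b c d = RtoC 0.
Proof.
assert (swap_x : forall a b c d, holomorphic_on_rect f a b c d ->
  boundary_int f b a c d = (- boundary_int f a b c d)%C).
{ intros a' b' c' d' Hf. unfold boundary_int, horizontal_int.
  rewrite (CInt_swap (fun x => f (x, c')) a' b'), (CInt_swap (fun x => f (x, d')) a' b').
  - ring.
  - apply smooth_horizontal with (1 := Hf). split; [apply Rmin_r|apply Rmax_r].
  - apply smooth_horizontal with (1 := Hf). split; [apply Rmin_l|apply Rmax_l]. }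
assert (swap_y : forall a b c d, holomorphic_on_rect f a b c d ->
  boundary_int f a b d c = (- boundary_int f a b c d)%C).
{ intros a' b' c' d' Hf. unfold boundary_int, vertical_int.
  rewrite (CInt_swap (fun y => Ci * f (a', y))%C c' d'), (CInt_swap (fun y => Ci * f (b', y))%C c' d').
  - ring.
  - apply smooth_vertical with (1 := Hf). split; [apply Rmin_r|apply Rmax_r].
  - apply smooth_vertical with (1 := Hf). split; [apply Rmin_l|apply Rmax_l]. }
assert (rev_x : forall a b c d, holomorphic_on_rect f a b c d -> holomorphic_on_rect f b a c d)
  by (intros a' b' c' d' Hf x y Hx Hy; apply Hf;
      [rewrite Rmin_comm, Rmax_comm|]; assumption).
assert (rev_y : forall a b c d, holomorphic_on_rect f a b c d -> holomorphic_on_rect f a b d c)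
  by (intros a' b' c' d' Hf x y Hx Hy; apply Hf;
      [|rewrite Rmin_comm, Rmax_comm]; assumption).
assert (half : forall a b c d, a <= b -> holomorphic_on_rect f a b c d ->
  boundary_int f a b c d = RtoC 0).
{ intros a' b' c' d' Hab Hf. destruct (Rle_dec c' d') as [Hcd|Hcd].
  - now apply goursat_rect_ordered.
  - rewrite (swap_y a' b' d' c') by now apply rev_y.
    rewrite goursat_rect_ordered; [ring|trivial|lra|now apply rev_y]. }
intros Hf. destruct (Rle_dec a b) as [Hab|Hab].
- now apply half.
- rewrite (swap_x b a c d) by now apply rev_x.
  rewrite half; [ring|lra|now apply rev_x].
Qed.

(** * Primitives *)

Definition open_C (D : C -> Prop) : Prop :=
  forall z, D z -> exists r, 0 < r /\ forall y, Cmod (y - z) < r -> D y.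

(** Exactly what is needed to integrate along one horizontal and one vertical side without leaving
    the domain; satisfied by half-planes and by the whole plane. *)
Definition rect_convex (D : C -> Prop) : Prop :=
  forall x1 y1 x2 y2 x y, D (x1, y1) -> D (x2, y2) ->
    Rmin x1 x2 <= x <= Rmax x1 x2 -> Rmin y1 y2 <= y <= Rmax y1 y2 -> D (x, y).

Definition holomorphic_on (D : C -> Prop) (f : C -> C) : Prop :=
  forall z, D z -> exists l, is_Cderive f z l.

(** The primitive is the integral along a horizontal, then a vertical side. By Goursat its
    increments are again integrals along such corner paths, whatever the starting point. *)
Lemma primitive_exists (D : C -> Prop) (f : C -> C) (z0 : C) :
  D z0 -> open_C D -> rect_convex D -> holomorphic_on D f ->
  exists F : C -> C, F z0 = RtoC 0 /\ forall z, D z -> is_Cderive F z (f z).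
Proof.
destruct z0 as [x0 y0]. intros H0 Hopen Hconv Hf.
pose (F := fun z : C => (horizontal_int f x0 (Re z) y0 + vertical_int f (Re z) y0 (Im z))%C).
exists F; split.
{ unfold F, horizontal_int, vertical_int, Re, Im; simpl.
  rewrite 2!(RInt_point (V := C_R_CompleteNormedModule)).
  change (RtoC 0 + RtoC 0 = RtoC 0)%C. ring. }
assert (Hrect : forall x1 y1 x2 y2, D (x1, y1) -> D (x2, y2) ->
  holomorphic_on_rect f x1 x2 y1 y2).
{ intros x1 y1 x2 y2 H1 H2 x y Hx Hy. apply Hf. exact (Hconv x1 y1 x2 y2 x y H1 H2 Hx Hy). }
assert (Hm : forall u v, Rmin u v <= u <= Rmax u v /\ Rmin u v <= v <= Rmax u v).
{ intros u v. repeat split; [apply Rmin_l|apply Rmax_l|apply Rmin_r|apply Rmax_r]. }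
intros [x y] HD.
destruct (Hf _ HD) as [l Hl].
apply is_Cderive_eps; intros eps He.
destruct (is_Cderive_continuous_eps f (x, y) l Hl (eps / 2)) as [r1 [Hr1 Hc]]; [lra|].
destruct (Hopen _ HD) as [r2 [Hr2 HD2]].
exists (Rmin (r1 / 2) r2); split; [apply Rmin_pos; lra|].
intros [x' y'] Hz.
assert (Hz1 := Rlt_le_trans _ _ _ Hz (Rmin_l _ _)).
assert (Hz2 := Rlt_le_trans _ _ _ Hz (Rmin_r _ _)).
assert (HD' := HD2 _ Hz2).
set (dz := Cmod ((x', y') - (x, y))) in *.
assert (Hdx : Rabs (x' - x) <= dz) by exact (re_le_Cmod ((x', y') - (x, y))).
assert (Hdy : Rabs (y' - y) <= dz) by exact (im_le_Cmod ((x', y') - (x, y))).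
assert (Hxy : D (x', y)).
{ apply (Hconv x y x' y' x' y HD HD'); apply Hm. }
assert (Hxy0 : D (x', y0)).
{ apply (Hconv x0 y0 x' y x' y0 H0 Hxy); apply Hm. }
assert (HxD0 : D (x, y0)).
{ apply (Hconv x0 y0 x y x y0 H0 HD); apply Hm. }
(* F moves by the integral along the corner path through (x', y) *)
assert (Hdiff : (F (x', y') - F (x, y) = horizontal_int f x x' y + vertical_int f x' y y')%C).
{ unfold F, Re, Im; cbn [fst snd].
  assert (E1 : horizontal_int f x0 x' y0 = (horizontal_int f x0 x y0 + horizontal_int f x x' y0)%C).
  { symmetry; apply CInt_Chasles.
    - apply smooth_horizontal with (1 := Hrect _ _ _ _ H0 HxD0). apply Hm.
    - apply smooth_horizontal with (1 := Hrect _ _ _ _ HxD0 Hxy0). apply Hm. }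
  assert (E2 : vertical_int f x' y0 y' = (vertical_int f x' y0 y + vertical_int f x' y y')%C).
  { symmetry; apply CInt_Chasles.
    - apply smooth_vertical with (1 := Hrect _ _ _ _ Hxy0 Hxy). apply Hm.
    - apply smooth_vertical with (1 := Hrect _ _ _ _ Hxy HD'). apply Hm. }
  assert (E3 := goursat_rect f x x' y0 y (Hrect _ _ _ _ HxD0 Hxy)).
  unfold boundary_int in E3. rewrite E1, E2.
  replace (vertical_int f x' y0 y) with
    ((horizontal_int f x x' y0 + vertical_int f x' y0 y - horizontal_int f x x' y -
      vertical_int f x y0 y) - horizontal_int f x x' y0 + horizontal_int f x x' y +
      vertical_int f x y0 y)%C by ring.
  rewrite E3. ring. }
rewrite Hdiff.
assert (Hclose : forall u v, Rmin x x' <= u <= Rmax x x' -> Rmin y y' <= v <= Rmax y y' ->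
  Cmod (f (u, v) - f (x, y)) <= eps / 2).
{ intros u v Hu Hv. left. apply Hc.
  eapply Rle_lt_trans; [apply Cmod_le_abs|]. unfold Re, Im; simpl.
  assert (B : forall p q w, Rmin p q <= w <= Rmax p q -> Rabs (w + - p) <= Rabs (q - p)).
  { intros p q w. unfold Rmin, Rmax. destruct (Rle_dec p q); intros Hw.
    - rewrite !Rabs_pos_eq; lra.
    - rewrite !Rabs_left1; lra. }
  assert (B1 := B _ _ _ Hu). assert (B2 := B _ _ _ Hv). lra. }
assert (Hh : Cmod (horizontal_int f x x' y - RtoC (x' - x) * f (x, y)) <= Rabs (x' - x) * (eps / 2)).
{ apply is_CInt_bound with (fun t => f (t, y) - f (x, y))%C.
  - intros t Ht. apply Hclose; trivial. apply Hm.
  - replace (RtoC (x' - x) * f (x, y))%C with (scal (V := C_R_NormedModule) (x' - x) (f (x, y))).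
    + apply (is_RInt_minus (V := C_R_NormedModule) (fun t => f (t, y)) (fun _ => f (x, y))).
      * apply CInt_correct. apply smooth_horizontal with (1 := Hrect _ _ _ _ HD Hxy). apply Hm.
      * apply (is_RInt_const (V := C_R_NormedModule)).
    + apply scal_R_Cmult. }
assert (Hv : Cmod (vertical_int f x' y y' - RtoC (y' - y) * (Ci * f (x, y))) <= Rabs (y' - y) * (eps / 2)).
{ apply is_CInt_bound with (fun t => Ci * f (x', t) - Ci * f (x, y))%C.
  - intros t Ht. replace (Ci * f (x', t) - Ci * f (x, y))%C with (Ci * (f (x', t) - f (x, y)))%C by ring.
    rewrite Cmod_mult, Cmod_Ci, Rmult_1_l. apply Hclose; trivial. apply Hm.
  - replace (RtoC (y' - y) * (Ci * f (x, y)))%C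
      with (scal (V := C_R_NormedModule) (y' - y) (Ci * f (x, y))%C).
    + apply (is_RInt_minus (V := C_R_NormedModule) (fun t => Ci * f (x', t))%C
         (fun _ => Ci * f (x, y))%C).
      * apply CInt_correct. apply smooth_vertical with (1 := Hrect _ _ _ _ Hxy HD'). apply Hm.
      * apply (is_RInt_const (V := C_R_NormedModule)).
    + apply scal_R_Cmult. }
replace (horizontal_int f x x' y + vertical_int f x' y y' - f (x, y) * ((x', y') - (x, y)))%C
  with ((horizontal_int f x x' y - RtoC (x' - x) * f (x, y))
     + (vertical_int f x' y y' - RtoC (y' - y) * (Ci * f (x, y))))%C.
- Cmod_triangle_le.
  assert (Rabs (x' - x) * (eps / 2) <= dz * (eps / 2)) by (apply Rmult_le_compat_r; lra).
  assert (Rabs (y' - y) * (eps / 2) <= dz * (eps / 2)) by (apply Rmult_le_compat_r; lra).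
  lra.
- rewrite !(C_pair_decomposition x' y'), !(C_pair_decomposition x y), !RtoC_minus. ring.
Qed.

(** * Identity theorem on the right half-plane *)

Definition difference_quotient (F f : C -> C) (z y : C) : C :=
  if Ceq_dec y z then f z else ((F y - F z) / (y - z))%C.

(** At the base point z this uses that F' = f is itself differentiable there: F has a second order
    expansion, so the quotient has derivative f'(z) / 2. This is why the Cauchy formula below is
    derived for a primitive F rather than for f. *)
Lemma difference_quotient_holomorphic (D : C -> Prop) (F f : C -> C) (z : C) :
  open_C D -> holomorphic_on D f -> (forall y, D y -> is_Cderive F y (f y)) -> D z ->
  holomorphic_on D (difference_quotient F f z).
Proof.
intros Hopen Hf HF Hz y Hy.
destruct (Ceq_dec y z) as [->|Hyz].
- destruct (Hf z Hz) as [l Hl]. exists (l / 2)%C.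
  apply is_Cderive_eps; intros eps He.
  destruct (proj1 (is_Cderive_eps _ _ _) Hl eps He) as [d1 [Hd1 H1]].
  destruct (Hopen z Hz) as [d2 [Hd2 H2]].
  exists (Rmin d1 d2); split; [now apply Rmin_pos|]. intros x Hx.
  assert (Hx1 := Rlt_le_trans _ _ _ Hx (Rmin_l _ _)).
  assert (Hx2 := Rlt_le_trans _ _ _ Hx (Rmin_r _ _)).
  unfold difference_quotient. destruct (Ceq_dec z z) as [_|N]; [|now elim N].
  destruct (Ceq_dec x z) as [->|Hxz].
  { replace (f z - f z - l / 2 * (z - z))%C with (RtoC 0) by field. rewrite Cmod_0.
    apply Rmult_le_pos; [lra|apply Cmod_ge_0]. }
  assert (Hxz' : (x - z <> RtoC 0)%C)
    by (intros E; apply Hxz; replace x with (x - z + z)%C by ring; rewrite E; ring).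
  assert (Hm : 0 < Cmod (x - z)) by now apply Cmod_gt_0.
  set (K := fun y => (F y - f z * (y - z) - (l / 2) * (y - z) ^ 2)%C).
  replace ((F x - F z) / (x - z) - f z - l / 2 * (x - z))%C with ((K x - K z) / (x - z))%C
    by (unfold K; field; trivial).
  rewrite Cmod_div by trivial. apply Rle_div_l; trivial.
  assert (Hseg : forall t, 0 <= t <= 1 -> Cmod (z + RtoC t * (x - z) - z) <= Cmod (x - z)).
  { intros t Ht. replace (z + RtoC t * (x - z) - z)%C with (RtoC t * (x - z))%C by ring.
    rewrite Cmod_mult, Cmod_R, Rabs_pos_eq by lra. nra. }
  apply (segment_mean_value K (fun y => f y - f z - l * (y - z))%C z x (eps * Cmod (x - z))).
  + intros t Ht. specialize (Hseg t Ht). set (y := (z + RtoC t * (x - z))%C) in *.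
    assert (HFy := HF y (H2 y (Rle_lt_trans _ _ _ Hseg Hx2))).
    unfold K. Cderive. field.
  + intros t Ht. specialize (Hseg t Ht). set (y := (z + RtoC t * (x - z))%C) in *.
    eapply Rle_trans; [apply H1; lra|]. apply Rmult_le_compat_l; lra.
- assert (Hyz' : (y - z <> RtoC 0)%C)
    by (intros E; apply Hyz; replace y with (y - z + z)%C by ring; rewrite E; ring).
  assert (HFy := HF y Hy).
  eexists. apply is_Cderive_ext_eps with (fun y => (F y - F z) / (y - z))%C (Cmod (y - z)).
  + now apply Cmod_gt_0.
  + intros x Hx. unfold difference_quotient. destruct (Ceq_dec x z) as [->|N]; trivial.
    exfalso. rewrite <- Cmod_opp in Hx. replace (- (z - y))%C with (y - z)%C in Hx by ring. lra.
  + repeat Cderive_step. trivial.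
Qed.

Definition circle (a : C) (r t : R) : C := (a + RtoC r * Cexp (Ci * RtoC t))%C.

Lemma circle_derive (a : C) (r t : R) :
  curve_derive (circle a r) t (Ci * (circle a r t - a))%C.
Proof.
apply curve_derive_ext with (fun s => (fun z => a + RtoC r * Cexp z) (0 + RtoC s * Ci))%C.
{ intros s. unfold circle. do 3 f_equal. ring. }
replace (Ci * (circle a r t - a))%C with (RtoC r * Cexp (0 + RtoC t * Ci) * Ci)%C.
- apply (curve_derive_comp (fun z => a + RtoC r * Cexp z)%C (fun s => 0 + RtoC s * Ci)%C).
  + Cderive. ring.
  + apply curve_derive_line.
- unfold circle. replace (0 + RtoC t * Ci)%C with (Ci * RtoC t)%C by ring. ring.
Qed.

Lemma Cmod_Cexp_imag (t : R) : Cmod (Cexp (Ci * RtoC t)) = 1.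
Proof.
rewrite Cmod_Cexp. replace (Re (Ci * RtoC t)) with 0 by (unfold Re; simpl; ring). apply exp_0.
Qed.

Lemma circle_Cmod (a : C) (r t : R) : 0 <= r -> Cmod (circle a r t - a) = r.
Proof.
intros Hr. unfold circle.
replace (a + RtoC r * Cexp (Ci * RtoC t) - a)%C with (RtoC r * Cexp (Ci * RtoC t))%C by ring.
rewrite Cmod_mult, Cmod_Cexp_imag, Cmod_R, Rabs_pos_eq; lra.
Qed.

Lemma circle_closed (a : C) (r : R) : circle a r (2 * PI) = circle a r 0.
Proof.
unfold circle, Cexp, Re, Im; simpl.
replace (0 * 0 + 1 * (2 * PI)) with (2 * PI) by ring.
replace (0 * 0 + 1 * 0) with 0 by ring.
replace (0 * (2 * PI) - 1 * 0) with (0 * 0 - 1 * 0) by ring.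
now rewrite cos_2PI, sin_2PI, cos_0, sin_0.
Qed.

Lemma circle_smooth (X : C -> C) (a : C) (r : R) :
  (forall t, exists l, is_Cderive X (circle a r t) l) ->
  curve_smooth_on (fun t => X (circle a r t)) 0 (2 * PI).
Proof.
intros H t _. destruct (H t) as [l Hl].
eexists. apply (curve_derive_comp X (circle a r)); [exact Hl|apply circle_derive].
Qed.

(** The difference quotient of F at z is holomorphic in the whole domain, so it has a primitive and
    its integral over a closed curve vanishes. *)
Lemma cauchy_formula_circle (D : C -> Prop) (F f : C -> C) (a z : C) (r : R) :
  open_C D -> rect_convex D -> holomorphic_on D f -> (forall y, D y -> is_Cderive F y (f y)) ->
  (forall y, Cmod (y - a) <= r -> D y) -> Cmod (z - a) < r ->
  is_CInt (fun t => let y := circle a r t in (F y - F z) * (y - a) / (y - z))%C 0 (2 * PI) (RtoC 0).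
Proof.
intros Hopen Hconv Hf HF Hdisc Hz.
assert (Hr : 0 <= r) by (eapply Rle_trans; [apply Cmod_ge_0|left; exact Hz]).
assert (HzD : D z) by (apply Hdisc; lra).
assert (Hg := difference_quotient_holomorphic D F f z Hopen Hf HF HzD).
set (g := difference_quotient F f z) in *.
destruct (primitive_exists D g z HzD Hopen Hconv Hg) as [K [_ HK]].
assert (HDc : forall t, D (circle a r t)).
{ intros t. apply Hdisc. rewrite circle_Cmod; lra. }
assert (HI : is_CInt (fun t => g (circle a r t) * (Ci * (circle a r t - a)))%C 0 (2 * PI)
   (K (circle a r (2 * PI)) - K (circle a r 0))%C).
{ apply (is_CInt_derive_smooth (fun t => K (circle a r t))).
  - intros t _. apply (curve_derive_comp K (circle a r)).
    + now apply HK.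
    + apply circle_derive.
  - apply (circle_smooth (fun y => g y * (Ci * (y - a)))%C).
    intros t. destruct (Hg _ (HDc t)) as [l Hl].
    eexists. repeat Cderive_step. }
rewrite circle_closed in HI.
apply (is_CInt_scal (- Ci)) in HI.
replace (- Ci * (K (circle a r 0) - K (circle a r 0)))%C with (RtoC 0) in HI by ring.
apply is_CInt_ext with (2 := HI).
intros t. cbv zeta.
assert (Hne : circle a r t <> z).
{ intros E. assert (E' := circle_Cmod a r t Hr). rewrite E in E'. lra. }
unfold g, difference_quotient. destruct (Ceq_dec (circle a r t) z) as [E|_]; [now elim Hne|].
assert (circle a r t - z <> RtoC 0)%C.
{ intros E. apply Hne. replace (circle a r t) with (circle a r t - z + z)%C by ring. rewrite E; ring. }
replace (- Ci * ((F (circle a r t) - F z) / (circle a r t - z) * (Ci * (circle a r t - a))))%C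
  with (- (Ci * Ci) * ((F (circle a r t) - F z) / (circle a r t - z) * (circle a r t - a)))%C by ring.
replace (Ci * Ci)%C with (- RtoC 1)%C
  by (unfold Ci, Cmult, Copp, RtoC; simpl; f_equal; ring).
field. trivial.
Qed.

(** Makes the integral of the Cauchy kernel nonzero without evaluating it: |w| < |p| means that
    (p + w) / (p - w) has positive real part, and p / (p - w) is half of it plus 1 / 2. *)
Lemma Re_cauchy_kernel (p w : C) : Cmod w < Cmod p -> 1 / 2 <= Re (p / (p - w)).
Proof.
intros H.
assert (H2 : Cmod w ^ 2 < Cmod p ^ 2).
{ assert (Hw := Cmod_ge_0 w). nra. }
rewrite 2!Cmod2_alt in H2.
destruct p as [p1 p2]; destruct w as [w1 w2]; unfold Re, Im in *; simpl in *.
assert (Hpos : 0 < (p1 - w1) ^ 2 + (p2 - w2) ^ 2).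
{ destruct (Req_dec p1 w1) as [E1|E1]; [destruct (Req_dec p2 w2) as [E2|E2]|].
  - subst. lra.
  - assert (0 < (p2 - w2) ^ 2) by (apply pow2_gt_0; lra). assert (H' := pow2_ge_0 (p1 - w1)). lra.
  - assert (0 < (p1 - w1) ^ 2) by (apply pow2_gt_0; lra). assert (H' := pow2_ge_0 (p2 - w2)). lra. }
match goal with |- _ <= ?e =>
  replace e with ((p1 * (p1 - w1) + p2 * (p2 - w2)) / ((p1 - w1) ^ 2 + (p2 - w2) ^ 2)) end.
- apply (Rle_div_r (1 / 2) _ _ Hpos). nra.
- field. simpl in Hpos. lra.
Qed.

Lemma curve_bounded (g : R -> C) (a b : R) : curve_smooth_on g a b -> a <= b ->
  exists M, forall t, a <= t <= b -> Cmod (g t) <= M.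
Proof.
intros Hg Hab.
destruct (bounded_continuity (V := R_NormedModule) (fun t => Re (g t)) a b) as [M1 H1].
{ intros x Hx. destruct (Hg x) as [d [Hd _]]; [now rewrite Rmin_left, Rmax_right by lra|].
  apply (ex_derive_continuous (fun s => Re (g s))). eexists; exact Hd. }
destruct (bounded_continuity (V := R_NormedModule) (fun t => Im (g t)) a b) as [M2 H2].
{ intros x Hx. destruct (Hg x) as [d [_ Hd]]; [now rewrite Rmin_left, Rmax_right by lra|].
  apply (ex_derive_continuous (fun s => Im (g s))). eexists; exact Hd. }
exists (M1 + M2). intros t Ht. eapply Rle_trans; [apply Cmod_le_abs|].
apply Rplus_le_compat; left; [now apply H1|now apply H2].
Qed.

(** Up to a nonzero factor, Cauchy's formula writes F z as a Taylor polynomial at the real centre a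
    plus a remainder of order (|z - a| / r)^n. The coefficients vanish one after another, by
    letting z tend to a along the real axis, where F vanishes; so F z is a remainder of every order. *)
Lemma vanishing_on_disc (D : C -> Prop) (F f : C -> C) (a r : R) :
  open_C D -> rect_convex D -> holomorphic_on D f -> (forall y, D y -> is_Cderive F y (f y)) ->
  (forall y, Cmod (y - RtoC a) <= r -> D y) ->
  (forall x, Rabs (x - a) < r -> F (RtoC x) = RtoC 0) ->
  forall z, Cmod (z - RtoC a) < r -> F z = RtoC 0.
Proof.
intros Hopen Hconv Hf HF Hdisc Hreal.
destruct (Rle_lt_dec r 0) as [Hr0|Hr0].
{ intros z Hz. assert (H := Cmod_ge_0 (z - RtoC a)). lra. }
set (c := circle (RtoC a) r).
assert (Hcm : forall t, Cmod (c t - RtoC a) = r) by (intros t; apply circle_Cmod; lra).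
assert (HDc : forall t, D (c t)) by (intros t; apply Hdisc; rewrite Hcm; lra).
assert (Hca : forall t, (c t - RtoC a <> RtoC 0)%C).
{ intros t. apply Cmod_gt_0. rewrite Hcm; lra. }
assert (Hcz : forall z t, Cmod (z - RtoC a) < r -> r - Cmod (z - RtoC a) <= Cmod (c t - z)).
{ intros z t Hz. assert (T := Cmod_triangle (c t - z) (z - RtoC a)).
  replace (c t - z + (z - RtoC a))%C with (c t - RtoC a)%C in T by ring. rewrite Hcm in T. lra. }
assert (Hcz0 : forall z t, Cmod (z - RtoC a) < r -> (c t - z <> RtoC 0)%C).
{ intros z t Hz. apply Cmod_gt_0. assert (H := Hcz z t Hz). lra. }
assert (Hpow : forall n t, ((c t - RtoC a) ^ n <> RtoC 0)%C).
{ intros n t. apply Cmod_gt_0. rewrite Cmod_pow, Hcm. now apply pow_lt. }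
assert (Dpow : forall n y, exists l, is_Cderive (fun y => (y - RtoC a) ^ n)%C y l).
{ intros n y; induction n as [|n [l IH]].
  - exists (RtoC 0). apply (is_Cderive_const (RtoC 1)).
  - eexists. apply (is_Cderive_mult (fun y => y - RtoC a)%C (fun y => (y - RtoC a) ^ n)%C); [|exact IH].
    apply is_Cderive_sub_const. }
(* rk n is what remains of the Cauchy kernel after n steps of its geometric expansion *)
pose (rk := fun n z y => (F y * (y - RtoC a) / ((y - RtoC a) ^ n * (y - z)))%C).
pose (ck := fun n y => (F y / (y - RtoC a) ^ n)%C).
assert (Crk : forall n z, Cmod (z - RtoC a) < r ->
  is_CInt (fun t => rk n z (c t)) 0 (2 * PI) (CInt (fun t => rk n z (c t)) 0 (2 * PI))).
{ intros n z Hz. apply CInt_correct. apply (circle_smooth (rk n z)).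
  intros t. destruct (Dpow n (c t)) as [l Hl]. assert (HFt := HF _ (HDc t)).
  eexists. unfold rk. repeat Cderive_step. apply Cmult_neq_0; [apply Hpow|now apply Hcz0]. }
assert (Cck : forall n, is_CInt (fun t => ck n (c t)) 0 (2 * PI) (CInt (fun t => ck n (c t)) 0 (2 * PI))).
{ intros n. apply CInt_correct. apply (circle_smooth (ck n)).
  intros t. destruct (Dpow n (c t)) as [l Hl]. eexists.
  apply (is_Cderive_div F (fun y => (y - RtoC a) ^ n)%C); [apply Hpow|now apply HF|exact Hl]. }
set (rem := fun n z => CInt (fun t => rk n z (c t)) 0 (2 * PI)) in *.
set (coef := fun n => CInt (fun t => ck n (c t)) 0 (2 * PI)) in *.
assert (Hrec : forall n z, Cmod (z - RtoC a) < r ->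
  rem n z = (coef n + (z - RtoC a) * rem (S n) z)%C).
{ intros n z Hz. apply (is_CInt_unique (fun t => rk n z (c t)) 0 (2 * PI)); [now apply Crk|].
  apply is_CInt_ext with (fun t => ck n (c t) + (z - RtoC a) * rk (S n) z (c t))%C.
  - intros t. unfold ck, rk. simpl Cpow. field.
    repeat split; first [now apply Hcz0|apply Hca|apply Hpow].
  - apply is_CInt_plus; [apply Cck|]. apply is_CInt_scal. now apply Crk. }
destruct (curve_bounded (fun t => F (c t)) 0 (2 * PI)) as [M HM].
{ apply circle_smooth. intros t. eexists; now apply HF. }
{ assert (H := PI_RGT_0); lra. }
assert (HM0 : 0 <= M).
{ eapply Rle_trans; [|apply (HM 0)]; [apply Cmod_ge_0|]. assert (H := PI_RGT_0); lra. }
assert (HPI := PI_RGT_0).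
assert (Hbound : forall n z, Cmod (z - RtoC a) < r ->
  Cmod (rem n z) <= 2 * PI * (M * r / (r ^ n * (r - Cmod (z - RtoC a))))).
{ intros n z Hz. rewrite <- (Rabs_pos_eq (2 * PI)) by lra.
  replace (2 * PI) with (2 * PI - 0) at 1 by ring.
  apply is_CInt_bound with (fun t => rk n z (c t)); [|now apply Crk].
  intros t Ht. rewrite Rmin_left, Rmax_right in Ht by lra.
  unfold rk. rewrite Cmod_div, 2!Cmod_mult, Cmod_pow, Hcm
    by (apply Cmult_neq_0; [apply Hpow|now apply Hcz0]).
  assert (Hn : 0 < r ^ n) by now apply pow_lt.
  assert (Hd := Hcz z t Hz).
  apply Rmult_le_compat.
  - apply Rmult_le_pos; [apply Cmod_ge_0|lra].
  - left; apply Rinv_0_lt_compat, Rmult_lt_0_compat; lra.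
  - apply Rmult_le_compat_r; [lra|now apply HM].
  - apply Rinv_le_contravar; [apply Rmult_lt_0_compat; lra|].
    apply Rmult_le_compat_l; lra. }
assert (Hformula : forall z, Cmod (z - RtoC a) < r -> exists J, 0 < Re J /\ (F z * J)%C = rem 0%nat z).
{ intros z Hz.
  assert (H0 := cauchy_formula_circle D F f (RtoC a) z r Hopen Hconv Hf HF Hdisc Hz).
  cbv zeta in H0. fold c in H0.
  assert (HJ : is_CInt (fun t => (c t - RtoC a) / (c t - z))%C 0 (2 * PI)
     (CInt (fun t => (c t - RtoC a) / (c t - z))%C 0 (2 * PI))).
  { apply CInt_correct. apply (circle_smooth (fun y => (y - RtoC a) / (y - z))%C).
    intros t. eexists. repeat Cderive_step. now apply Hcz0. }
  set (J := CInt (fun t => (c t - RtoC a) / (c t - z))%C 0 (2 * PI)) in *.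
  exists J; split.
  - apply Rlt_le_trans with (scal (2 * PI - 0) (1 / 2)).
    { cbv [scal]; simpl; cbv [mult]; simpl. lra. }
    apply (is_RInt_le (fun _ => 1 / 2) (fun t => Re ((c t - RtoC a) / (c t - z))) 0 (2 * PI)).
    + lra.
    + apply (is_RInt_const (V := R_NormedModule)).
    + now apply is_CInt_Re.
    + intros t _. replace (c t - z)%C with ((c t - RtoC a) - (z - RtoC a))%C by ring.
      apply Re_cauchy_kernel. now rewrite Hcm.
  - assert (H1 := is_CInt_minus _ _ _ _ _ _ (Crk 0%nat z Hz) (is_CInt_scal (F z) _ _ _ _ HJ)).
    assert (E : (rem 0%nat z - F z * J)%C = RtoC 0).
    { eapply is_CInt_unique; [|exact H0]. apply is_CInt_ext with (2 := H1).
      intros t. unfold rk. simpl Cpow. field. now apply Hcz0. }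
    replace (rem 0%nat z) with (rem 0%nat z - F z * J + F z * J)%C by ring.
    rewrite E. ring. }
assert (Hrealm : forall x, Cmod (RtoC x - RtoC a) = Rabs (x - a)).
{ intros x. rewrite <- RtoC_minus. apply Cmod_R. }
assert (Hrem0 : forall n x, 0 < Rabs (x - a) < r -> rem n (RtoC x) = RtoC 0 /\ coef n = RtoC 0).
{ assert (Hco : forall n, (forall x, 0 < Rabs (x - a) < r -> rem n (RtoC x) = RtoC 0) -> coef n = RtoC 0).
  { intros n Hn. apply Cmod_eq_0. apply Rle_antisym; [|apply Cmod_ge_0].
    apply le_epsilon; intros eps He. rewrite Rplus_0_l.
    set (B := 2 * PI * (M * r / (r ^ S n * (r / 2)))).
    assert (HB : 0 <= B).
    { unfold B. apply Rmult_le_pos; [lra|]. apply Rle_div_r.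
      - apply Rmult_lt_0_compat; [now apply pow_lt|lra].
      - rewrite Rmult_0_l. apply Rmult_le_pos; lra. }
    set (h := Rmin (r / 2) (eps / (B + 1))).
    assert (Hh : 0 < h) by (apply Rmin_pos; [lra|apply Rdiv_lt_0_compat; lra]).
    assert (Hh1 : h <= r / 2) by apply Rmin_l.
    assert (Hh2 : h <= eps / (B + 1)) by apply Rmin_r.
    assert (Hx : Rabs (a + h - a) = h) by (replace (a + h - a) with h by ring; rewrite Rabs_pos_eq; lra).
    assert (Hz : Cmod (RtoC (a + h) - RtoC a) < r) by (rewrite Hrealm, Hx; lra).
    assert (E := Hrec n (RtoC (a + h)) Hz).
    rewrite Hn in E by (rewrite Hx; lra).
    replace (coef n) with (- ((RtoC (a + h) - RtoC a) * rem (S n) (RtoC (a + h))))%C.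
    2:{ replace (coef n) with (coef n + (RtoC (a + h) - RtoC a) * rem (S n) (RtoC (a + h))
          - (RtoC (a + h) - RtoC a) * rem (S n) (RtoC (a + h)))%C by ring. rewrite <- E. ring. }
    rewrite Cmod_opp, Cmod_mult, Hrealm, Hx.
    apply Rle_trans with (h * B).
    - apply Rmult_le_compat_l; [lra|]. eapply Rle_trans; [apply Hbound; exact Hz|].
      unfold B. apply Rmult_le_compat_l; [lra|]. apply Rmult_le_compat_l; [apply Rmult_le_pos; lra|].
      assert (0 < r ^ S n) by now apply pow_lt.
      apply Rinv_le_contravar; [apply Rmult_lt_0_compat; lra|].
      apply Rmult_le_compat_l; [lra|]. rewrite Hrealm, Hx. lra.
    - apply Rle_trans with (eps / (B + 1) * B); [apply Rmult_le_compat_r; lra|].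
      left. apply shrunk_eps_lt; trivial. }
  induction n as [|n IH].
  - assert (H0 : forall x, 0 < Rabs (x - a) < r -> rem 0%nat (RtoC x) = RtoC 0).
    { intros x Hx. destruct (Hformula (RtoC x)) as [J [_ E]]; [rewrite Hrealm; lra|].
      rewrite Hreal in E by lra. rewrite <- E. apply Cmult_0_l. }
    intros x Hx; split; [now apply H0|now apply Hco].
  - assert (H1 : forall x, 0 < Rabs (x - a) < r -> rem (S n) (RtoC x) = RtoC 0).
    { intros x Hx. destruct (IH x Hx) as [I1 I2].
      assert (E := Hrec n (RtoC x)). rewrite Hrealm in E. specialize (E (proj2 Hx)).
      rewrite I1, I2, Cplus_0_l in E. symmetry in E.
      apply Cmult_eq_0 in E. destruct E as [E|E]; trivial.
      exfalso. assert (H := Hrealm x). rewrite E, Cmod_0 in H. lra. }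
    intros x Hx; split; [now apply H1|now apply Hco]. }
assert (Hcoef : forall n, coef n = RtoC 0).
{ intros n. apply (Hrem0 n (a + r / 2)).
  replace (a + r / 2 - a) with (r / 2) by ring. rewrite Rabs_pos_eq; lra. }
intros z Hz.
assert (Hz0 := Cmod_ge_0 (z - RtoC a)).
assert (Hiter : forall n, rem 0%nat z = ((z - RtoC a) ^ n * rem n z)%C).
{ induction n as [|n IH]; [symmetry; apply Cmult_1_l|].
  rewrite IH, (Hrec n z Hz), Hcoef. simpl Cpow.
  match goal with |- ?x = ?y => change (@eq C x y) end. ring. }
assert (Hzero : rem 0%nat z = RtoC 0).
{ apply Cmod_eq_0. apply Rle_antisym; [|apply Cmod_ge_0].
  apply le_epsilon; intros eps He. rewrite Rplus_0_l.
  set (B := 2 * PI * (M * r / (r - Cmod (z - RtoC a)))).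
  assert (HB : 0 <= B).
  { unfold B. apply Rmult_le_pos; [lra|]. apply Rle_div_r; [lra|].
    rewrite Rmult_0_l. apply Rmult_le_pos; lra. }
  set (q := Cmod (z - RtoC a) / r).
  assert (Hq : 0 <= q < 1).
  { split; [apply Rle_div_r; lra|apply Rlt_div_l; lra]. }
  destruct (pow_lt_1_zero q ltac:(rewrite Rabs_pos_eq; lra) (eps / (B + 1))) as [n Hn].
  { apply Rdiv_lt_0_compat; lra. }
  specialize (Hn n (le_n n)).
  assert (Hqn : 0 <= q ^ n) by (apply pow_le; lra).
  rewrite Rabs_pos_eq in Hn by trivial.
  rewrite (Hiter n), Cmod_mult, Cmod_pow.
  assert (Hrn : 0 < r ^ n) by now apply pow_lt.
  apply Rle_trans with (Cmod (z - RtoC a) ^ n * (2 * PI * (M * r / (r ^ n * (r - Cmod (z - RtoC a)))))).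
  - apply Rmult_le_compat_l; [now apply pow_le|now apply Hbound].
  - replace (Cmod (z - RtoC a) ^ n * (2 * PI * (M * r / (r ^ n * (r - Cmod (z - RtoC a))))))
      with (q ^ n * B).
    2:{ unfold B, q, Rdiv. rewrite Rpow_mult_distr, pow_inv. field. lra. }
    apply Rle_trans with (eps / (B + 1) * B); [apply Rmult_le_compat_r; lra|].
    left. apply shrunk_eps_lt; trivial. }
destruct (Hformula z Hz) as [J [HJ E]].
rewrite Hzero in E. apply Cmult_eq_0 in E. destruct E as [E|E]; trivial.
rewrite E in HJ. simpl in HJ. lra.
Qed.

(** A primitive F of f vanishes on the axis as well. No chain of discs is needed: every point of the
    half-plane lies in a single disc contained in it and centred on the real axis. *)
Theorem identity_right_half_plane (f : C -> C) :
  holomorphic_on (fun z => 0 < Re z) f ->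
  (forall x, 0 < x -> f (RtoC x) = RtoC 0) ->
  forall z, 0 < Re z -> f z = RtoC 0.
Proof.
intros Hf Hreal.
set (D := fun z => 0 < Re z).
assert (Hopen : open_C D).
{ intros z Hz. exists (Re z); split; trivial. intros y Hy. unfold D.
  assert (H := re_le_Cmod (y - z)). apply Rabs_le_between in H.
  unfold Re in *; simpl in *. lra. }
assert (Hconv : rect_convex D).
{ intros x1 y1 x2 y2 x y H1 H2 Hx _. unfold D, Re in *; simpl in *.
  apply Rlt_le_trans with (Rmin x1 x2); [now apply Rmin_pos|tauto]. }
assert (H1 : D (RtoC 1)) by (unfold D; simpl; lra).
destruct (primitive_exists D f (RtoC 1) H1 Hopen Hconv Hf) as [F [HF1 HF]].
assert (HFreal : forall x, 0 < x -> F (RtoC x) = RtoC 0).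
{ intros x Hx.
  assert (Hpt : forall t, 0 <= t <= 1 -> (RtoC 1 + RtoC t * (RtoC x - RtoC 1))%C = RtoC (1 + t * (x - 1))).
  { intros t _. now rewrite RtoC_plus, RtoC_mult, RtoC_minus. }
  assert (Hpos : forall t, 0 <= t <= 1 -> 0 < 1 + t * (x - 1)) by (intros t Ht; nra).
  assert (H := segment_mean_value F f (RtoC 1) (RtoC x) 0).
  rewrite HF1, Rmult_0_l in H.
  replace (F (RtoC x)) with (F (RtoC x) - 0)%C by ring.
  apply Cmod_eq_0, Rle_antisym; [|apply Cmod_ge_0].
  apply H; intros t Ht; rewrite Hpt by trivial.
  - apply HF. unfold D; simpl. now apply Hpos.
  - rewrite Hreal by now apply Hpos. rewrite Cmod_0. lra. }
assert (HFzero : forall z, D z -> F z = RtoC 0).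
{ intros z Hz. unfold D in Hz.
  set (m := Cmod z ^ 2). assert (Hm := Cmod2_alt z). fold m in Hm.
  assert (Hm0 : 0 < m) by (assert (E := pow2_ge_0 (Im z)); nra).
  set (a := m / Re z).
  assert (Ha : a * Re z = m) by (unfold a; field; lra).
  assert (Ha0 : 0 < a) by (apply Rdiv_lt_0_compat; lra).
  set (d := Cmod (z - RtoC a)).
  assert (Hd0 : 0 <= d) by apply Cmod_ge_0.
  assert (Hd : d < a).
  { assert (Hd2 := Cmod2_alt (z - RtoC a)). fold d in Hd2.
    assert (E1 : Re (z - RtoC a) = Re z - a) by (unfold Re; simpl; ring).
    assert (E2 : Im (z - RtoC a) = Im z) by (unfold Im; simpl; ring).
    rewrite E1, E2 in Hd2. nra. }
  apply (vanishing_on_disc D F f a ((d + a) / 2)); trivial.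
  - intros y Hy. unfold D. assert (H := re_le_Cmod (y - RtoC a)). apply Rabs_le_between in H.
    unfold Re in *; simpl in *. lra.
  - intros x Hx. apply HFreal. apply Rabs_lt_between in Hx. lra.
  - fold d. lra. }
intros z Hz.
assert (E0 : is_Cderive F z (RtoC 0)).
{ destruct (Hopen z Hz) as [r [Hr Hr2]].
  apply is_Cderive_ext_eps with (fun _ => RtoC 0) r; [trivial| |apply is_Cderive_const].
  intros y Hy. symmetry. now apply HFzero, Hr2. }
rewrite <- (is_C_derive_unique F z (f z) (HF z Hz)).
exact (is_C_derive_unique F z (RtoC 0) E0).
Qed.

(** * Gaussian moments *)

Lemma zero_derive_const (f : R -> R) (x : R) :
  (forall t, is_derive f t 0) -> f x = f 0.
Proof.
intros H. destruct (Rtotal_order x 0) as [Hx|[->|Hx]]; trivial.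
- apply (eq_is_derive (V := R_NormedModule)); [intros; apply H|trivial].
- symmetry. apply (eq_is_derive (V := R_NormedModule)); [intros; apply H|trivial].
Qed.

Lemma RInt_0_derive (f : R -> R) (x : R) :
  (forall t, continuous f t) -> is_derive (fun y => RInt f 0 y) x (f x).
Proof.
intros H. apply (is_derive_RInt (V := R_NormedModule) f _ 0); [|apply H].
apply filter_forall; intros y. apply (RInt_correct (V := R_CompleteNormedModule)).
apply (ex_RInt_continuous (V := R_CompleteNormedModule)). intros; apply H.
Qed.

Lemma ex_RInt_ex_derive (f : R -> R) (a b : R) : (forall t, ex_derive f t) -> ex_RInt f a b.
Proof.
intros H. apply (ex_RInt_continuous (V := R_CompleteNormedModule)).
intros t _. apply (ex_derive_continuous f), H.
Qed.

Definition gauss_moment (n : nat) (a x : R) : R :=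
  RInt (fun t => t ^ n * exp (- (a * t ^ 2 / 2))) 0 x.

Lemma gauss_moment_derive (n : nat) (a x : R) :
  is_derive (gauss_moment n a) x (x ^ n * exp (- (a * x ^ 2 / 2))).
Proof.
apply (RInt_0_derive (fun t => t ^ n * exp (- (a * t ^ 2 / 2)))).
intros t. apply (ex_derive_continuous (fun t => t ^ n * exp (- (a * t ^ 2 / 2)))).
auto_derive; trivial.
Qed.

Lemma gauss_moment_0 (n : nat) (a : R) : gauss_moment n a 0 = 0.
Proof. apply (RInt_point (V := R_CompleteNormedModule)). Qed.

Lemma gauss_moment_opp (n : nat) (a x : R) :
  gauss_moment n a (- x) = (-1) ^ S n * gauss_moment n a x.
Proof.
assert (H := zero_derive_const (fun x => gauss_moment n a (- x) - (-1) ^ S n * gauss_moment n a x) x).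
cbv beta in H. rewrite Ropp_0, gauss_moment_0 in H.
apply Rminus_diag_uniq. rewrite H; [ring|].
intros t.
replace 0 with ((-1) * ((- t) ^ n * exp (- (a * (- t) ^ 2 / 2)))
   - (-1) ^ S n * (t ^ n * exp (- (a * t ^ 2 / 2)))).
- apply (is_derive_minus (fun x => gauss_moment n a (- x))).
  + apply (is_derive_comp (gauss_moment n a) (fun x => - x)); [apply gauss_moment_derive|].
    auto_derive; trivial; ring.
  + apply is_derive_scal, gauss_moment_derive.
- replace ((- t) ^ 2) with (t ^ 2) by ring.
  replace (- t) with ((-1) * t) by ring. rewrite Rpow_mult_distr. simpl. ring.
Qed.

(** Integration by parts. *)
Lemma gauss_moment_rec (n : nat) (a x : R) :
  a * gauss_moment (S (S n)) a x =
    INR (S n) * gauss_moment n a x - x ^ S n * exp (- (a * x ^ 2 / 2)).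
Proof.
assert (H := zero_derive_const (fun x => a * gauss_moment (S (S n)) a x -
    (INR (S n) * gauss_moment n a x - x ^ S n * exp (- (a * x ^ 2 / 2)))) x).
cbv beta in H. rewrite !gauss_moment_0 in H.
apply Rminus_diag_uniq. rewrite H; [simpl; ring|].
intros t.
replace 0 with (a * (t ^ S (S n) * exp (- (a * t ^ 2 / 2))) -
  (INR (S n) * (t ^ n * exp (- (a * t ^ 2 / 2))) -
    (INR (S n) * t ^ n * exp (- (a * t ^ 2 / 2))
       + t ^ S n * (- (a * t) * exp (- (a * t ^ 2 / 2)))))) by (simpl; ring).
apply (is_derive_minus (fun x => a * gauss_moment (S (S n)) a x)).
- apply is_derive_scal, gauss_moment_derive.
- apply (is_derive_minus (fun x => INR (S n) * gauss_moment n a x)).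
  + apply is_derive_scal, gauss_moment_derive.
  + auto_derive; trivial. change (Nat.pred (S n)) with n. simpl pow. unfold Rdiv.
    change (match n with 0%nat => 1 | S _ => INR n + 1 end) with (INR (S n)).
    generalize (INR (S n)) (t ^ n) (exp (- (a * (t * (t * 1)) * / 2))); intros; field.
Qed.

(** Companion of the squared error function: twice its derivative cancels that of the square, which
    gives the Gaussian integral without double integrals. *)
Definition gauss_param_int (x : R) : R :=
  RInt (fun t => exp (- (x ^ 2 * (1 + t ^ 2) / 2)) / (1 + t ^ 2)) 0 1.

Lemma one_plus_sq_pos (t : R) : 0 < 1 + t ^ 2.
Proof. assert (H := pow2_ge_0 t). lra. Qed.

Lemma gauss_param_kernel_derive (x t : R) :
  is_derive (fun x => exp (- (x ^ 2 * (1 + t ^ 2) / 2)) / (1 + t ^ 2)) x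
    (- x * exp (- (x ^ 2 * (1 + t ^ 2) / 2))).
Proof.
assert (H := one_plus_sq_pos t). auto_derive; [simpl in H; lra|]. simpl pow. unfold Rdiv.  field. simpl in H. lra.
Qed.

Lemma gauss_param_int_derive (x : R) :
  is_derive gauss_param_int x (- (exp (- (1 * x ^ 2 / 2)) * gauss_moment 0 1 x)).
Proof.
assert (H : is_derive gauss_param_int x
   (RInt (fun t => Derive (fun x => exp (- (x ^ 2 * (1 + t ^ 2) / 2)) / (1 + t ^ 2)) x) 0 1)).
{ apply (is_derive_RInt_param (fun x t => exp (- (x ^ 2 * (1 + t ^ 2) / 2)) / (1 + t ^ 2)) 0 1 x).
  - apply filter_forall; intros y t _. eexists. apply gauss_param_kernel_derive.
  - intros t _.
    apply continuity_2d_pt_ext with (fun u v => - u * exp (- (u ^ 2 * (1 + v ^ 2) / 2))).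
    { intros u v. symmetry. apply is_derive_unique, gauss_param_kernel_derive. }
    apply continuity_2d_pt_mult.
    + apply continuity_2d_pt_opp, continuity_2d_pt_id1.
    + apply (continuity_1d_2d_pt_comp exp). { apply derivable_continuous_pt, derivable_pt_exp. }
      apply continuity_2d_pt_opp. unfold Rdiv.
      apply continuity_2d_pt_mult; [|apply continuity_2d_pt_const].
      simpl. repeat (first [apply continuity_2d_pt_mult | apply continuity_2d_pt_plus
        | apply continuity_2d_pt_id1 | apply continuity_2d_pt_id2 | apply continuity_2d_pt_const]).
  - apply filter_forall; intros y. apply ex_RInt_ex_derive. intros t.
    assert (H := one_plus_sq_pos t). auto_derive. simpl in H. lra. }
replace (- (exp (- (1 * x ^ 2 / 2)) * gauss_moment 0 1 x)) with
  (RInt (fun t => Derive (fun x => exp (- (x ^ 2 * (1 + t ^ 2) / 2)) / (1 + t ^ 2)) x) 0 1); trivial.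
unfold gauss_moment.
assert (E := RInt_comp_lin (V := R_CompleteNormedModule)
  (fun t => t ^ 0 * exp (- (1 * t ^ 2 / 2))) x 0 0 1).
replace (x * 0 + 0) with 0 in E by ring. replace (x * 1 + 0) with x in E by ring.
rewrite <- E.
2:{ apply ex_RInt_ex_derive. intros t. auto_derive; trivial. }
rewrite Ropp_mult_distr_l.
rewrite <- (RInt_scal (V := R_CompleteNormedModule)).
2:{ apply ex_RInt_ex_derive. intros t.
    apply ex_derive_ext with (fun y => x * ((x * y + 0) ^ 0 * exp (- (1 * (x * y + 0) ^ 2 / 2))));
    [reflexivity|]. auto_derive; trivial. }
apply RInt_ext. intros t _.
etransitivity; [apply is_derive_unique, gauss_param_kernel_derive|].
cbv [scal]; simpl; cbv [mult]; simpl.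
replace (- (x * (x * 1) * (1 + t * (t * 1)) / 2))
  with (- (1 * (x * (x * 1)) / 2) + - (1 * ((x * t + 0) * ((x * t + 0) * 1)) / 2)) by field.
rewrite exp_plus. ring.
Qed.

Lemma gauss_square (x : R) : gauss_moment 0 1 x ^ 2 + 2 * gauss_param_int x = PI / 2.
Proof.
assert (H := zero_derive_const (fun x => gauss_moment 0 1 x ^ 2 + 2 * gauss_param_int x) x).
cbv beta in H. rewrite H.
- rewrite gauss_moment_0. unfold gauss_param_int.
  replace (RInt _ 0 1) with (PI / 4); [field|].
  symmetry. apply (is_RInt_unique (V := R_CompleteNormedModule)).
  replace (PI / 4) with (minus (atan 1) (atan 0))
    by (rewrite atan_1, atan_0; unfold minus, plus, opp; simpl; ring).
  apply (is_RInt_ext (V := R_NormedModule) (fun t => / (1 + Rsqr t))).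
  { intros t _. replace (- (0 ^ 2 * (1 + t ^ 2) / 2)) with 0 by field. rewrite exp_0.
    unfold Rsqr. simpl. unfold Rdiv. now rewrite Rmult_1_l, Rmult_1_r. }
  apply (is_RInt_derive (V := R_CompleteNormedModule) atan).
  + intros t _. apply is_derive_atan.
  + intros t _. apply (ex_derive_continuous (fun t => / (1 + Rsqr t))).
    assert (H1 := one_plus_sq_pos t). unfold Rsqr. auto_derive. simpl in H1. lra.
- intros t.
  replace 0 with (2 * (t ^ 0 * exp (- (1 * t ^ 2 / 2))) * gauss_moment 0 1 t ^ 1
    + 2 * (- (exp (- (1 * t ^ 2 / 2)) * gauss_moment 0 1 t))) by (simpl; ring).
  apply (is_derive_plus (fun x => gauss_moment 0 1 x ^ 2) (fun x => 2 * gauss_param_int x)).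
  + apply (is_derive_pow (gauss_moment 0 1) 2). apply gauss_moment_derive.
  + apply is_derive_scal, gauss_param_int_derive.
Qed.

Lemma gauss_moment_nonneg (n : nat) (a x : R) : 0 <= x -> 0 <= gauss_moment n a x.
Proof.
intros Hx. unfold gauss_moment.
apply RInt_ge_0; trivial.
- apply ex_RInt_ex_derive. intros t. auto_derive; trivial.
- intros t Ht. apply Rmult_le_pos; [apply pow_le; lra|left; apply exp_pos].
Qed.

(** Follows from gauss_square, the companion integral being at most exp (- x^2 / 2). *)
Lemma gauss_integral_error (x : R) : 0 <= x ->
  Rabs (gauss_moment 0 1 x - sqrt (PI / 2)) <= 2 * exp (- (x ^ 2 / 2)).
Proof.
intros Hx.
assert (HPI := PI2_1).
assert (Hs : 1 <= sqrt (PI / 2)).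
{ rewrite <- sqrt_1. apply sqrt_le_1_alt. lra. }
assert (Hss : sqrt (PI / 2) ^ 2 = PI / 2) by (apply pow2_sqrt; lra).
assert (Hm := gauss_moment_nonneg 0 1 x Hx).
assert (Hsq := gauss_square x).
assert (HB : 0 <= gauss_param_int x <= exp (- (x ^ 2 / 2))).
{ assert (Hex : ex_RInt (fun t => exp (- (x ^ 2 * (1 + t ^ 2) / 2)) / (1 + t ^ 2)) 0 1).
  { apply ex_RInt_ex_derive. intros t.
    assert (H := one_plus_sq_pos t). auto_derive. simpl in H. lra. }
  split.
  - apply RInt_ge_0; [lra|trivial|]. intros t _. assert (H := one_plus_sq_pos t).
    left. apply Rdiv_lt_0_compat; [apply exp_pos|trivial].
  - eapply Rle_trans; [apply Rle_abs|].
    replace (exp (- (x ^ 2 / 2))) with ((1 - 0) * exp (- (x ^ 2 / 2))) by ring.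
    apply abs_RInt_le_const; [lra|trivial|]. intros t _.
    assert (H := one_plus_sq_pos t). assert (Ht := pow2_ge_0 t). assert (Hx2 := pow2_ge_0 x).
    rewrite Rabs_pos_eq by (left; apply Rdiv_lt_0_compat; [apply exp_pos|trivial]).
    apply Rle_trans with (exp (- (x ^ 2 * (1 + t ^ 2) / 2)) / 1).
    + apply Rmult_le_compat_l; [left; apply exp_pos|]. apply Rinv_le_contravar; lra.
    + unfold Rdiv at 1. rewrite Rinv_1, Rmult_1_r. apply exp_monotone.
      assert (0 <= x ^ 2 * t ^ 2) by now apply Rmult_le_pos. nra. }
set (m := gauss_moment 0 1 x) in *. set (s := sqrt (PI / 2)) in *.
assert (E : (m - s) * (m + s) = - (2 * gauss_param_int x)) by nra.
apply Rabs_le. nra.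
Qed.

Lemma gauss_moment_scale (a x : R) : 0 < a ->
  gauss_moment 0 a x = gauss_moment 0 1 (sqrt a * x) / sqrt a.
Proof.
intros Ha. assert (Hs := sqrt_lt_R0 a Ha).
assert (H := zero_derive_const
   (fun x => gauss_moment 0 a x - gauss_moment 0 1 (sqrt a * x) / sqrt a) x).
cbv beta in H. rewrite Rmult_0_r, !gauss_moment_0 in H.
apply Rminus_diag_uniq. rewrite H; [field; lra|].
intros t.
replace 0 with (t ^ 0 * exp (- (a * t ^ 2 / 2)) -
  / sqrt a * (sqrt a * ((sqrt a * t) ^ 0 * exp (- (1 * (sqrt a * t) ^ 2 / 2))))).
- apply (is_derive_minus (gauss_moment 0 a)); [apply gauss_moment_derive|].
  apply is_derive_ext with (fun x => / sqrt a * gauss_moment 0 1 (sqrt a * x)).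
  { intros; unfold Rdiv; apply Rmult_comm. }
  apply is_derive_scal.
  apply (is_derive_comp (gauss_moment 0 1) (fun x => sqrt a * x)); [apply gauss_moment_derive|].
  auto_derive; trivial; ring.
- replace ((sqrt a * t) ^ 2) with (sqrt a ^ 2 * t ^ 2) by ring. rewrite pow2_sqrt by lra.
  rewrite (Rmult_1_l (a * t ^ 2)). generalize (exp (- (a * t ^ 2 / 2))); intros e. simpl. field. lra.
Qed.

(** The double factorial (2n - 1)!!, in the form in which it enters the expansion. *)
Definition even_moment_coeff (n : nat) : R := INR (fact (2 * n)) / (2 ^ n * INR (fact n)).

Lemma even_moment_coeff_S (n : nat) :
  even_moment_coeff (S n) = INR (S (2 * n)) * even_moment_coeff n.
Proof.
unfold even_moment_coeff. replace (2 * S n)%nat with (S (S (2 * n))) by lia.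
rewrite !fact_simpl, !mult_INR.
replace (INR (S (S (2 * n)))) with (2 * INR (S n)) by (rewrite !S_INR, mult_INR; simpl; ring).
simpl (2 ^ S n). field.
repeat split; first [apply INR_fact_neq_0|apply not_0_INR; lia|apply pow_nonzero; lra].
Qed.

(** The moments over [0, rho] differ from those over the half-line by an exponentially small amount;
    the recursion only changes the constant in front of it. *)
Lemma gauss_moment_even (rho : R) (n : nat) : 0 < rho ->
  exists K, 0 <= K /\ forall a, 1 <= a ->
    Rabs (gauss_moment (2 * n) a rho - even_moment_coeff n * sqrt (PI / 2) / (sqrt a * a ^ n))
      <= K * exp (- (a * rho ^ 2 / 2)).
Proof.
intros Hr. induction n as [|n [K [HK IH]]].
- exists 2; split; [lra|]. intros a Ha.
  assert (Hs : 1 <= sqrt a) by (rewrite <- sqrt_1; apply sqrt_le_1_alt; lra).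
  simpl (2 * 0)%nat. rewrite gauss_moment_scale by lra.
  unfold even_moment_coeff; simpl.
  replace (_ - _) with ((gauss_moment 0 1 (sqrt a * rho) - sqrt (PI / 2)) / sqrt a) by (field; lra).
  unfold Rdiv. rewrite Rabs_mult, (Rabs_pos_eq (/ sqrt a)) by (left; apply Rinv_0_lt_compat; lra).
  assert (H := gauss_integral_error (sqrt a * rho)).
  assert (H' : 0 <= sqrt a * rho) by (apply Rmult_le_pos; lra). specialize (H H').
  replace ((sqrt a * rho) ^ 2) with (sqrt a ^ 2 * rho ^ 2) in H by ring.
  rewrite pow2_sqrt in H by lra.
  assert (Hi : / sqrt a <= 1) by (rewrite <- Rinv_1; apply Rinv_le_contravar; lra).
  assert (Hi0 : 0 < / sqrt a) by (apply Rinv_0_lt_compat; lra).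
  set (e := Rabs _) in *. assert (0 <= e) by apply Rabs_pos.
  simpl in H. unfold Rdiv in H. nra.
- set (c := INR (S (2 * n))) in *.
  assert (Hc : 0 <= c) by apply pos_INR.
  exists (c * K + rho ^ S (2 * n)); split.
  { apply Rplus_le_le_0_compat; [now apply Rmult_le_pos|apply pow_le; lra]. }
  intros a Ha.
  assert (Hs : 0 < sqrt a) by (apply sqrt_lt_R0; lra).
  assert (Hn : 0 < a ^ n) by (apply pow_lt; lra).
  replace (2 * S n)%nat with (S (S (2 * n))) by lia.
  assert (E := gauss_moment_rec (2 * n) a rho). fold c in E.
  rewrite even_moment_coeff_S. fold c.
  set (m := gauss_moment (S (S (2 * n))) a rho) in *.
  set (m0 := gauss_moment (2 * n) a rho) in *.
  set (ex := exp (- (a * rho ^ 2 / 2))) in *.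
  replace (m - c * even_moment_coeff n * sqrt (PI / 2) / (sqrt a * a ^ S n))
    with ((c * (m0 - even_moment_coeff n * sqrt (PI / 2) / (sqrt a * a ^ n)) - rho ^ S (2 * n) * ex) / a).
  2:{ replace m with ((c * m0 - rho ^ S (2 * n) * ex) / a) by (rewrite <- E; field; lra).
      simpl (a ^ S n). field. repeat split; lra. }
  unfold Rdiv at 1. rewrite Rabs_mult, (Rabs_pos_eq (/ a)) by (left; apply Rinv_0_lt_compat; lra).
  assert (Hi : / a <= 1) by (rewrite <- Rinv_1; apply Rinv_le_contravar; lra).
  assert (Hi0 : 0 < / a) by (apply Rinv_0_lt_compat; lra).
  assert (Hex : 0 < ex) by apply exp_pos.
  assert (Hrn : 0 <= rho ^ S (2 * n)) by (apply pow_le; lra).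
  assert (B : Rabs (c * (m0 - even_moment_coeff n * sqrt (PI / 2) / (sqrt a * a ^ n)) - rho ^ S (2 * n) * ex)
     <= (c * K + rho ^ S (2 * n)) * ex).
  { eapply Rle_trans; [apply Rabs_triang|]. rewrite Rabs_Ropp, !Rabs_mult.
    rewrite (Rabs_pos_eq c), (Rabs_pos_eq ex), (Rabs_pos_eq (rho ^ _)) by lra.
    specialize (IH a Ha). apply (Rmult_le_compat_l c) in IH; [|exact Hc]. fold m0 ex in IH. lra. }
  set (y := Rabs _) in *. assert (0 <= y) by apply Rabs_pos. nra.
Qed.

Lemma exp_decay_pow (c : R) (n : nat) : 0 < c ->
  exists K, 0 <= K /\ forall a, 0 <= a -> exp (- (c * a)) * a ^ n <= K.
Proof.
revert c. induction n as [|n IHn]; intros c Hc.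
- exists 1; split; [lra|]. intros a Ha. simpl. rewrite Rmult_1_r.
  rewrite <- exp_0. apply exp_monotone. nra.
- destruct (IHn (c / 2)) as [K [HK HKa]]; [lra|].
  exists (K * (2 / c)); split; [apply Rmult_le_pos; [lra|]; left; apply Rdiv_lt_0_compat; lra|].
  intros a Ha.
  replace (- (c * a)) with (- (c / 2 * a) + - (c / 2 * a)) by field. rewrite exp_plus.
  simpl. replace (exp (- (c / 2 * a)) * exp (- (c / 2 * a)) * (a * a ^ n))
    with ((exp (- (c / 2 * a)) * a ^ n) * (exp (- (c / 2 * a)) * a)) by ring.
  assert (He := exp_pos (- (c / 2 * a))).
  apply Rmult_le_compat.
  + apply Rmult_le_pos; [lra|now apply pow_le].
  + apply Rmult_le_pos; lra.
  + now apply HKa.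
  + (* x <= exp x *)
    assert (H := exp_ineq1_le (c / 2 * a)).
    rewrite exp_Ropp. assert (Hp := exp_pos (c / 2 * a)).
    rewrite Rmult_comm. apply Rle_div_l; [exact Hp|].
    apply Rmult_le_reg_l with (c / 2); [lra|].
    replace (c / 2 * (2 / c * exp (c / 2 * a))) with (exp (c / 2 * a)) by (field; lra). lra.
Qed.

(** * The Lambert function on the surface *)

Definition cis (t : R) : C := (cos t, sin t).

Lemma cis_plus (s t : R) : cis (s + t) = (cis s * cis t)%C.
Proof. unfold cis, Cmult; simpl. rewrite cos_plus, sin_plus. f_equal; ring. Qed.

Lemma cis_0 : cis 0 = RtoC 1.
Proof. unfold cis, RtoC. now rewrite cos_0, sin_0. Qed.

Lemma Cexp_polar (z : C) : Cexp z = (RtoC (exp (Re z)) * cis (Im z))%C.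
Proof. unfold Cexp, cis, Cmult, RtoC; simpl. f_equal; ring. Qed.

Lemma Cmod_cis (t : R) : Cmod (cis t) = 1.
Proof.
assert (H := Cmod_Cexp (0, t)). rewrite Cexp_polar in H. simpl in H. rewrite exp_0 in H.
rewrite Cmult_1_l in H. exact H.
Qed.

Lemma cis_neq_0 (t : R) : cis t <> RtoC 0.
Proof. apply Cmod_gt_0. rewrite Cmod_cis. lra. Qed.

(** The equation is given near the positive axis only; the identity theorem carries it to the whole
    half-plane log |z| > 0. *)
Lemma lambert_equation (W : C -> C) : lambert_on_surface W ->
  forall v, 0 < Re v -> (W v * Cexp (W v))%C = Cexp v.
Proof.
intros [W0 [[Hnear _] [Hhol Hreal]]] v Hv.
assert (E := identity_right_half_plane (fun v => W v * Cexp (W v) - Cexp v)%C).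
assert (E' : (W v * Cexp (W v) - Cexp v)%C = RtoC 0).
{ apply E; trivial.
  - intros z Hz. destruct (Hhol z Hz) as [l Hl]. eexists.
    apply (is_Cderive_minus (fun v => W v * Cexp (W v))%C Cexp); [|apply is_Cderive_Cexp].
    apply (is_Cderive_mult W (fun v => Cexp (W v))%C); [exact Hl|].
    apply is_Cderive_Cexp_comp. exact Hl.
  - intros x Hx. rewrite (Hreal x Hx).
    destruct (locally_singleton _ _ (Hnear (exp x) (Rlt_le _ _ (exp_pos x)))) as [_ H].
    rewrite H, Cexp_RtoC. ring. }
replace (W v * Cexp (W v))%C with (W v * Cexp (W v) - Cexp v + Cexp v)%C by ring.
rewrite E'. ring.
Qed.

Lemma lambert_real (W : C -> C) : lambert_on_surface W ->
  forall a, 0 < a -> exists w, 0 < w /\ W (RtoC a) = RtoC w.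
Proof.
intros [W0 [[_ Hpos] [_ Hreal]]] a Ha. rewrite (Hreal a Ha). apply Hpos. apply exp_pos.
Qed.

(** In particular Im (v - W v) is a continuous determination of the argument of W v, which vanishes
    on the real axis. *)
Lemma lambert_log (W : C -> C) : lambert_on_surface W ->
  forall v, 0 < Re v -> Cexp (v - W v) = W v.
Proof.
intros HW v Hv. assert (E := lambert_equation W HW v Hv).
unfold Cminus. rewrite Cexp_plus, <- E, Cexp_opp. field. apply Cexp_neq_0.
Qed.

Lemma lambert_mod (W : C -> C) : lambert_on_surface W ->
  forall v, 0 < Re v -> Cmod (W v) = exp (Re v - Re (W v)).
Proof.
intros HW v Hv. rewrite <- (lambert_log W HW v Hv) at 1. now rewrite Cmod_Cexp.
Qed.

(** If |W v| < K then |exp v| = |W v| exp (Re (W v)) < K exp K. *)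
Lemma lambert_large (W : C -> C) (K : R) : lambert_on_surface W -> 0 < K ->
  forall v, 0 < Re v -> ln K + K < Re v -> K <= Cmod (W v).
Proof.
intros HW HK v Hv Hlarge. apply Rnot_lt_le; intros Hlt.
assert (E := lambert_mod W HW v Hv).
assert (H := Re_le_Cmod (W v)).
assert (H2 : Re v - Re (W v) < ln K).
{ apply exp_lt_inv. rewrite exp_ln by trivial. now rewrite <- E. }
lra.
Qed.

(** This makes the expansion uniform in the argument of x. If W v were close to the negative real
    axis, |exp v| = |W v| exp (Re (W v)) would be at most m exp (- eps m) with m = |W v|, hence
    bounded by 1 / eps. *)
Lemma lambert_cos (W : C -> C) (eps : R) : lambert_on_surface W -> 0 < eps ->
  forall v, 0 < Re v -> - ln eps < Re v -> - eps < cos (Im (v - W v)).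
Proof.
intros HW He v Hv Hlarge. apply Rnot_le_lt; intros Hle.
assert (E := lambert_mod W HW v Hv).
assert (Hre : Re (W v) = Cmod (W v) * cos (Im (v - W v))).
{ rewrite <- (lambert_log W HW v Hv) at 1. rewrite E. reflexivity. }
assert (Hm : 0 < Cmod (W v)) by (rewrite E; apply exp_pos).
set (m := Cmod (W v)) in *.
assert (Hre2 : Re (W v) <= - (eps * m)) by nra.
assert (Hm2 : m * exp (Re (W v)) = exp (Re v)).
{ rewrite E, <- exp_plus. f_equal. ring. }
assert (Hb : m * exp (Re (W v)) <= / eps).
{ apply Rle_trans with (m * exp (- (eps * m))).
  - apply Rmult_le_compat_l; [lra|]. now apply exp_monotone.
  - rewrite exp_Ropp. assert (Hp := exp_pos (eps * m)).
    assert (H := exp_ineq1_le (eps * m)).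
    apply Rmult_le_reg_l with eps; [lra|]. rewrite Rinv_r by lra.
    apply Rmult_le_reg_r with (exp (eps * m)); [lra|].
    replace (eps * (m * / exp (eps * m)) * exp (eps * m)) with (eps * m) by (field; lra). lra. }
rewrite Hm2 in Hb.
assert (H3 : exp (- ln eps) < exp (Re v)) by now apply exp_increasing.
rewrite exp_Ropp, exp_ln in H3 by trivial. lra.
Qed.

Lemma avoided_value_not_crossed (f : R -> R) (t y : R) :
  (forall s, continuous f s) -> (forall s, f s <> y) -> f 0 < y -> f t < y.
Proof.
intros Hc Hne H0. apply Rnot_le_lt; intros Ht.
destruct (IVT_gen f 0 t y) as [s [_ Hs]].
- intros s. apply continuity_pt_filterlim. apply Hc.
- rewrite Rmin_left, Rmax_right; lra.
- exact (Hne s Hs).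
Qed.

Lemma lambert_arg_continuous (W : C -> C) (x t : R) : lambert_on_surface W -> 0 < x ->
  continuous (fun s => Im ((x, s) - W (x, s))) t.
Proof.
intros [W0 [_ [Hhol _]]] Hx. destruct (Hhol (x, t)) as [l Hl]; [exact Hx|].
destruct (curve_derive_minus (fun s => (x, s)) (fun s => W (x, s)) t Ci (l * Ci)%C) as [_ H].
- apply curve_derive_vertical.
- apply (curve_derive_comp W (fun s => (x, s))); [exact Hl|apply curve_derive_vertical].
- apply (ex_derive_continuous (fun s => Im ((x, s) - W (x, s)))). eexists; exact H.
Qed.

Lemma lambert_arg_on_axis (W : C -> C) (x : R) : lambert_on_surface W -> 0 < x ->
  Im ((x, 0) - W (x, 0)) = 0.
Proof.
intros HW Hx. destruct (lambert_real W HW x Hx) as [w [_ E]].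
change (x, 0) with (RtoC x). rewrite E. unfold Im; simpl. ring.
Qed.

(** Along a vertical line the argument starts from 0 on the axis and cannot reach pi or - pi, where
    its cosine would be -1. *)
Lemma lambert_arg (W : C -> C) (eps : R) : lambert_on_surface W -> 0 < eps < 1 ->
  forall v, 0 < Re v -> - ln eps < Re v -> Rabs (Im (v - W v)) < PI.
Proof.
intros HW He [x t] Hv Hlarge. unfold Re in Hv, Hlarge; simpl in Hv, Hlarge.
assert (Hpi := PI_RGT_0).
set (th := fun s => Im ((x, s) - W (x, s))).
assert (Hcos : forall s, - eps < cos (th s)).
{ intros s. now apply (lambert_cos W eps HW (proj1 He) (x, s)). }
assert (Hc : forall s, continuous th s) by (intros s; now apply lambert_arg_continuous).
assert (H0 : th 0 = 0) by now apply lambert_arg_on_axis.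
change (Im ((x, t) - W (x, t))) with (th t).
apply Rabs_def1.
- apply avoided_value_not_crossed with (f := th); [trivial| |lra].
  intros s Hs. specialize (Hcos s). rewrite Hs, cos_PI in Hcos. lra.
- assert (- th t < PI); [|lra].
  apply (avoided_value_not_crossed (fun s => - th s)); [| |lra].
  + intros s. apply (continuous_opp th). apply Hc.
  + intros s Hs. specialize (Hcos s). rewrite <- cos_neg, Hs, cos_PI in Hcos. lra.
Qed.

Lemma lambda_pos (q : R) : 0 < q < 1 -> 0 < lambda q.
Proof.
intros Hq. unfold lambda. assert (H : ln q < 0) by (rewrite <- ln_1; apply ln_increasing; lra).
unfold Rdiv. rewrite Rmult_1_l, <- Rinv_opp. apply Rinv_0_lt_compat. lra.
Qed.

Lemma real_square_root (p : C) (m : R) : 0 < m -> (p * p)%C = RtoC m ->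
  Im p = 0 /\ Re p ^ 2 = m.
Proof.
destruct p as [x y]. unfold Cmult, RtoC, Re, Im; simpl. intros Hm E. injection E as E1 E2.
assert (Hxy : x * y = 0) by lra.
destruct (Rmult_integral _ _ Hxy) as [->| ->]; [nra|]. split; [trivial|lra].
Qed.

(** Collects what the analysis needs to know of omega: it is a cis th, with a large, th a principal
    argument that stays almost within the right half-plane, and log omega = (ln a, th). The given
    square root is the principal one: sq u cis (- th / 2) is a real square root of a, hence has no
    zero along a vertical line, and it is positive on the axis. *)
Lemma omega_polar (q : R) (W sq : C -> C) :
  0 < q < 1 -> lambert_on_surface W -> sqrt_omega_branch q W sq ->
  forall eps K, 0 < eps < 1 -> exists A, forall u, A < Re u -> exists a th,
    K <= a /\ 0 < a /\ Rabs th < PI /\ - eps < cos th /\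
    omega q W u = (RtoC a * cis th)%C /\
    sq u = (RtoC (sqrt a) * cis (th / 2))%C /\
    omega_arg q u = (omega q W u / RtoC (lambda q) + (ln (a / lambda q), th))%C.
Proof.
intros Hq HW [Hsq [a0 Ha0]] eps K He.
assert (Hlam := lambda_pos q Hq). set (lam := lambda q) in *.
set (K' := Rmax 1 (K / lam)).
assert (HK' : 0 < K') by (apply Rlt_le_trans with 1; [lra|apply Rmax_l]).
set (s0 := - (3 / 2) * ln q - ln lam).
exists (Rmax a0 (Rmax 0 (Rmax (ln K' + K') (- ln eps)) - s0)).
intros [x t] Hu. unfold Re in Hu; simpl in Hu.
assert (Hx1 : a0 < x) by (eapply Rle_lt_trans; [apply Rmax_l|exact Hu]).
assert (Hx2 : Rmax 0 (Rmax (ln K' + K') (- ln eps)) - s0 < x)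
  by (eapply Rle_lt_trans; [apply Rmax_r|exact Hu]).
set (y := x + s0).
assert (Hy : Rmax 0 (Rmax (ln K' + K') (- ln eps)) < y) by (unfold y; lra).
assert (Hy0 : 0 < y) by (eapply Rle_lt_trans; [apply Rmax_l|exact Hy]).
assert (Hy3 : Rmax (ln K' + K') (- ln eps) < y) by (eapply Rle_lt_trans; [apply Rmax_r|exact Hy]).
assert (Hy1 : ln K' + K' < y) by (eapply Rle_lt_trans; [apply Rmax_l|exact Hy3]).
assert (Hy2 : - ln eps < y) by (eapply Rle_lt_trans; [apply Rmax_r|exact Hy3]).
assert (Harg : forall s, omega_arg q (x, s) = (y, s)).
{ intros s. unfold omega_arg, y, s0, Cplus, RtoC; simpl. f_equal; ring. }
set (th := fun s => Im ((y, s) - W (y, s))).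
set (m := fun s => Cmod (W (y, s))).
assert (Hm : forall s, K' <= m s) by (intros s; now apply lambert_large).
assert (HWs : forall s, W (y, s) = (RtoC (m s) * cis (th s))%C).
{ intros s. rewrite <- (lambert_log W HW (y, s) Hy0) at 1. rewrite Cexp_polar.
  unfold m. rewrite (lambert_mod W HW (y, s) Hy0). reflexivity. }
assert (Hom : forall s, omega q W (x, s) = (RtoC (lam * m s) * cis (th s))%C).
{ intros s. unfold omega. fold lam. rewrite Harg, HWs, RtoC_mult. ring. }
assert (Ham : forall s, 0 < lam * m s).
{ intros s. apply Rmult_lt_0_compat; trivial. specialize (Hm s); lra. }
assert (Hth : forall s, continuous th s) by (intros s; now apply lambert_arg_continuous).
set (p := fun s => (sq (x, s) * cis (- (th s / 2)))%C).
assert (Hpp : forall s, (p s * p s)%C = RtoC (lam * m s)).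
{ intros s. unfold p. destruct (Hsq (x, s)) as [_ E]; [rewrite Harg; exact Hy0|].
  rewrite Hom in E.
  replace (sq (x, s) * cis (- (th s / 2)) * (sq (x, s) * cis (- (th s / 2))))%C
    with (sq (x, s) ^ 2 * (cis (- (th s / 2)) * cis (- (th s / 2))))%C by ring.
  rewrite E, <- cis_plus. rewrite <- Cmult_assoc, <- cis_plus.
  replace (th s + (- (th s / 2) + - (th s / 2))) with 0 by field. rewrite cis_0. ring. }
assert (Hpre : forall s, Im (p s) = 0 /\ Re (p s) ^ 2 = lam * m s)
  by (intros s; apply real_square_root; [apply Ham|apply Hpp]).
assert (Hpos : 0 < Re (p t)).
{ assert (H : - Re (p t) < 0); [|lra].
  apply (avoided_value_not_crossed (fun s => - Re (p s))).
  - intros s. apply (continuous_opp (fun s => Re (p s))).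
    destruct (Hsq (x, s)) as [Hcont _]; [rewrite Harg; exact Hy0|].
    assert (Hc1 : continuous (fun s => sq (x, s)) s).
    { apply (continuous_comp (fun s => (x, s)) sq); [|exact Hcont].
      apply (curve_derive_continuous (fun s => (x, s)) s Ci). apply curve_derive_vertical. }
    assert (Hc2 : continuous (fun s => - (th s / 2)) s).
    { apply (continuous_opp (fun s => th s / 2)).
      apply (continuous_mult th (fun _ => / 2)); [apply Hth|apply continuous_const]. }
    apply continuous_ext with (fun s => fst (sq (x, s)) * cos (- (th s / 2))
        - snd (sq (x, s)) * sin (- (th s / 2))); [reflexivity|].
    apply (continuous_minus (fun s => fst (sq (x, s)) * cos (- (th s / 2)))).
    + apply (continuous_mult (fun s => fst (sq (x, s)))).
      * apply (continuous_comp (fun s => sq (x, s)) fst); [exact Hc1|apply continuous_fst].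
      * apply (continuous_comp (fun s => - (th s / 2)) cos); [exact Hc2|apply continuous_cos].
    + apply (continuous_mult (fun s => snd (sq (x, s)))).
      * apply (continuous_comp (fun s => sq (x, s)) snd); [exact Hc1|apply continuous_snd].
      * apply (continuous_comp (fun s => - (th s / 2)) sin); [exact Hc2|apply continuous_sin].
  - intros s Hs. destruct (Hpre s) as [_ E]. specialize (Ham s).
    replace (Re (p s)) with 0 in E by lra. lra.
  - destruct (Ha0 x Hx1) as [r [Hr E]]. unfold p, th.
    rewrite (lambert_arg_on_axis W y HW Hy0).
    change (x, 0) with (RtoC x). rewrite E.
    replace (- (0 / 2)) with 0 by field. rewrite cis_0. unfold Re; simpl. lra. }
exists (lam * m t), (th t). split; [|split; [|split; [|split; [|split; [|split]]]]].
- specialize (Hm t). assert (K / lam <= m t) by (eapply Rle_trans; [apply Rmax_r|exact Hm]).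
  rewrite Rmult_comm. apply Rle_div_l in H; trivial.
- apply Ham.
- apply (lambert_arg W eps HW He (y, t)); trivial.
- apply (lambert_cos W eps HW (proj1 He) (y, t)); trivial.
- apply Hom.
- destruct (Hpre t) as [E1 E2].
  replace (RtoC (sqrt (lam * m t))) with (p t).
  + unfold p. rewrite <- Cmult_assoc, <- cis_plus.
    replace (- (th t / 2) + th t / 2) with 0 by ring. rewrite cis_0. ring.
  + rewrite <- E2, sqrt_pow2 by lra.
    destruct (p t) as [p1 p2]. unfold Re, Im, RtoC in *; simpl in *. now rewrite E1.
- rewrite Harg. unfold omega. fold lam. rewrite Harg.
  replace (RtoC lam * W (y, t) / RtoC lam)%C with (W (y, t)).
  2:{ field. intros E. apply RtoC_inj in E. lra. }
  replace (lam * m t / lam) with (m t) by (field; lra).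
  unfold m. rewrite (lambert_mod W HW (y, t) Hy0), ln_exp.
  unfold th. destruct (W (y, t)) as [w1 w2]. unfold Cplus, Re, Im; simpl. f_equal; ring.
Qed.

(** * Limits at the ends of the contour *)

(** Convergence at the end of the contour where Im z tends to y0, for every way of going there
    within a strip. *)
Definition end_limit (F : C -> C) (y0 : R) (l : C) : Prop :=
  forall eps, 0 < eps -> exists X, forall z, X < Re z -> Rabs (Im z - y0) < 1 ->
    Cmod (F z - l) < eps.

Lemma exp_decay_horizontal (F f : C -> C) (K x x' y : R) :
  0 <= K -> (forall z, is_Cderive F z (f z)) -> x <= x' ->
  (forall t, x <= t <= x' -> Cmod (f (t, y)) <= K * exp (- t)) ->
  Cmod (F (x', y) - F (x, y)) <= K * exp (- x).
Proof.
intros HK HF Hx Hf.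
apply Rle_trans with (- (K * exp (- x')) - - (K * exp (- x))).
- apply (curve_mean_value (fun t => F (t, y)) (fun t => f (t, y) * 1)%C
    (fun t => - (K * exp (- t))) (fun t => K * exp (- t))); trivial.
  + intros t _. apply (curve_derive_comp F (fun t => (t, y))); [apply HF|apply curve_derive_horizontal].
  + intros t _. auto_derive; trivial; ring.
  + intros t Ht. rewrite Cmult_1_r. now apply Hf.
- assert (0 <= K * exp (- x')) by (apply Rmult_le_pos; [trivial|left; apply exp_pos]). lra.
Qed.

Lemma exp_decay_end_limit (F f : C -> C) (y0 K x0 : R) :
  0 <= K -> (forall z, is_Cderive F z (f z)) ->
  (forall x y, x0 <= x -> Rabs (y - y0) < 1 -> Cmod (f (x, y)) <= K * exp (- x)) ->
  exists l, end_limit F y0 l.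
Proof.
intros HK HF Hf.
assert (Hh : forall x x' y, x0 <= x -> x <= x' -> Rabs (y - y0) < 1 ->
   Cmod (F (x', y) - F (x, y)) <= K * exp (- x)).
{ intros x x' y Hx Hxx Hy. apply (exp_decay_horizontal F f); trivial.
  intros t Ht. apply Hf; trivial; lra. }
assert (Hv : forall x y y', x0 <= x -> Rabs (y - y0) < 1 -> Rabs (y' - y0) < 1 ->
   Cmod (F (x, y') - F (x, y)) <= 2 * (K * exp (- x))).
{ intros x y y' Hx Hy Hy'.
  apply Rle_trans with (K * exp (- x) * Cmod ((x, y') - (x, y))).
  - assert (Hpt : forall t, ((x, y) + RtoC t * ((x, y') - (x, y)))%C = (x, y + t * (y' - y))).
    { intros t. unfold Cplus, Cminus, Cmult, RtoC; simpl. f_equal; simpl; ring. }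
    apply (segment_mean_value F f); intros t Ht; rewrite Hpt.
    + apply HF.
    + apply Hf; trivial. apply Rabs_def2 in Hy. apply Rabs_def2 in Hy'.
      assert (conv : forall p p', 0 < p -> 0 < p' -> 0 < (1 - t) * p + t * p')
        by (intros p p' Hp Hp'; destruct (Rle_dec t (1 / 2)); nra).
      assert (A1 := conv (1 - (y - y0)) (1 - (y' - y0)) ltac:(lra) ltac:(lra)).
      assert (A2 := conv (1 + (y - y0)) (1 + (y' - y0)) ltac:(lra) ltac:(lra)).
      apply Rabs_def1; lra.
  - replace ((x, y') - (x, y))%C with (RtoC (y' - y) * Ci)%C
      by (rewrite (C_pair_decomposition x y), (C_pair_decomposition x y'), RtoC_minus; ring).
    rewrite Cmod_mult, Cmod_R, Cmod_Ci, Rmult_1_r, (Rmult_comm 2).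
    apply Rmult_le_compat_l.
    + apply Rmult_le_pos; [trivial|left; apply exp_pos].
    + apply Rabs_def2 in Hy. apply Rabs_def2 in Hy'. apply Rabs_le; lra. }
assert (H0 : Rabs (y0 - y0) < 1) by (rewrite Rminus_diag, Rabs_R0; lra).
assert (Hsmall : forall eps, 0 < eps -> exists X, x0 <= X /\ forall x, X <= x -> 3 * (K * exp (- x)) < eps).
{ intros eps He. exists (Rmax x0 (- ln (eps / (3 * (K + 1))))). split; [apply Rmax_l|].
  intros x Hx. assert (Hx2 := Rle_trans _ _ _ (Rmax_r _ _) Hx).
  assert (Hp : 0 < eps / (3 * (K + 1))) by (apply Rdiv_lt_0_compat; lra).
  assert (He' : exp (- x) <= eps / (3 * (K + 1))).
  { rewrite <- (exp_ln _ Hp). apply exp_monotone. lra. }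
  assert (Hex := exp_pos (- x)).
  apply Rle_lt_trans with (3 * K * (eps / (3 * (K + 1)))); [nra|].
  replace (3 * K * (eps / (3 * (K + 1)))) with (eps / (K + 1) * K) by (field; lra).
  now apply shrunk_eps_lt. }
pose (u := fun n => F (INR n, y0)).
assert (Hcauchy : forall eps, 0 < eps -> exists N, forall n m, (N <= n)%nat -> (N <= m)%nat ->
   Cmod (u n - u m) < eps).
{ intros eps He. destruct (Hsmall eps He) as [X [HX1 HX2]].
  destruct (nfloor_ex (Rmax 0 X)) as [N0 HN0]; [apply Rmax_l|].
  exists (S N0).
  assert (Hord : forall n m, (S N0 <= n)%nat -> (n <= m)%nat -> Cmod (u m - u n) < eps).
  { intros n m Hn Hm. apply le_INR in Hn, Hm. rewrite S_INR in Hn.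
    assert (X <= INR n) by (assert (H := Rmax_r 0 X); lra).
    eapply Rle_lt_trans; [apply Hh; [lra|exact Hm|exact H0]|].
    specialize (HX2 (INR n) H). assert (He1 := exp_pos (- INR n)). nra. }
  intros n m Hn Hm. destruct (Nat.le_ge_cases n m) as [Hnm|Hnm].
  - rewrite <- Cmod_opp. replace (- (u n - u m))%C with (u m - u n)%C by ring. now apply Hord.
  - now apply Hord. }
assert (Hc : forall pr : C -> R, (forall z w, Rabs (pr z - pr w) <= Cmod (z - w)) ->
   ex_finite_lim_seq (fun n => pr (u n))).
{ intros pr Hpr. apply ex_lim_seq_cauchy_corr. intros eps.
  destruct (Hcauchy eps (cond_pos eps)) as [N HN]. exists N. intros n m Hn Hm.
  eapply Rle_lt_trans; [apply Hpr|now apply HN]. }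
destruct (Hc Re) as [l1 Hl1].
{ intros z w. replace (Re z - Re w) with (Re (z - w)) by (unfold Re; simpl; ring). apply re_le_Cmod. }
destruct (Hc Im) as [l2 Hl2].
{ intros z w. replace (Im z - Im w) with (Im (z - w)) by (unfold Im; simpl; ring). apply im_le_Cmod. }
exists (l1, l2). intros eps He.
destruct (Hsmall eps He) as [X [HX1 HX2]]. exists X.
intros [x y] Hx Hy. unfold Re in Hx; unfold Im in Hy; simpl in Hx, Hy.
assert (Hxx : X <= x) by lra. specialize (HX2 x Hxx).
assert (Hz : forall n, x <= INR n -> Cmod (F (x, y) - u n) <= 3 * (K * exp (- x))).
{ intros n Hn.
  replace (F (x, y) - u n)%C with (- (F (x, y0) - F (x, y)) + - (u n - F (x, y0)))%C by ring.
  Cmod_triangle_le. rewrite 2!Cmod_opp.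
  assert (A1 := Hv x y y0 ltac:(lra) Hy H0). assert (A2 := Hh x (INR n) y0 ltac:(lra) Hn H0).
  unfold u. lra. }
apply Rle_lt_trans with (3 * (K * exp (- x))); [|exact HX2].
apply le_epsilon; intros e He2.
assert (He4 : 0 < e / 2) by lra.
destruct (proj2 (is_lim_seq_spec _ _) Hl1 (mkposreal _ He4)) as [N1 HN1].
destruct (proj2 (is_lim_seq_spec _ _) Hl2 (mkposreal _ He4)) as [N2 HN2].
destruct (nfloor_ex (Rmax 0 x)) as [N3 HN3]; [apply Rmax_l|].
set (n := (N1 + N2 + S N3)%nat).
specialize (HN1 n ltac:(lia)). specialize (HN2 n ltac:(lia)). simpl in HN1, HN2.
assert (Hn : x <= INR n).
{ apply Rle_trans with (INR (S N3)); [|apply le_INR; lia]. rewrite S_INR.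
  assert (H := Rmax_r 0 x). lra. }
replace (F (x, y) - (l1, l2))%C with ((F (x, y) - u n) + (u n - (l1, l2)))%C by ring.
Cmod_triangle_le. apply Rplus_le_compat; [now apply Hz|].
eapply Rle_trans; [apply Cmod_le_abs|].
unfold Re, Im in *; simpl. unfold Rminus in *. lra.
Qed.

Lemma exp_decay_end_bound (F f : C -> C) (y0 K x0 : R) (l : C) :
  0 <= K -> (forall z, is_Cderive F z (f z)) ->
  (forall x, x0 <= x -> Cmod (f (x, y0)) <= K * exp (- x)) ->
  end_limit F y0 l -> Cmod (l - F (x0, y0)) <= K * exp (- x0).
Proof.
intros HK HF Hf Hl. apply le_epsilon; intros eps He.
destruct (Hl eps He) as [X HX].
set (x1 := Rmax x0 (X + 1)).
assert (Hx1 : x0 <= x1) by apply Rmax_l. assert (Hx2 : X + 1 <= x1) by apply Rmax_r.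
replace (l - F (x0, y0))%C with ((F (x1, y0) - F (x0, y0)) + - (F (x1, y0) - l))%C by ring.
Cmod_triangle_le. rewrite Cmod_opp.
apply Rplus_le_compat.
- apply (exp_decay_horizontal F f); trivial. intros t Ht. apply Hf; lra.
- left. apply HX; unfold Re, Im; simpl; [lra|]. rewrite Rminus_diag, Rabs_R0; lra.
Qed.

Lemma locally_C_eps (l : C) (P : C -> Prop) :
  locally (T := C_UniformSpace) l P -> exists e, 0 < e /\ forall z, Cmod (z - l) < e -> P z.
Proof.
intros [e He]. exists e. split; [apply cond_pos|]. intros z Hz. apply He.
split.
- eapply Rle_lt_trans; [|exact Hz]. exact (re_le_Cmod (z - l)).
- eapply Rle_lt_trans; [|exact Hz]. exact (im_le_Cmod (z - l)).
Qed.

(** The integrand is the derivative of F along the contour, so the contour enters only through its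
    two ends. *)
Lemma hankel_integral (F G : C -> C) (g : R -> C) (lp lm : C) :
  (forall z, is_Cderive F z (G z)) -> (forall z, exists l, is_Cderive G z l) ->
  hankel_contour g -> end_limit F PI lp -> end_limit F (- PI) lm ->
  RInt_gen (V := C_R_CompleteNormedModule) (fun tau => G (g tau) * path_derive g tau)%C
     (Rbar_locally m_infty) (Rbar_locally p_infty) = (lp - lm)%C.
Proof.
intros HF HG [Hd Hc Hsm Hem Hsa Hea] Hlp Hlm.
apply (is_RInt_gen_unique (V := C_R_CompleteNormedModule)).
intros P HP. destruct (locally_C_eps _ _ HP) as [e [He HPe]].
assert (He2 : 0 < e / 2) by lra.
destruct (Hlp _ He2) as [Xp HXp]. destruct (Hlm _ He2) as [Xm HXm].
assert (Hint : forall a b, is_CInt (fun tau => G (g tau) * path_derive g tau)%C a b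
   (F (g b) - F (g a))%C).
{ assert (Hg : forall t, curve_derive g t (path_derive g t)).
  { intros t. destruct (Hd t) as [D1 D2].
    split; unfold path_derive, Re, Im; simpl; now apply Derive_correct. }
  intros a b. apply (is_CInt_derive (fun t => F (g t))).
  - intros t _. apply (curve_derive_comp F g); [apply HF|apply Hg].
  - intros t _. destruct (HG (g t)) as [l Hl]. destruct (Hc t) as [C1 C2].
    destruct (curve_derive_comp G g t l _ Hl (Hg t)) as [D1 D2].
    assert (C3 := ex_derive_continuous (fun s => Re (G (g s))) t (ex_intro _ _ D1)).
    assert (C4 := ex_derive_continuous (fun s => Im (G (g s))) t (ex_intro _ _ D2)).
    split.
    + apply (continuous_minus (fun s => Re (G (g s)) * Derive (fun s => Re (g s)) s)
         (fun s => Im (G (g s)) * Derive (fun s => Im (g s)) s)).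
      * now apply (continuous_mult (fun s => Re (G (g s)))).
      * now apply (continuous_mult (fun s => Im (G (g s)))).
    + apply (continuous_plus (fun s => Re (G (g s)) * Derive (fun s => Im (g s)) s)
         (fun s => Im (G (g s)) * Derive (fun s => Re (g s)) s)).
      * now apply (continuous_mult (fun s => Re (G (g s)))).
      * now apply (continuous_mult (fun s => Im (G (g s)))). }
apply is_lim_spec in Hsm. apply is_lim_spec in Hem.
apply is_lim_spec in Hsa. apply is_lim_spec in Hea.
specialize (Hsm Xm). specialize (Hem Xp).
specialize (Hsa (mkposreal 1 Rlt_0_1)). specialize (Hea (mkposreal 1 Rlt_0_1)).
simpl in Hsm, Hem, Hsa, Hea.
assert (Hm := filter_and (F := Rbar_locally m_infty) _ _ Hsm Hsa).
assert (Hp := filter_and (F := Rbar_locally p_infty) _ _ Hem Hea).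
exists (fun tau => Xm < Re (g tau) /\ Rabs (Im (g tau) - - PI) < 1)
       (fun tau => Xp < Re (g tau) /\ Rabs (Im (g tau) - PI) < 1); trivial.
intros a b [A1 A2] [B1 B2]. exists (F (g b) - F (g a))%C. split; [apply Hint|].
apply HPe.
replace (F (g b) - F (g a) - (lp - lm))%C with ((F (g b) - lp) + - (F (g a) - lm))%C by ring.
eapply Rle_lt_trans; [apply Cmod_triangle|]. rewrite Cmod_opp.
specialize (HXp _ B1 B2). specialize (HXm _ A1 A2). lra.
Qed.

(** * Tails of the descent path *)

(** With t = omega exp s one has t - omega log t = omega (1 + psi s) up to a constant; the saddle
    point t = omega is s = 0. *)
Definition psi (s : C) : C := (Cexp s - s - 1)%C.

Definition saddle_integrand (L : R) (w s : C) : C :=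
  Cexp (w * psi s + RtoC (L / 2) * s ^ 2 + s).

Lemma saddle_integrand_holomorphic (L : R) (w s : C) :
  exists l, is_Cderive (saddle_integrand L w) s l.
Proof. eexists. unfold saddle_integrand, psi. repeat Cderive_step. Qed.

Lemma saddle_primitive (L : R) (w : C) :
  exists F, forall s, is_Cderive F s (saddle_integrand L w s).
Proof.
destruct (primitive_exists (fun _ => True) (saddle_integrand L w) (RtoC 0)) as [F [_ HF]]; trivial.
- intros z _. exists 1. split; [lra|trivial].
- intros x1 y1 x2 y2 x y. trivial.
- intros z _. apply saddle_integrand_holomorphic.
- exists F. intros s. now apply HF.
Qed.

(** The real part of cis th * psi (x, y): the integrand is small where it is negative. *)
Definition saddle_height (th x y : R) : R :=
  exp x * cos (th + y) - x * cos th + y * sin th - cos th.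

Lemma saddle_height_Re (th x y : R) : Re (cis th * psi (x, y)) = saddle_height th x y.
Proof.
unfold saddle_height, psi, Cexp, cis, Re, Im; simpl. rewrite cos_plus. ring.
Qed.

Lemma Cmod_saddle_integrand (L a th x y : R) :
  Cmod (saddle_integrand L (RtoC a * cis th) (x, y))
   = exp (a * saddle_height th x y + L / 2 * (x ^ 2 - y ^ 2) + x).
Proof.
unfold saddle_integrand. rewrite Cmod_Cexp. f_equal.
rewrite <- saddle_height_Re, <- Cmult_assoc.
generalize (cis th * psi (x, y))%C. intros [p1 p2]. unfold Re; simpl. ring.
Qed.

Lemma Cmod_saddle_integrand_le (L a th x y m : R) :
  0 <= L -> saddle_height th x y <= - m -> 0 <= a ->
  Cmod (saddle_integrand L (RtoC a * cis th) (x, y)) <= exp (- (a * m)) * exp (L / 2 * x ^ 2 + x).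
Proof.
intros HL Hh Ha. rewrite Cmod_saddle_integrand, <- exp_plus. apply exp_monotone.
assert (0 <= L / 2 * y ^ 2) by (apply Rmult_le_pos; [lra|apply pow2_ge_0]). nra.
Qed.

(** i exp (- i th / 2), the direction of steepest descent at the saddle point: cis th * e^2 = -1. *)
Definition descent_dir (th : R) : C := (sin (th / 2), cos (th / 2)).

Lemma descent_dir_cis (th : R) : descent_dir th = (Ci * cis (- (th / 2)))%C.
Proof.
unfold descent_dir, cis, Ci, Cmult; simpl. rewrite cos_neg, sin_neg. f_equal; ring.
Qed.

Lemma Cmod_descent_dir (th : R) : Cmod (descent_dir th) = 1.
Proof. rewrite descent_dir_cis, Cmod_mult, Cmod_Ci, Cmod_cis. ring. Qed.

Lemma descent_dir_sqr (th : R) : (cis th * descent_dir th ^ 2)%C = (- RtoC 1)%C.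
Proof.
rewrite descent_dir_cis.
replace (cis th * (Ci * cis (- (th / 2))) ^ 2)%C
  with (Ci ^ 2 * (cis th * (cis (- (th / 2)) * cis (- (th / 2)))))%C by ring.
rewrite <- !cis_plus. replace (th + (- (th / 2) + - (th / 2))) with 0 by field. rewrite cis_0.
unfold Ci, Cmult, Copp, RtoC; simpl. f_equal; ring.
Qed.

Lemma psi_quadratic (s : C) (r : R) : Cmod s <= r -> r < 1 ->
  Cmod (psi s - s ^ 2 / 2) <= r ^ 3 / (1 - r).
Proof.
intros Hs Hr. assert (H0 := Cmod_ge_0 s).
replace (psi s - s ^ 2 / 2)%C with (Cexp s - 1 - s - s ^ 2 / 2)%C by (unfold psi; ring).
eapply Rle_trans; [apply Cexp_taylor2|].
apply Rmult_le_compat; [apply pow_le; lra|left; apply exp_pos|apply pow_incr; lra|].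
assert (H := exp_ineq1_le (- Cmod s)). rewrite exp_Ropp in H.
assert (Hp := exp_pos (Cmod s)).
rewrite <- (Rinv_inv (exp (Cmod s))). apply Rinv_le_contravar; lra.
Qed.

(** Within rho / 8 of rho e, the quadratic part of cis th * psi is - rho^2 / 2 up to 17 / 128 rho^2,
    and the cubic remainder is at most rho^2 / 10. *)
Lemma saddle_height_local (th rho x y : R) :
  0 < rho <= 1 / 16 -> Cmod ((x, y) - RtoC rho * descent_dir th) <= rho / 8 ->
  saddle_height th x y <= - (rho ^ 2 / 4).
Proof.
intros Hr Hd. set (s := (x, y) : C) in *. set (e := descent_dir th) in *.
set (d := (s - RtoC rho * e)%C) in *.
assert (Hs : s = (RtoC rho * e + d)%C) by (unfold d; ring).
assert (He : Cmod e = 1) by apply Cmod_descent_dir.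
assert (Hd0 := Cmod_ge_0 d).
assert (Hsm : Cmod s <= 9 / 8 * rho).
{ rewrite Hs. Cmod_triangle_le.
  rewrite Cmod_mult, He, Cmod_R, Rabs_pos_eq; lra. }
assert (Hpsi := psi_quadratic s (9 / 8 * rho) Hsm ltac:(lra)).
assert (Hpsi2 : (9 / 8 * rho) ^ 3 / (1 - 9 / 8 * rho) <= 1 / 10 * rho ^ 2).
{ apply Rle_div_l; [lra|].
  replace ((9 / 8 * rho) ^ 3) with (729 / 512 * rho * rho ^ 2) by field.
  replace (1 / 10 * rho ^ 2 * (1 - 9 / 8 * rho)) with (1 / 10 * (1 - 9 / 8 * rho) * rho ^ 2) by ring.
  apply Rmult_le_compat_r; [apply pow2_ge_0|lra]. }
rewrite <- saddle_height_Re. fold s.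
set (err := (cis th * (psi s - s ^ 2 / 2) + cis th * (2 * (RtoC rho * e * d) + d ^ 2) / 2)%C).
assert (E : (cis th * psi s)%C = (RtoC (- (rho ^ 2 / 2)) + err)%C).
{ replace (RtoC (- (rho ^ 2 / 2))) with (RtoC rho ^ 2 / 2 * (cis th * e ^ 2))%C.
  2:{ unfold e. rewrite descent_dir_sqr. rewrite RtoC_opp, RtoC_div, RtoC_pow by lra. field. }
  unfold err. rewrite Hs. field. }
rewrite E.
assert (Herr : Cmod err <= 1 / 10 * rho ^ 2 + 17 / 128 * rho ^ 2).
{ unfold err. Cmod_triangle_le. apply Rplus_le_compat.
  - rewrite Cmod_mult, Cmod_cis. lra.
  - assert (N2 : RtoC 2 <> RtoC 0) by (apply RtoC_neq_0; lra).
    rewrite Cmod_div, Cmod_mult, Cmod_cis, Cmod_R, (Rabs_pos_eq 2) by (trivial; lra).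
    apply Rle_div_l; [lra|]. rewrite Rmult_1_l. Cmod_triangle_le.
    rewrite Cmod_pow, !Cmod_mult, He, !Cmod_R, (Rabs_pos_eq 2), (Rabs_pos_eq rho) by lra.
    assert (Cmod d ^ 2 <= (rho / 8) ^ 2) by (apply pow_incr; lra). nra. }
assert (H := Re_le_Cmod err).
replace (Re (RtoC (- (rho ^ 2 / 2)) + err)) with (- (rho ^ 2 / 2) + Re err) by reflexivity.
assert (0 <= rho ^ 2) by apply pow2_ge_0. lra.
Qed.

(** Since sin (phi + y) - sin phi = 2 cos (phi + y / 2) sin (y / 2), with both factors nonnegative. *)
Lemma sin_half_sum_le (phi y : R) : - (PI / 2) < phi < PI / 2 -> 0 <= y -> y <= PI - 2 * phi ->
  sin phi <= sin (phi + y).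
Proof.
intros Hphi Hy0 Hy1.
assert (E : sin (phi + y) - sin phi = 2 * cos (phi + y / 2) * sin (y / 2)).
{ rewrite form4. replace ((phi + y - phi) / 2) with (y / 2) by field.
  replace ((phi + y + phi) / 2) with (phi + y / 2) by field. ring. }
assert (0 <= cos (phi + y / 2)) by (apply cos_ge_0; lra).
assert (0 <= sin (y / 2)) by (apply sin_ge_0; lra).
assert (0 <= cos (phi + y / 2) * sin (y / 2)) by now apply Rmult_le_pos. lra.
Qed.

(** The derivative is the real part of i exp (i th / 2) (exp s - 1), at s = r e. *)
Lemma saddle_height_ray_derive (th r : R) :
  is_derive (fun r => saddle_height th (r * sin (th / 2)) (r * cos (th / 2))) r
    (sin (th / 2) - exp (r * sin (th / 2)) * sin (th / 2 + r * cos (th / 2))).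
Proof.
unfold saddle_height. auto_derive; trivial.
set (phi := th / 2). replace th with (phi + phi) by (unfold phi; field).
replace (phi + phi + r * cos phi) with (phi + (phi + r * cos phi)) by ring.
set (b := phi + r * cos phi). rewrite (sin_plus phi b), (cos_plus phi b), (sin_plus phi phi), (cos_plus phi phi).
assert (H := sin2_cos2 phi). unfold Rsqr in H.
set (E := exp _).
transitivity ((sin phi * sin phi + cos phi * cos phi) * (sin phi - E * sin b)); [|rewrite H; ring].
ring.
Qed.

Lemma decreasing_of_derive (f f' : R -> R) (a b : R) : a <= b ->
  (forall x, a <= x <= b -> is_derive f x (f' x)) -> (forall x, a <= x <= b -> f' x <= 0) ->
  f b <= f a.
Proof.
intros Hab Hf Hle.
destruct (MVT_gen f a b f') as [c [Hc1 Hc2]]; rewrite ?Rmin_left, ?Rmax_right in * by lra.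
- intros x Hx. apply Hf; lra.
- intros x Hx. apply continuity_pt_filterlim. apply (ex_derive_continuous f).
  eexists. now apply Hf.
- specialize (Hle c Hc1). nra.
Qed.

(** The straight ray in the direction of steepest descent goes downhill until it meets Im s = pi - th,
    that is arg t = pi. With phi = th / 2 and y = r cos phi the slope is sin phi - exp x sin (phi + y),
    where x = r sin phi has the sign of phi; both signs follow from sin phi <= sin (phi + y). *)
Lemma saddle_height_ray (th r0 r1 : R) :
  Rabs th < PI -> 0 <= r0 -> r0 <= r1 -> r1 * cos (th / 2) <= PI - th ->
  saddle_height th (r1 * sin (th / 2)) (r1 * cos (th / 2))
    <= saddle_height th (r0 * sin (th / 2)) (r0 * cos (th / 2)).
Proof.
intros Hth H0 H01 H1. apply Rabs_def2 in Hth.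
assert (Hcos : 0 < cos (th / 2)) by (apply cos_gt_0; lra).
apply (decreasing_of_derive (fun r => saddle_height th (r * sin (th / 2)) (r * cos (th / 2)))
  (fun r => sin (th / 2) - exp (r * sin (th / 2)) * sin (th / 2 + r * cos (th / 2)))); trivial.
- intros r _. apply saddle_height_ray_derive.
- intros r Hr. set (phi := th / 2) in *.
  assert (Hs : sin phi <= sin (phi + r * cos phi)).
  { apply sin_half_sum_le; unfold phi in *; try lra.
    - apply Rmult_le_pos; lra.
    - apply Rle_trans with (r1 * cos (th / 2)); [apply Rmult_le_compat_r; lra|lra]. }
  set (S := sin (phi + r * cos phi)) in *.
  destruct (Rle_dec 0 (sin phi)) as [Hp|Hp].
  + assert (1 <= exp (r * sin phi)).
    { rewrite <- exp_0. apply exp_monotone. apply Rmult_le_pos; lra. }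
    nra.
  + assert (exp (r * sin phi) <= 1).
    { rewrite <- exp_0. apply exp_monotone. nra. }
    assert (He := exp_pos (r * sin phi)).
    destruct (Rle_dec 0 S); nra.
Qed.

(** On the line Im s = pi - th the slope is - exp x - cos th, negative for x >= -12 since then
    exp x >= exp (-12) > - cos th. *)
Lemma saddle_height_line (th x0 x : R) : - exp (-12) < cos th -> -12 <= x0 -> x0 <= x ->
  saddle_height th x (PI - th) <= saddle_height th x0 (PI - th).
Proof.
intros Hc H0 H1.
apply (decreasing_of_derive (fun x => saddle_height th x (PI - th)) (fun x => - exp x - cos th)); trivial.
- intros t _. unfold saddle_height. auto_derive; trivial.
  replace (th + (PI - th)) with PI by ring. rewrite cos_PI. ring.
- intros t Ht. assert (exp (-12) <= exp t) by (apply exp_monotone; lra). lra.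
Qed.

Lemma poly_minus_exp_bounded (A B D E : R) : 0 < A -> 0 <= B -> 0 <= D ->
  exists K, forall x, -12 <= x -> - (A * exp x) + B * x ^ 2 + D * x + E <= K.
Proof.
intros HA HB HD.
destruct (exp_decay_pow 1 3 Rlt_0_1) as [K3 [HK3 H3]].
set (al := A / (K3 + 1)). assert (Hal : 0 < al) by (apply Rdiv_lt_0_compat; lra).
set (X := (B + D) / al + 1).
assert (HX : 1 <= X).
{ unfold X. assert (0 <= (B + D) / al) by (apply Rle_div_r; lra). lra. }
exists (B * X ^ 2 + D * X + 144 * B + Rabs E). intros x Hx.
assert (HE := Rle_abs E).
assert (Hex := exp_pos x).
destruct (Rle_dec x 0) as [Hx0|Hx0].
- assert (x ^ 2 <= 144) by nra. assert (0 <= A * exp x) by (apply Rmult_le_pos; lra).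
  assert (0 <= B * X ^ 2) by (apply Rmult_le_pos; [lra|apply pow2_ge_0]). nra.
- assert (Hal3 : al * x ^ 3 <= A * exp x).
  { specialize (H3 x ltac:(lra)). rewrite Rmult_1_l, exp_Ropp in H3.
    assert (Hx3 : x ^ 3 <= K3 * exp x).
    { apply Rmult_le_reg_l with (/ exp x); [now apply Rinv_0_lt_compat|].
      replace (/ exp x * (K3 * exp x)) with K3 by (field; lra). exact H3. }
    unfold al. apply Rle_trans with (A / (K3 + 1) * (K3 * exp x)).
    - apply Rmult_le_compat_l; [left; exact Hal|exact Hx3].
    - replace (A / (K3 + 1) * (K3 * exp x)) with (A * exp x * K3 / (K3 + 1)) by (field; lra).
      apply Rle_div_l; [lra|]. assert (0 <= A * exp x) by (apply Rmult_le_pos; lra). nra. }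
  destruct (Rle_dec x X) as [HxX|HxX].
  + assert (x ^ 2 <= X ^ 2) by (apply pow_incr; lra).
    assert (B * x ^ 2 <= B * X ^ 2) by (apply Rmult_le_compat_l; lra).
    assert (0 <= A * exp x) by (apply Rmult_le_pos; lra). nra.
  + assert (Halx : B + D <= al * x).
    { apply Rle_trans with (al * ((B + D) / al + 1)).
      - replace (al * ((B + D) / al + 1)) with (B + D + al) by (field; lra). lra.
      - apply Rmult_le_compat_l; [lra|]. fold X. lra. }
    assert (B * x ^ 2 + D * x <= al * x ^ 3).
    { assert (Hx2 : 0 <= x ^ 2) by apply pow2_ge_0.
      apply Rle_trans with ((B + D) * x ^ 2).
      { assert (x <= x ^ 2) by nra. assert (D * x <= D * x ^ 2) by (apply Rmult_le_compat_l; lra). lra. }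
      replace (al * x ^ 3) with (al * x * x ^ 2) by ring. now apply Rmult_le_compat_r. }
    assert (0 <= B * X ^ 2) by (apply Rmult_le_pos; [lra|apply pow2_ge_0]). nra.
Qed.

Lemma cos_1_ge : 1 / 2 <= cos 1.
Proof.
rewrite <- cos_PI3. assert (H := PI2_3_2). apply cos_decr_1; lra.
Qed.

(** In the strip |arg t - pi| < 1 the real part of t is at most - |t| / 2. *)
Lemma saddle_end_limit (L a th : R) (F : C -> C) :
  0 <= L -> 0 < a -> Rabs th < PI ->
  (forall s, is_Cderive F s (saddle_integrand L (RtoC a * cis th) s)) ->
  exists l, end_limit F (PI - th) l.
Proof.
intros HL Ha Hth HF. apply Rabs_def2 in Hth.
assert (HP4 := PI_4). assert (Hc1 := cos_1_ge). assert (HP := PI2_3_2).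
destruct (poly_minus_exp_bounded (a / 2) (L / 2) (a + 2) (a * 11)) as [K HK]; [lra|lra|lra|].
apply (exp_decay_end_limit F (saddle_integrand L (RtoC a * cis th)) (PI - th) (exp K) 0);
  [left; apply exp_pos|exact HF|].
intros x y Hx Hy. rewrite Cmod_saddle_integrand, <- exp_plus. apply exp_monotone.
apply Rabs_def2 in Hy.
assert (Hcos : cos (th + y) <= - (1 / 2)).
{ set (d := y - (PI - th)). replace (th + y) with (d + PI) by (unfold d; ring).
  rewrite neg_cos.
  assert (cos 1 <= cos (Rabs d)).
  { apply cos_decr_1; [apply Rabs_pos| |lra|lra|apply Rabs_le; unfold d; lra].
    apply Rle_trans with 1; [apply Rabs_le; unfold d; lra|lra]. }
  assert (Ec : cos (Rabs d) = cos d).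
  { unfold Rabs; destruct (Rcase_abs d); [apply cos_neg|reflexivity]. }
  lra. }
assert (Hex := exp_pos x).
assert (Hsb := SIN_bound th). assert (Hcb := COS_bound th).
assert (Hh : saddle_height th x y <= - (1 / 2 * exp x) + x + 11).
{ unfold saddle_height.
  assert (exp x * cos (th + y) <= exp x * - (1 / 2)) by (apply Rmult_le_compat_l; lra).
  assert (- (x * cos th) <= x) by nra.
  assert (y * sin th <= Rabs y).
  { eapply Rle_trans; [apply Rle_abs|]. rewrite Rabs_mult.
    assert (Rabs (sin th) <= 1) by (apply Rabs_le; lra). assert (H' := Rabs_pos y). nra. }
  assert (Rabs y <= 10) by (apply Rabs_le; lra). lra. }
assert (Hy2 : 0 <= L / 2 * y ^ 2) by (apply Rmult_le_pos; [lra|apply pow2_ge_0]).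
specialize (HK x ltac:(lra)).
assert (a * saddle_height th x y <= a * (- (1 / 2 * exp x) + x + 11)) by (apply Rmult_le_compat_l; lra).
lra.
Qed.

Lemma exp_m12_small : exp (-12) <= 1 / 13.
Proof.
assert (H := exp_ineq1_le 12). replace (-12) with (- (12)) by ring. rewrite exp_Ropp.
unfold Rdiv. rewrite Rmult_1_l. apply Rinv_le_contravar; lra.
Qed.

(** Bounds the length of the ray: it meets Im s = pi - th at distance (pi - th) / cos (th / 2), which
    is less than 12. This is where the constant -12 comes from. *)
Lemma cos_half_lower (th : R) : Rabs th < PI -> - exp (-12) < cos th -> 2 / 3 < cos (th / 2).
Proof.
intros Hth Hc. apply Rabs_def2 in Hth. assert (He := exp_m12_small).
assert (Hcos : 0 < cos (th / 2)) by (apply cos_gt_0; lra).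
assert (E : cos th = 2 * cos (th / 2) * cos (th / 2) - 1).
{ rewrite <- cos_2a_cos. f_equal. field. }
nra.
Qed.

(** The path goes from s to the nearby point rho e of the ray, along the ray to the line Im s = pi - th,
    then along this line to infinity. The height stays below - rho^2 / 4 on all of it. On the last part
    one unit of a is set aside, so that - exp x absorbs the quadratic growth of Re (L s^2 / 2). *)
Lemma upper_tail (L rho : R) : 0 <= L -> 0 < rho <= 1 / 16 ->
  exists K, 0 <= K /\ forall a th F l s,
    1 <= a -> Rabs th < PI -> - exp (-12) < cos th ->
    (forall s, is_Cderive F s (saddle_integrand L (RtoC a * cis th) s)) ->
    end_limit F (PI - th) l ->
    Cmod (s - RtoC rho * descent_dir th) <= rho / 8 ->
    Cmod (l - F s) <= K * exp (- (a * (rho ^ 2 / 4))).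
Proof.
intros HL Hr.
destruct (poly_minus_exp_bounded 1 (L / 2) 3 33) as [B HB]; [lra|lra|lra|].
set (M := exp (L / 2 * 144 + 12)).
set (m := rho ^ 2 / 4).
assert (HM : 0 < M) by apply exp_pos.
exists (M + 12 * M + exp (B + 12 + m)). split.
{ assert (H := exp_pos (B + 12 + m)). lra. }
intros a th F l s Ha Hth Hc HF Hl Hs.
assert (Hcos := cos_half_lower th Hth Hc).
assert (Hth' := Rabs_def2 _ _ Hth).
assert (HP4 := PI_4). assert (HP := PI2_3_2). assert (Hc1 := cos_1_ge).
set (e := descent_dir th) in *.
assert (He : Cmod e = 1) by apply Cmod_descent_dir.
set (r1 := (PI - th) / cos (th / 2)).
assert (Hr1 : r1 * cos (th / 2) = PI - th) by (unfold r1; field; lra).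
assert (Hr1u : r1 <= 12) by nra.
assert (Hsin := SIN_bound (th / 2)).
assert (Hgap : 1 / 16 < PI - th).
{ apply Rnot_le_lt; intros Hle.
  assert (cos 1 <= cos (PI - th)) by (apply cos_decr_1; lra).
  assert (E : cos (PI - th) = - cos th).
  { replace (PI - th) with (- th + PI) by ring. now rewrite neg_cos, cos_neg. }
  assert (Hsm := exp_m12_small). lra. }
assert (Hr1l : 1 / 16 <= r1).
{ assert (Hcb := COS_bound (th / 2)). apply Rnot_lt_le; intros Hlt. nra. }
set (p0 := (RtoC rho * e)%C). set (p1 := (RtoC r1 * e)%C).
set (x1 := r1 * sin (th / 2)).
assert (Ep1 : p1 = (x1, PI - th)).
{ unfold p1, e, descent_dir, x1. rewrite <- Hr1. unfold Cmult, RtoC; simpl. f_equal; ring. }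
assert (Hx1 : -12 <= x1) by (unfold x1; nra).
set (Ex := exp (- (a * m))). assert (HEx : 0 < Ex) by apply exp_pos.
assert (Hbound : forall x y, saddle_height th x y <= - m -> Rabs x <= 12 ->
  Cmod (saddle_integrand L (RtoC a * cis th) (x, y)) <= Ex * M).
{ intros x y Hh Hx. eapply Rle_trans; [apply Cmod_saddle_integrand_le with (m := m); lra|].
  apply Rmult_le_compat_l; [lra|]. apply exp_monotone.
  assert (Hx' := Rle_abs x).
  assert (x ^ 2 <= 144). { rewrite <- (Rabs_pos_eq (x ^ 2)) by apply pow2_ge_0.
    rewrite <- RPow_abs. assert (Hax := Rabs_pos x). nra. }
  assert (L / 2 * x ^ 2 <= L / 2 * 144) by (apply Rmult_le_compat_l; lra). lra. }
assert (S1 : Cmod (F p0 - F s) <= Ex * M).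
{ assert (Hnear : forall t, 0 <= t <= 1 -> Cmod (s + RtoC t * (p0 - s) - p0) <= rho / 8).
  { intros t Ht. replace (s + RtoC t * (p0 - s) - p0)%C with (RtoC (1 - t) * (s - p0))%C
      by (rewrite RtoC_minus; ring).
    rewrite Cmod_mult, Cmod_R, Rabs_pos_eq by lra. unfold p0 in *.
    assert (Hsp := Cmod_ge_0 (s - RtoC rho * e)). nra. }
  apply Rle_trans with (Ex * M * Cmod (p0 - s)).
  - apply (segment_mean_value F (saddle_integrand L (RtoC a * cis th))); intros t Ht; [apply HF|].
    specialize (Hnear t Ht). destruct (s + RtoC t * (p0 - s))%C as [x y].
    apply Hbound; [now apply saddle_height_local|].
    assert (Hx := re_le_Cmod (x, y)).
    assert (Cmod (x, y) <= rho / 8 + rho).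
    { replace (x, y) with (((x, y) - p0) + p0)%C by ring.
      Cmod_triangle_le. unfold p0 at 2.
      rewrite Cmod_mult, He, Cmod_R, Rabs_pos_eq by lra. lra. }
    unfold Re in Hx; simpl in Hx. lra.
  - rewrite <- Cmod_opp. replace (- (p0 - s))%C with (s - p0)%C by ring.
    unfold p0. rewrite <- (Rmult_1_r (Ex * M)) at 2. apply Rmult_le_compat_l; [|lra].
    apply Rmult_le_pos; lra. }
assert (Hray : forall r, rho <= r <= r1 ->
  saddle_height th (r * sin (th / 2)) (r * cos (th / 2)) <= - m).
{ intros r Hrr. eapply Rle_trans; [apply (saddle_height_ray th rho r)|]; trivial; try lra.
  - rewrite <- Hr1. apply Rmult_le_compat_r; lra.
  - apply saddle_height_local; trivial.
    replace (((rho * sin (th / 2))%R, (rho * cos (th / 2))%R) - RtoC rho * descent_dir th)%C with (RtoC 0).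
    + rewrite Cmod_0. lra.
    + unfold descent_dir, Cminus, Cplus, Copp, Cmult, RtoC; simpl. f_equal; ring. }
assert (S2 : Cmod (F p1 - F p0) <= 12 * (Ex * M)).
{ apply Rle_trans with (Ex * M * Cmod (p1 - p0)).
  - apply (segment_mean_value F (saddle_integrand L (RtoC a * cis th))); intros t Ht; [apply HF|].
    set (r := rho + t * (r1 - rho)).
    replace (p0 + RtoC t * (p1 - p0))%C with (r * sin (th / 2), r * cos (th / 2)).
    2:{ unfold p0, p1, e, descent_dir, r, Cminus, Cplus, Copp, Cmult, RtoC; simpl. f_equal; ring. }
    assert (rho <= r <= r1) by (unfold r; nra).
    apply Hbound; [now apply Hray|]. rewrite Rabs_mult, (Rabs_pos_eq r) by lra.
    assert (Rabs (sin (th / 2)) <= 1) by (apply Rabs_le; lra).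
    assert (H' := Rabs_pos (sin (th / 2))). nra.
  - replace (p1 - p0)%C with (RtoC (r1 - rho) * e)%C by (unfold p0, p1; rewrite RtoC_minus; ring).
    rewrite Cmod_mult, He, Cmod_R, Rabs_pos_eq by lra.
    assert (0 <= Ex * M) by (apply Rmult_le_pos; lra). nra. }
assert (S3 : Cmod (l - F p1) <= exp (B + 12 + m) * Ex).
{ rewrite Ep1.
  apply Rle_trans with (exp (B - (a - 1) * m) * exp (- x1)).
  - apply (exp_decay_end_bound F (saddle_integrand L (RtoC a * cis th))); trivial.
    + left; apply exp_pos.
    + intros x Hx. rewrite Cmod_saddle_integrand, <- exp_plus. apply exp_monotone.
      assert (Hh : saddle_height th x (PI - th) <= - m).
      { eapply Rle_trans; [apply (saddle_height_line th x1 x); trivial|].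
        unfold x1. rewrite <- Hr1. apply Hray. lra. }
      assert (Hh2 : saddle_height th x (PI - th) <= - exp x + x + 33).
      { unfold saddle_height. replace (th + (PI - th)) with PI by ring. rewrite cos_PI.
        assert (Hsb := SIN_bound th). assert (Hcb := COS_bound th).
        assert (- (x * cos th) <= x + 24).
        { destruct (Rle_dec 0 x); nra. }
        assert ((PI - th) * sin th <= 8) by nra. lra. }
      assert (Hy2 : 0 <= L / 2 * (PI - th) ^ 2) by (apply Rmult_le_pos; [lra|apply pow2_ge_0]).
      specialize (HB x ltac:(lra)).
      assert ((a - 1) * saddle_height th x (PI - th) <= (a - 1) * - m) by (apply Rmult_le_compat_l; lra).
      lra.
  - unfold Ex. rewrite <- !exp_plus. apply exp_monotone. lra. }
replace (l - F s)%C with ((l - F p1) + (F p1 - F p0) + (F p0 - F s))%C by ring.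
Cmod_triangle_le.
eapply Rle_trans; [apply Rplus_le_compat_r, Cmod_triangle|].
fold m Ex. lra.
Qed.

(** * Reflection in the real axis *)

Lemma is_Cderive_conj (F : C -> C) (z l : C) :
  is_Cderive F (Cconj z) l -> is_Cderive (fun s => Cconj (F (Cconj s))) z (Cconj l).
Proof.
intros HF. apply is_Cderive_eps; intros eps He.
destruct (proj1 (is_Cderive_eps _ _ _) HF eps He) as [d [Hd H]].
exists d; split; trivial. intros y Hy.
assert (E : forall u v, (Cconj u - Cconj v)%C = Cconj (u - v)).
{ intros [u1 u2] [v1 v2]. unfold Cconj, Cminus, Cplus, Copp; simpl. f_equal; ring. }
assert (E' : forall u v, (Cconj u * Cconj v)%C = Cconj (u * v)).
{ intros [u1 u2] [v1 v2]. unfold Cconj, Cmult; simpl. f_equal; ring. }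
assert (Ec : Cmod (Cconj y - Cconj z) = Cmod (y - z)) by (rewrite E; apply Cmod_conj).
specialize (H (Cconj y)). rewrite Ec in H. specialize (H Hy).
replace (Cconj (F (Cconj y)) - Cconj (F (Cconj z)) - Cconj l * (y - z))%C
  with (Cconj (F (Cconj y) - F (Cconj z) - l * (Cconj y - Cconj z))).
- rewrite Cmod_conj. exact H.
- rewrite <- !E, <- E', <- E, !Cconj_conj. reflexivity.
Qed.

Lemma saddle_integrand_conj (L a th : R) (s : C) :
  Cconj (saddle_integrand L (RtoC a * cis th) (Cconj s))
    = saddle_integrand L (RtoC a * cis (- th)) s.
Proof.
assert (Hexp : forall z, Cconj (Cexp z) = Cexp (Cconj z)).
{ intros [x y]. unfold Cexp, Cconj, Re, Im; simpl. rewrite cos_neg, sin_neg. f_equal; ring. }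
unfold saddle_integrand, psi. rewrite Hexp. f_equal.
rewrite 2!Cplus_conj, !Cmult_conj, !Cminus_conj, Cpow_conj, Hexp, !Cconj_conj.
replace (Cconj (cis th)) with (cis (- th))
  by (unfold cis, Cconj; simpl; rewrite cos_neg, sin_neg; reflexivity).
replace (Cconj (RtoC a)) with (RtoC a) by (unfold Cconj, RtoC; simpl; f_equal; ring).
replace (Cconj (RtoC (L / 2))) with (RtoC (L / 2)) by (unfold Cconj, RtoC; simpl; f_equal; ring).
replace (Cconj (RtoC 1)) with (RtoC 1) by (unfold Cconj, RtoC; simpl; f_equal; ring).
reflexivity.
Qed.

Lemma end_limit_conj (F : C -> C) (y0 : R) (l : C) :
  end_limit F (- y0) l -> end_limit (fun s => Cconj (F (Cconj s))) y0 (Cconj l).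
Proof.
intros H eps He. destruct (H eps He) as [X HX]. exists X. intros [x y] Hx Hy.
replace (Cconj (F (Cconj (x, y))) - Cconj l)%C with (Cconj (F (Cconj (x, y)) - l)).
- rewrite Cmod_conj. apply HX; [exact Hx|]. unfold Cconj, Im in *; simpl in *.
  replace (- y - - y0) with (- (y - y0)) by ring. now rewrite Rabs_Ropp.
- unfold Cconj, Cminus, Cplus, Copp; simpl. f_equal; ring.
Qed.

Lemma Cmod_conj_sub_descent_dir (s : C) (rho th : R) :
  Cmod (Cconj s - RtoC rho * descent_dir (- th)) = Cmod (s + RtoC rho * descent_dir th).
Proof.
rewrite <- (Cmod_conj (s + _)). f_equal. destruct s as [x y].
unfold descent_dir, Cconj, Cminus, Cplus, Copp, Cmult, RtoC; simpl.
replace (- th / 2) with (- (th / 2)) by field. rewrite sin_neg, cos_neg. f_equal; ring.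
Qed.

(** Reflection in the real axis exchanges th and - th, and the two ends of the contour. *)
Lemma lower_tail (L rho : R) : 0 <= L -> 0 < rho <= 1 / 16 ->
  exists K, 0 <= K /\ forall a th F l s,
    1 <= a -> Rabs th < PI -> - exp (-12) < cos th ->
    (forall s, is_Cderive F s (saddle_integrand L (RtoC a * cis th) s)) ->
    end_limit F (- (PI + th)) l ->
    Cmod (s + RtoC rho * descent_dir th) <= rho / 8 ->
    Cmod (l - F s) <= K * exp (- (a * (rho ^ 2 / 4))).
Proof.
intros HL Hr. destruct (upper_tail L rho HL Hr) as [K [HK H]].
exists K; split; trivial. intros a th F l s Ha Hth Hc HF Hl Hs.
replace (Cmod (l - F s)) with (Cmod (Cconj l - Cconj (F (Cconj (Cconj s))))).
- apply (H a (- th) (fun s => Cconj (F (Cconj s))) (Cconj l) (Cconj s)); trivial.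
  + now rewrite Rabs_Ropp.
  + now rewrite cos_neg.
  + intros z. rewrite <- saddle_integrand_conj. apply is_Cderive_conj. apply HF.
  + replace (PI - - th) with (PI + th) by ring. now apply end_limit_conj.
  + now rewrite Cmod_conj_sub_descent_dir.
- rewrite Cconj_conj.
  replace (Cconj l - Cconj (F s))%C with (Cconj (l - F s)).
  + apply Cmod_conj.
  + unfold Cconj, Cminus, Cplus, Copp; simpl. f_equal; ring.
Qed.

Lemma saddle_end_limit_lower (L a th : R) (F : C -> C) :
  0 <= L -> 0 < a -> Rabs th < PI ->
  (forall s, is_Cderive F s (saddle_integrand L (RtoC a * cis th) s)) ->
  exists l, end_limit F (- (PI + th)) l.
Proof.
intros HL Ha Hth HF.
destruct (saddle_end_limit L a (- th) (fun s => Cconj (F (Cconj s)))) as [l Hl]; trivial.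
- now rewrite Rabs_Ropp.
- intros z. rewrite <- saddle_integrand_conj. apply is_Cderive_conj. apply HF.
- exists (Cconj l). intros eps He.
  replace (PI - - th) with (- - (PI + th)) in Hl by ring.
  destruct (end_limit_conj _ _ _ Hl eps He) as [X HX]. exists X. intros z Hz1 Hz2.
  specialize (HX z Hz1 Hz2). now rewrite !Cconj_conj in HX.
Qed.

(** * Contribution of the saddle point *)

Fixpoint power_partial_sum (a : nat -> C) (z : C) (n : nat) : C :=
  match n with
  | O => RtoC 0
  | S m => (power_partial_sum a z m + a m * z ^ m)%C
  end.

Lemma pow_n_Cpow (z : C) (n : nat) : pow_n (K := C_AbsRing) z n = (z ^ n)%C.
Proof. induction n as [|n IH]; [reflexivity|]. simpl. now rewrite IH. Qed.

Lemma sum_n_power_partial_sum (a : nat -> C) (z : C) (n : nat) :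
  sum_n (G := C_NormedModule) (fun k => scal (pow_n (K := C_AbsRing) z k) (a k)) n
    = power_partial_sum a z (S n).
Proof.
induction n as [|n IH].
- rewrite sum_O. simpl. rewrite Cplus_0_l. apply Cmult_comm.
- rewrite sum_Sn, IH.
  change (power_partial_sum a z (S n) + pow_n (K := C_AbsRing) z (S n) * a (S n)
    = power_partial_sum a z (S n) + a (S n) * z ^ S n)%C.
  rewrite (pow_n_Cpow z (S n)). ring.
Qed.

Lemma is_pseries_partial_sum (a : nat -> C) (z l : C) :
  is_pseries (K := C_AbsRing) (V := C_NormedModule) a z l ->
  forall eps, 0 < eps -> exists N, forall n, (N <= n)%nat -> Cmod (power_partial_sum a z n - l) < eps.
Proof.
intros H eps He.
assert (HP : locally (T := C_NormedModule) l (fun y => Cmod (y - l) < eps)).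
{ exists (mkposreal (eps / 2) ltac:(lra)). intros y [H1 H2].
  eapply Rle_lt_trans; [apply Cmod_le_abs|].
  change (Rabs (Re (y - l)) < eps / 2) in H1. change (Rabs (Im (y - l)) < eps / 2) in H2. lra. }
destruct (H _ HP) as [N HN]. exists (S N). intros n Hn. destruct n as [|n]; [lia|].
rewrite <- sum_n_power_partial_sum. apply HN. lia.
Qed.

Lemma eventually_bounded (u : nat -> R) (N : nat) (B : R) :
  (forall n, (N <= n)%nat -> u n <= B) -> exists B', forall n, u n <= B'.
Proof.
revert B. induction N as [|N IH]; intros B H.
- exists B. intros n. apply H. lia.
- apply (IH (Rmax B (u N))). intros n Hn. destruct (Nat.eq_dec n N) as [->|Hne].
  + apply Rmax_r.
  + eapply Rle_trans; [apply H; lia|apply Rmax_l].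
Qed.

(** The terms are bounded at some radius r > 0, hence dominated by a geometric series for |z| <= r / 2. *)
Lemma power_series_remainder (a : nat -> C) (f : C -> C) :
  taylor_coeffs_at_0 f a -> forall M, exists K r, 0 <= K /\ 0 < r /\
    forall z, Cmod z <= r -> Cmod (f z - power_partial_sum a z M) <= K * Cmod z ^ M.
Proof.
intros H M. destruct (locally_C_eps _ _ H) as [r0 [Hr0 Hf]].
set (r := r0 / 2).
assert (Hr : 0 < r) by (unfold r; lra).
assert (Hz1 : is_pseries (K := C_AbsRing) (V := C_NormedModule) a (RtoC r) (f (RtoC r))).
{ apply Hf. replace (RtoC r - RtoC 0)%C with (RtoC r) by ring.
  rewrite Cmod_R, Rabs_pos_eq; unfold r; lra. }
destruct (is_pseries_partial_sum _ _ _ Hz1 1 Rlt_0_1) as [N HN].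
destruct (eventually_bounded (fun n => Cmod (a n) * r ^ n) N 2) as [B HB].
{ intros n Hn. rewrite <- (Rabs_pos_eq (r ^ n)) by (apply pow_le; lra).
  rewrite <- Cmod_R, <- Cmod_mult, RtoC_pow.
  assert (H1 := HN n Hn). assert (H2 := HN (S n) ltac:(lia)).
  replace (a n * RtoC r ^ n)%C with ((power_partial_sum a (RtoC r) (S n) - f (RtoC r))
    + - (power_partial_sum a (RtoC r) n - f (RtoC r)))%C by (simpl; ring).
  Cmod_triangle_le. rewrite Cmod_opp. lra. }
assert (HB0 : 0 <= B).
{ eapply Rle_trans; [|apply (HB 0%nat)]. simpl. rewrite Rmult_1_r. apply Cmod_ge_0. }
exists (2 * B / r ^ M), (r / 2).
assert (HrM : 0 < r ^ M) by now apply pow_lt.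
split; [apply Rle_div_r; lra|split; [lra|]].
intros z Hz. assert (Hz0 := Cmod_ge_0 z).
set (t := Cmod z / r).
assert (Ht : 0 <= t <= 1 / 2).
{ split; [apply Rle_div_r; lra|apply Rle_div_l; lra]. }
assert (Hterm : forall n, Cmod (a n * z ^ n) <= B * t ^ n).
{ intros n. rewrite Cmod_mult, Cmod_pow.
  replace (Cmod z ^ n) with (r ^ n * t ^ n).
  - rewrite <- Rmult_assoc. apply Rmult_le_compat_r; [apply pow_le; lra|apply HB].
  - rewrite <- Rpow_mult_distr. f_equal. unfold t. field. lra. }
assert (Hsum : forall n, Cmod (power_partial_sum a z (M + n) - power_partial_sum a z M)
   <= B * t ^ M * (2 * (1 - (1 / 2) ^ n))).
{ induction n as [|n IH].
  - rewrite Nat.add_0_r. unfold Cminus. rewrite Cplus_opp_r, Cmod_0. simpl. lra.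
  - rewrite Nat.add_succ_r. simpl power_partial_sum.
    replace (power_partial_sum a z (M + n) + a (M + n)%nat * z ^ (M + n) - power_partial_sum a z M)%C
     with ((power_partial_sum a z (M + n) - power_partial_sum a z M) + a (M + n)%nat * z ^ (M + n))%C
      by ring.
    Cmod_triangle_le.
    assert (H1 := Hterm (M + n)%nat). rewrite pow_add in H1.
    assert (H2 : t ^ n <= (1 / 2) ^ n) by (apply pow_incr; lra).
    assert (H3 : 0 <= B * t ^ M) by (apply Rmult_le_pos; [lra|apply pow_le; lra]).
    simpl ((1 / 2) ^ S n).
    assert (B * (t ^ M * t ^ n) <= B * t ^ M * (1 / 2) ^ n).
    { rewrite <- Rmult_assoc. now apply Rmult_le_compat_l. }
    lra. }
replace (2 * B / r ^ M * Cmod z ^ M) with (B * t ^ M * 2).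
2:{ unfold t, Rdiv. rewrite Rpow_mult_distr, pow_inv. field. lra. }
apply le_epsilon; intros eps He.
assert (Hfz : is_pseries (K := C_AbsRing) (V := C_NormedModule) a z (f z)).
{ apply Hf. replace (z - RtoC 0)%C with z by ring. unfold r in Hz. lra. }
destruct (is_pseries_partial_sum _ _ _ Hfz eps He) as [N' HN'].
specialize (HN' (M + N')%nat ltac:(lia)). specialize (Hsum N').
replace (f z - power_partial_sum a z M)%C with
  ((power_partial_sum a z (M + N') - power_partial_sum a z M)
   + - (power_partial_sum a z (M + N') - f z))%C by ring.
Cmod_triangle_le. rewrite Cmod_opp.
apply Rplus_le_compat; [|lra]. eapply Rle_trans; [exact Hsum|].
apply Rmult_le_compat_l; [apply Rmult_le_pos; [lra|apply pow_le; lra]|].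
assert (0 <= (1 / 2) ^ N') by (apply pow_le; lra). lra.
Qed.

Lemma power_series_coeff_0 (a : nat -> C) (f : C -> C) : taylor_coeffs_at_0 f a -> a 0%nat = f (RtoC 0).
Proof.
intros H. destruct (power_series_remainder a f H 1) as (K & r & HK & Hr & Hb).
specialize (Hb (RtoC 0)). rewrite Cmod_0 in Hb. simpl in Hb.
rewrite Rmult_0_l, Rmult_0_r in Hb. specialize (Hb ltac:(lra)).
assert (E : (f 0 - (0 + a 0%nat * 1))%C = RtoC 0).
{ apply Cmod_eq_0, Rle_antisym; [exact Hb|apply Cmod_ge_0]. }
replace (a 0%nat) with (f 0 - (f 0 - (0 + a 0%nat * 1)))%C by ring. rewrite E. ring.
Qed.

(** The logarithm of 1 - ell. The equation of ell says that psi (saddle_chart ell sigma) = sigma^2 / 2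
    near 0, so that the exponent becomes quadratic in sigma. *)
Definition saddle_chart (ell : C -> C) (sigma : C) : C := (- ell sigma - sigma ^ 2 / 2)%C.

(** In the variable sigma the integrand is - exp (w sigma^2 / 2) V (sigma): differentiating
    exp s = 1 - ell sigma gives exp s ds = - ell' d sigma, and log T = s turns (log T)^2 into
    ell^2 + sigma^2 ell + sigma^4 / 4. *)
Lemma saddle_chart_germ (q : R) (ell : C -> C) : ell_germ ell ->
  exists r, 0 < r /\ forall sigma, Cmod sigma < r ->
    Cmod (saddle_chart ell sigma + sigma) <= Cmod sigma / 8 /\
    exists l, is_Cderive (saddle_chart ell) sigma l /\
      forall w, (saddle_integrand (lambda q) w (saddle_chart ell sigma) * l)%C
        = (- (Cexp (w * (sigma ^ 2 / 2)) * V_fun q ell sigma))%C.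
Proof.
intros [Hholo H0 H1 Heq].
destruct (locally_C_eps _ _ Hholo) as [r1 [Hr1 Hh]].
destruct (locally_C_eps _ _ Heq) as [r2 [Hr2 He]].
assert (sub0 : forall z : C, (z - RtoC 0)%C = z) by (intros; ring).
setoid_rewrite sub0 in Hh. setoid_rewrite sub0 in He.
assert (Hd : forall z, Cmod z < r1 -> is_Cderive ell z (C_derive ell z)).
{ intros z Hz. apply C_derive_correct; [exact z|]. now apply Hh. }
assert (Hd0 : is_Cderive ell (RtoC 0) (RtoC 1)).
{ rewrite <- H1. apply Hd. rewrite Cmod_0; trivial. }
destruct (proj1 (is_Cderive_eps _ _ _) Hd0 (1 / 16) ltac:(lra)) as [r3 [Hr3 Hlin]].
set (r := Rmin (Rmin r1 r2) (Rmin r3 (1 / 8))).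
assert (Hrr : r <= r1 /\ r <= r2 /\ r <= r3 /\ r <= 1 / 8).
{ unfold r, Rmin. repeat destruct Rle_dec; lra. }
exists r; split; [repeat apply Rmin_pos; lra|].
assert (Hexp : forall z, Cmod z < r -> Cexp (saddle_chart ell z) = (1 - ell z)%C).
{ intros z Hz. unfold saddle_chart. unfold Cminus at 1. rewrite Cexp_plus, Cexp_opp.
  rewrite <- He by lra. field. apply Cexp_neq_0. }
intros z Hz. assert (Hz0 := Cmod_ge_0 z). split.
{ specialize (Hlin z). rewrite H0, !sub0 in Hlin. specialize (Hlin ltac:(lra)).
  unfold saddle_chart.
  replace (- ell z - z ^ 2 / 2 + z)%C with (- (ell z - 1 * z) + - (z ^ 2 / 2))%C by ring.
  Cmod_triangle_le. rewrite !Cmod_opp.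
  assert (N2 : RtoC 2 <> RtoC 0) by (apply RtoC_neq_0; lra).
  rewrite Cmod_div, Cmod_pow, Cmod_R, (Rabs_pos_eq 2) by (trivial; lra).
  assert (Cmod z ^ 2 / 2 <= Cmod z / 16) by nra. lra. }
set (d := C_derive ell z).
assert (Hdz : is_Cderive ell z d) by (apply Hd; lra).
assert (N2 : RtoC 2 <> RtoC 0) by (apply RtoC_neq_0; lra).
exists (- d - z)%C.
assert (Hc : is_Cderive (saddle_chart ell) z (- d - z)%C).
{ unfold saddle_chart. Cderive; [trivial|field]. }
split; trivial. intros w.
(* differentiate exp s = 1 - ell *)
assert (Hl : (Cexp (saddle_chart ell z) * (- d - z))%C = (- d)%C).
{ rewrite <- (is_C_derive_unique (fun y => Cexp (saddle_chart ell y)) z _ (is_Cderive_Cexp_comp _ _ _ Hc)).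
  apply is_C_derive_unique.
  apply is_Cderive_ext_eps with (fun y => 1 - ell y)%C (r - Cmod z); [lra| |].
  - intros y Hy. symmetry. apply Hexp.
    replace y with ((y - z) + z)%C by ring.
    eapply Rle_lt_trans; [apply Cmod_triangle|lra].
  - Cderive. ring. }
unfold saddle_integrand, psi. rewrite Cexp_plus, <- Cmult_assoc, Hl, Hexp by trivial.
unfold V_fun. fold d.
replace (Cexp (w * (1 - ell z - saddle_chart ell z - 1) + RtoC (lambda q / 2) * saddle_chart ell z ^ 2))
  with (Cexp (w * (z ^ 2 / 2)) * Cexp (RtoC (lambda q / 2) * (ell z ^ 2 + z ^ 2 * ell z + z ^ 4 / 4)))%C.
- ring.
- rewrite <- Cexp_plus. f_equal. unfold saddle_chart.
  replace (RtoC (lambda q / 2)) with (RtoC (lambda q) / 2)%C by (rewrite RtoC_div by lra; reflexivity). field.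
Qed.

(** A primitive, in t, of exp (- a t^2 / 2) times the partial sum of the power series of V at - t e. *)
Fixpoint gauss_sum (V : nat -> C) (e : C) (a t : R) (n : nat) : C :=
  match n with
  | O => RtoC 0
  | S m => (gauss_sum V e a t m + V m * (- e) ^ m * RtoC (gauss_moment m a t))%C
  end.

Lemma gauss_sum_derive (V : nat -> C) (e : C) (a t : R) (n : nat) :
  curve_derive (fun t => gauss_sum V e a t n) t
    (RtoC (exp (- (a * t ^ 2 / 2))) * power_partial_sum V (- (RtoC t * e)) n)%C.
Proof.
induction n as [|n IH].
- simpl. rewrite Cmult_0_r. split; apply (is_derive_const (V := R_NormedModule)).
- simpl gauss_sum. simpl power_partial_sum.
  replace (RtoC (exp (- (a * t ^ 2 / 2))) *
     (power_partial_sum V (- (RtoC t * e)) n + V n * (- (RtoC t * e)) ^ n))%C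
   with (RtoC (exp (- (a * t ^ 2 / 2))) * power_partial_sum V (- (RtoC t * e)) n
     + V n * (- e) ^ n * RtoC (t ^ n * exp (- (a * t ^ 2 / 2))))%C.
  + apply curve_derive_plus; trivial. apply curve_derive_scal.
    apply (curve_derive_RtoC (gauss_moment n a)). apply gauss_moment_derive.
  + replace (- (RtoC t * e))%C with (RtoC t * - e)%C by ring.
    rewrite Cpow_mult_l, RtoC_mult, RtoC_pow. ring.
Qed.

Definition expansion_term (V : nat -> C) (w : C) (n : nat) : C :=
  (RtoC (INR (fact (2 * n)) / (2 ^ n * INR (fact n))) * V (2 * n)%nat * (- (1 / w)) ^ n)%C.

Definition expansion_sum (V : nat -> C) (w : C) (N : nat) : C :=
  sum_n_m (G := C_AbelianMonoid) (expansion_term V w) 1 N.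

Lemma sqrt_2PI : sqrt (2 * PI) = 2 * sqrt (PI / 2).
Proof.
assert (H := PI_RGT_0).
replace (2 * PI) with (2 ^ 2 * (PI / 2)) by field.
rewrite sqrt_mult by lra. rewrite sqrt_pow2; lra.
Qed.

Lemma gauss_even_moment_term (V : nat -> C) (n : nat) (rho : R) : 0 < rho ->
  exists K, 0 <= K /\ forall a th, 1 <= a ->
    let e := descent_dir th in
    Cmod (V (2 * n)%nat * (- e) ^ (2 * n) * RtoC (2 * gauss_moment (2 * n) a rho)
      - RtoC (sqrt (2 * PI) / sqrt a) * expansion_term V (RtoC a * cis th) n)%C
    <= K * exp (- (a * rho ^ 2 / 2)).
Proof.
intros Hr. destruct (gauss_moment_even rho n Hr) as [K [HK H]].
exists (2 * Cmod (V (2 * n)%nat) * K). split.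
{ assert (Hv := Cmod_ge_0 (V (2 * n)%nat)). repeat apply Rmult_le_pos; lra. }
intros a th Ha e. specialize (H a Ha).
assert (Hs : 0 < sqrt a) by (apply sqrt_lt_R0; lra).
assert (Hn : 0 < a ^ n) by (apply pow_lt; lra).
assert (Ha0 : RtoC a <> RtoC 0) by (apply RtoC_neq_0; lra).
assert (E : ((- (1 / (RtoC a * cis th))) ^ n * RtoC (a ^ n))%C = ((- e) ^ (2 * n))%C).
{ rewrite RtoC_pow, <- Cpow_mult_l. rewrite Cpow_mult_r. f_equal.
  assert (E2 := descent_dir_sqr th). fold e in E2.
  replace ((- e) ^ 2)%C with (cis th * e ^ 2 / cis th)%C by (field; apply cis_neq_0).
  rewrite E2. field. split; [apply cis_neq_0|trivial]. }
unfold expansion_term. rewrite <- E. fold (even_moment_coeff n).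
set (w := (- (1 / (RtoC a * cis th)))%C).
replace (V (2 * n)%nat * (w ^ n * RtoC (a ^ n)) * RtoC (2 * gauss_moment (2 * n) a rho)
  - RtoC (sqrt (2 * PI) / sqrt a) * (RtoC (even_moment_coeff n) * V (2 * n)%nat * w ^ n))%C
 with (RtoC 2 * V (2 * n)%nat * (w ^ n * RtoC (a ^ n)) * RtoC (gauss_moment (2 * n) a rho
    - even_moment_coeff n * sqrt (PI / 2) / (sqrt a * a ^ n)))%C.
- unfold w. rewrite E, !Cmod_mult, Cmod_pow, Cmod_opp. unfold e at 1. rewrite Cmod_descent_dir, pow1.
  rewrite !Cmod_R, (Rabs_pos_eq 2) by lra. rewrite Rmult_1_r, Rmult_assoc, (Rmult_assoc _ K).
  rewrite !Rmult_assoc. apply Rmult_le_compat_l; [lra|].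
  apply Rmult_le_compat_l; [apply Cmod_ge_0|exact H].
- rewrite sqrt_2PI.
  replace (2 * sqrt (PI / 2) / sqrt a) with (2 * a ^ n * (sqrt (PI / 2) / (sqrt a * a ^ n)))
    by (field; lra).
  replace (even_moment_coeff n * sqrt (PI / 2) / (sqrt a * a ^ n))
    with (even_moment_coeff n * (sqrt (PI / 2) / (sqrt a * a ^ n))) by (field; lra).
  rewrite RtoC_minus, !RtoC_mult. ring.
Qed.

(** Over [- rho, rho] the odd moments cancel and the even ones produce the terms of the expansion:
    (- e)^(2n) = (-1)^n cis (- n th) and the moment brings a^(-n), which together make (- 1 / w)^n. *)
Lemma gauss_sum_expansion (V : nat -> C) (rho : R) (N : nat) : 0 < rho -> V 0%nat = RtoC 1 ->
  exists K, 0 <= K /\ forall a th, 1 <= a ->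
    let e := descent_dir th in
    Cmod (gauss_sum V e a rho (2 * S N) - gauss_sum V e a (- rho) (2 * S N)
      - RtoC (sqrt (2 * PI) / sqrt a) * (1 + expansion_sum V (RtoC a * cis th) N))%C
    <= K * exp (- (a * rho ^ 2 / 2)).
Proof.
intros Hr HV0.
assert (Hpair : forall e a n, (gauss_sum V e a rho (2 * S n) - gauss_sum V e a (- rho) (2 * S n))%C
  = (gauss_sum V e a rho (2 * n) - gauss_sum V e a (- rho) (2 * n)
     + V (2 * n)%nat * (- e) ^ (2 * n) * RtoC (2 * gauss_moment (2 * n) a rho))%C).
{ intros e a n. replace (2 * S n)%nat with (S (S (2 * n))) by lia. simpl gauss_sum.
  fold (2 * n)%nat. replace (n + (n + 0))%nat with (2 * n)%nat by lia.
  rewrite !gauss_moment_opp.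
  assert (E1 : (-1) ^ S (2 * n) = -1) by apply pow_1_odd.
  assert (E2 : (-1) ^ S (S (2 * n)) = 1).
  { replace (S (S (2 * n))) with (2 * S n)%nat by lia. apply pow_1_even. }
  rewrite E1, E2, !RtoC_mult. ring. }
induction N as [|N [K [HK IH]]].
- destruct (gauss_even_moment_term V 0 rho Hr) as [K [HK H]].
  exists K; split; trivial. intros a th Ha e. specialize (H a th Ha). cbv zeta in H. fold e in H.
  rewrite Hpair. replace (gauss_sum V e a rho (2 * 0)) with (RtoC 0) by reflexivity.
  replace (gauss_sum V e a (- rho) (2 * 0)) with (RtoC 0) by reflexivity.
  assert (E0 : expansion_sum V (RtoC a * cis th) 0 = RtoC 0).
  { unfold expansion_sum. rewrite sum_n_m_zero by lia. reflexivity. }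
  assert (E1 : expansion_term V (RtoC a * cis th) 0 = RtoC 1).
  { unfold expansion_term. change (2 * 0)%nat with 0%nat. rewrite HV0. simpl.
    replace (1 / (1 * 1)) with 1 by field. ring. }
  rewrite E0. rewrite E1 in H.
  replace (0 - 0 + V (2 * 0)%nat * (- e) ^ (2 * 0) * RtoC (2 * gauss_moment (2 * 0) a rho) -
     RtoC (sqrt (2 * PI) / sqrt a) * (1 + 0))%C
   with (V (2 * 0)%nat * (- e) ^ (2 * 0) * RtoC (2 * gauss_moment (2 * 0) a rho) -
     RtoC (sqrt (2 * PI) / sqrt a) * 1)%C by ring.
  exact H.
- destruct (gauss_even_moment_term V (S N) rho Hr) as [K' [HK' H']].
  exists (K + K'); split; [lra|]. intros a th Ha e.
  specialize (IH a th Ha). specialize (H' a th Ha). cbv zeta in IH, H'. fold e in IH, H'.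
  rewrite Hpair.
  assert (ES : expansion_sum V (RtoC a * cis th) (S N) =
    (expansion_sum V (RtoC a * cis th) N + expansion_term V (RtoC a * cis th) (S N))%C).
  { unfold expansion_sum. rewrite sum_n_Sm by lia. reflexivity. }
  rewrite ES.
  set (A := (gauss_sum V e a rho (2 * S N) - gauss_sum V e a (- rho) (2 * S N))%C) in *.
  set (B := (V (2 * S N)%nat * (- e) ^ (2 * S N) * RtoC (2 * gauss_moment (2 * S N) a rho))%C) in *.
  set (c := RtoC (sqrt (2 * PI) / sqrt a)) in *.
  set (E1 := expansion_sum _ _ _) in *. set (E2 := expansion_term _ _ _) in *.
  replace (A + B - c * (1 + (E1 + E2)))%C with ((A - c * (1 + E1)) + (B - c * E2))%C by ring.
  Cmod_triangle_le. lra.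
Qed.

(** The part of the path near the saddle point is the image under saddle_chart of the segment from
    rho e to - rho e. With sigma = - t e one has w sigma^2 / 2 = - a t^2 / 2, so the Taylor
    polynomial of V contributes Gaussian moments and its remainder one more moment. *)
Lemma local_contribution (q : R) (ell : C -> C) (V : nat -> C) (N : nat) :
  ell_germ ell -> taylor_coeffs_at_0 (V_fun q ell) V ->
  exists rho K, 0 < rho <= 1 / 16 /\ 0 <= K /\ forall a th F,
    1 <= a -> (forall s, is_Cderive F s (saddle_integrand (lambda q) (RtoC a * cis th) s)) ->
    let e := descent_dir th in
    exists sp sm, Cmod (sp - RtoC rho * e) <= rho / 8 /\ Cmod (sm + RtoC rho * e) <= rho / 8 /\
      Cmod (F sp - F sm - e * (RtoC (sqrt (2 * PI) / sqrt a) * (1 + expansion_sum V (RtoC a * cis th) N)))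
        <= K * (exp (- (a * rho ^ 2 / 2)) + / (sqrt a * a ^ S N)).
Proof.
intros Hell HV.
assert (HV0 : V 0%nat = RtoC 1).
{ rewrite (power_series_coeff_0 _ _ HV). destruct Hell as [_ H0 H1 _]. unfold V_fun. rewrite H0, H1.
  replace (RtoC (lambda q / 2) * (0 ^ 2 + 0 ^ 2 * 0 + 0 ^ 4 / 4))%C with (RtoC 0).
  - rewrite Cexp_0. ring.
  - field. }
destruct (saddle_chart_germ q ell Hell) as [r1 [Hr1 Hchart]].
destruct (power_series_remainder V _ HV (2 * S N)) as (K1 & r2 & HK1 & Hr2 & Hrem).
set (rho := Rmin (Rmin (r1 / 2) r2) (1 / 16)).
assert (Hrho : 0 < rho) by (unfold rho; repeat apply Rmin_pos; lra).
assert (Hrhos : rho <= r1 / 2 /\ rho <= r2 /\ rho <= 1 / 16).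
{ unfold rho, Rmin. repeat destruct Rle_dec; lra. }
clearbody rho.
destruct (gauss_sum_expansion V rho N Hrho HV0) as [K2 [HK2 Hexp]].
destruct (gauss_moment_even rho (S N) Hrho) as [K3 [HK3 Hmom]].
set (cN := even_moment_coeff (S N) * sqrt (PI / 2)).
exists rho, (K2 + 2 * K1 * (K3 + Rabs cN)).
assert (HcN := Rabs_pos cN).
split; [lra|]. split.
{ assert (0 <= 2 * K1 * (K3 + Rabs cN)) by (repeat apply Rmult_le_pos; lra). lra. }
intros a th F Ha HF e.
assert (He : Cmod e = 1) by apply Cmod_descent_dir.
assert (Hpt : forall t, Cmod (- (RtoC t * e)) = Rabs t).
{ intros t. rewrite Cmod_opp, Cmod_mult, Cmod_R, He. ring. }
exists (saddle_chart ell (- (RtoC rho * e))), (saddle_chart ell (- (RtoC (- rho) * e))).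
split; [|split].
- destruct (Hchart (- (RtoC rho * e))%C) as [H _]; [rewrite Hpt, Rabs_pos_eq; lra|].
  rewrite Hpt, Rabs_pos_eq in H by lra. exact H.
- destruct (Hchart (- (RtoC (- rho) * e))%C) as [H _]; [rewrite Hpt, Rabs_Ropp, Rabs_pos_eq; lra|].
  rewrite Hpt, Rabs_Ropp, Rabs_pos_eq in H by lra.
  replace (saddle_chart ell (- (RtoC (- rho) * e)) + RtoC rho * e)%C
    with (saddle_chart ell (- (RtoC (- rho) * e)) + - (RtoC (- rho) * e))%C
    by (rewrite RtoC_opp; ring).
  exact H.
- set (k := fun t => F (saddle_chart ell (- (RtoC t * e)))).
  set (E := fun t => exp (- (a * t ^ 2 / 2))).
  assert (Hk : forall t, - rho <= t <= rho ->
    curve_derive k t (e * (RtoC (E t) * V_fun q ell (- (RtoC t * e))))%C).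
  { intros t Ht. destruct (Hchart (- (RtoC t * e))%C) as [_ [l [Hl Hid]]].
    { rewrite Hpt. apply Rle_lt_trans with rho; [apply Rabs_le; lra|lra]. }
    specialize (Hid (RtoC a * cis th)%C).
    replace (RtoC a * cis th * ((- (RtoC t * e)) ^ 2 / 2))%C with (RtoC (- (a * t ^ 2 / 2))) in Hid.
    2:{ assert (E2 := descent_dir_sqr th). fold e in E2.
        assert (N2 : RtoC 2 <> RtoC 0) by (apply RtoC_neq_0; lra).
        replace (RtoC a * cis th * ((- (RtoC t * e)) ^ 2 / 2))%C
          with (RtoC a * RtoC t ^ 2 * (cis th * e ^ 2) / 2)%C by (field; trivial).
        rewrite E2, RtoC_opp, RtoC_div, RtoC_mult, RtoC_pow by lra. field; trivial. }
    rewrite Cexp_RtoC in Hid.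
    replace (e * (RtoC (E t) * V_fun q ell (- (RtoC t * e))))%C with
      (saddle_integrand (lambda q) (RtoC a * cis th) (saddle_chart ell (- (RtoC t * e))) * (l * - e))%C.
    2:{ rewrite Cmult_assoc, Hid. fold (E t). ring. }
    apply (curve_derive_comp F (fun t => saddle_chart ell (- (RtoC t * e)))); [apply HF|].
    apply (curve_derive_comp (saddle_chart ell) (fun t => - (RtoC t * e))%C); [exact Hl|].
    apply curve_derive_ext with (2 := curve_derive_line 0 (- e) t). intros s; ring. }
  assert (HA := curve_mean_value (fun t => k t - e * gauss_sum V e a t (2 * S N))%C
    (fun t => e * (RtoC (E t) * V_fun q ell (- (RtoC t * e)))
       - e * (RtoC (E t) * power_partial_sum V (- (RtoC t * e)) (2 * S N)))%C
    (fun t => K1 * gauss_moment (2 * S N) a t) (fun t => K1 * (t ^ (2 * S N) * E t)) (- rho) rho).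
  cbv beta in HA.
  assert (HB : Cmod (k rho - e * gauss_sum V e a rho (2 * S N) -
        (k (- rho) - e * gauss_sum V e a (- rho) (2 * S N))) <=
     K1 * gauss_moment (2 * S N) a rho - K1 * gauss_moment (2 * S N) a (- rho)).
  { apply HA; [lra| | |].
    - intros t Ht. apply curve_derive_minus; [now apply Hk|]. apply curve_derive_scal, gauss_sum_derive.
    - intros t Ht. apply is_derive_scal, gauss_moment_derive.
    - intros t Ht.
      replace (e * (RtoC (E t) * V_fun q ell (- (RtoC t * e)))
       - e * (RtoC (E t) * power_partial_sum V (- (RtoC t * e)) (2 * S N)))%C
       with (e * RtoC (E t) * (V_fun q ell (- (RtoC t * e))
          - power_partial_sum V (- (RtoC t * e)) (2 * S N)))%C by ring.
      assert (HE : 0 < E t) by apply exp_pos.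
      rewrite !Cmod_mult, He, Cmod_R, (Rabs_pos_eq (E t)), Rmult_1_l by lra.
      specialize (Hrem (- (RtoC t * e))%C). rewrite Hpt in Hrem.
      replace (Rabs t ^ (2 * S N)) with (t ^ (2 * S N)) in Hrem.
      + replace (K1 * (t ^ (2 * S N) * E t)) with (E t * (K1 * t ^ (2 * S N))) by ring.
        apply Rmult_le_compat_l; [lra|]. apply Hrem. apply Rle_trans with rho; [apply Rabs_le; lra|lra].
      + rewrite !pow_mult. f_equal. symmetry. apply pow2_abs. }
  rewrite gauss_moment_opp in HB.
  replace ((-1) ^ S (2 * S N)) with (-1) in HB by (symmetry; apply pow_1_odd).
  specialize (Hexp a th Ha). cbv zeta in Hexp. fold e in Hexp. specialize (Hmom a Ha).
  set (G := (gauss_sum V e a rho (2 * S N) - gauss_sum V e a (- rho) (2 * S N))%C) in *.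
  set (X := (RtoC (sqrt (2 * PI) / sqrt a) * (1 + expansion_sum V (RtoC a * cis th) N))%C) in *.
  set (mrho := - rho) in *.
  change (Cmod (k rho - k mrho - e * X) <=
    (K2 + 2 * K1 * (K3 + Rabs cN)) * (E rho + / (sqrt a * a ^ S N))).
  replace (k rho - k mrho - e * X)%C with
    ((k rho - e * gauss_sum V e a rho (2 * S N) -
        (k mrho - e * gauss_sum V e a mrho (2 * S N))) + e * (G - X))%C by (unfold G; ring).
  Cmod_triangle_le. rewrite Cmod_mult, He, Rmult_1_l.
  assert (Hs : 0 < sqrt a) by (apply sqrt_lt_R0; lra).
  assert (Hn : 0 < a ^ S N) by (apply pow_lt; lra).
  set (inv := / (sqrt a * a ^ S N)).
  assert (Hinv : 0 < inv) by (apply Rinv_0_lt_compat, Rmult_lt_0_compat; trivial).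
  assert (HE : 0 < E rho) by apply exp_pos.
  change (exp (- (a * rho ^ 2 / 2))) with (E rho) in Hexp, Hmom.
  set (m := gauss_moment (2 * S N) a rho) in *.
  assert (Hm : m <= Rabs cN * inv + K3 * E rho).
  { assert (H := Rle_abs (m - even_moment_coeff (S N) * sqrt (PI / 2) / (sqrt a * a ^ S N))).
    assert (H2 : even_moment_coeff (S N) * sqrt (PI / 2) / (sqrt a * a ^ S N) <= Rabs cN * inv).
    { apply Rmult_le_compat_r; [lra|apply Rle_abs]. }
    lra. }
  assert (K1 * m <= K1 * (Rabs cN * inv + K3 * E rho)) by now apply Rmult_le_compat_l.
  assert (P1 : 0 <= K2 * inv) by (apply Rmult_le_pos; lra).
  assert (P2 : 0 <= K1 * Rabs cN * E rho) by (repeat apply Rmult_le_pos; lra).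
  assert (P3 : 0 <= K1 * K3 * inv) by (repeat apply Rmult_le_pos; lra).
  apply Rle_trans with (2 * (K1 * m) + K2 * E rho); [lra|].
  replace ((K2 + 2 * K1 * (K3 + Rabs cN)) * (E rho + inv)) with
    (2 * (K1 * (Rabs cN * inv + K3 * E rho)) + K2 * E rho + K2 * inv
      + 2 * (K1 * K3 * inv) + 2 * (K1 * Rabs cN * E rho)) by ring.
  lra.
Qed.

(** * From the contour integral to the saddle point *)

Lemma end_limit_shift (F : C -> C) (c d : C) (y0 : R) (l : C) :
  end_limit F (y0 - Im d) l -> end_limit (fun z => c * F (z - d))%C y0 (c * l)%C.
Proof.
intros H eps He. assert (Hc := Cmod_ge_0 c).
destruct (H (eps / (Cmod c + 1))) as [X HX]; [apply Rdiv_lt_0_compat; lra|].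
exists (X + Re d). intros z Hz1 Hz2.
replace (c * F (z - d) - c * l)%C with (c * (F (z - d) - l))%C by ring.
rewrite Cmod_mult. specialize (HX (z - d)%C).
assert (E1 : Re (z - d) = Re z - Re d) by (unfold Re; simpl; ring).
assert (E2 : Im (z - d) = Im z - Im d) by (unfold Im; simpl; ring).
rewrite E1, E2 in HX.
replace (Im z - Im d - (y0 - Im d)) with (Im z - y0) in HX by ring.
specialize (HX ltac:(lra) Hz2).
apply Rle_lt_trans with (Cmod c * (eps / (Cmod c + 1))).
- apply Rmult_le_compat_l; lra.
- rewrite Rmult_comm. now apply shrunk_eps_lt.
Qed.

(** The integrand of h in the variable z = log t. *)
Definition hankel_kernel (q : R) (u z : C) : C :=
  Cexp (Cexp z - RtoC (1 / (2 * ln q)) * (z + RtoC (1 / 2 * ln q) - u) ^ 2).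

(** Expand the square at z = s + log omega. Since omega is the saddle point in t, not in log t, the
    factor 1 / t of dt / t is absorbed in the square: this turns q^(-1/2) x into the q^(-3/2) x that
    defines omega, and leaves the term s in the exponent of saddle_integrand. *)
Lemma hankel_kernel_saddle (q a th : R) (u s : C) (w := (RtoC a * cis th)%C) :
  0 < q < 1 -> 0 < a ->
  (u + RtoC (- (3 / 2) * ln q - ln (lambda q)) = w / RtoC (lambda q) + (ln (a / lambda q), th))%C ->
  hankel_kernel q u (s + (ln a, th)) =
    (Cexp (RtoC (- (ln q / 2)) * w ^ 2 + RtoC (1 + ln q) * w) * RtoC (exp (- (ln q / 2)))
     * saddle_integrand (lambda q) w s)%C.
Proof.
intros Hq Ha Hu.
assert (Hlam := lambda_pos q Hq).
assert (Hln : ln q <> 0).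
{ intros E. unfold lambda in Hlam. rewrite E in Hlam. unfold Rdiv in Hlam. rewrite Rinv_0 in Hlam. lra. }
assert (HlnL : lambda q = - / ln q) by (unfold lambda; field; trivial).
assert (Hlq : RtoC (ln q) <> RtoC 0) by now apply RtoC_neq_0.
assert (Eu : u = (- w * RtoC (ln q) + (ln a, th) + RtoC (3 / 2 * ln q))%C).
{ assert (E : (w / RtoC (lambda q))%C = (- w * RtoC (ln q))%C).
  { rewrite HlnL, RtoC_opp, RtoC_inv by trivial. field. trivial. }
  rewrite E in Hu. rewrite ln_div in Hu by lra.
  replace u with (u + RtoC (- (3 / 2) * ln q - ln (lambda q))
     - RtoC (- (3 / 2) * ln q - ln (lambda q)))%C by ring.
  rewrite Hu.
  replace ((ln a - ln (lambda q))%R, th) with ((ln a, th) - RtoC (ln (lambda q)))%C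
    by (unfold Cminus, Cplus, Copp, RtoC; simpl; f_equal; ring).
  replace (- (3 / 2) * ln q - ln (lambda q)) with (- (3 / 2 * ln q) - ln (lambda q)) by ring.
  rewrite RtoC_minus, RtoC_opp. ring. }
assert (Ew : Cexp (ln a, th) = w).
{ rewrite Cexp_polar. unfold Re, Im; simpl. now rewrite exp_ln. }
unfold hankel_kernel, saddle_integrand, psi.
rewrite <- Cexp_RtoC, <- !Cexp_plus. f_equal. rewrite Cexp_plus, Ew.
set (ES := Cexp s).
rewrite Eu, HlnL.
replace (- / ln q / 2) with (- (/ (2 * ln q))) by (field; trivial).
replace (1 / (2 * ln q)) with (/ (2 * ln q)) by (field; trivial).
replace (1 / 2 * ln q) with (/ 2 * ln q) by field.
replace (3 / 2 * ln q) with (3 * / 2 * ln q) by field.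
replace (ln q / 2) with (/ 2 * ln q) by field.
assert (N2 : RtoC 2 <> RtoC 0) by (apply RtoC_neq_0; lra).
assert (N2' : 2 * ln q <> 0) by (intros E; destruct (Rmult_integral _ _ E); lra).
rewrite !RtoC_opp, RtoC_plus, RtoC_inv, !RtoC_mult, RtoC_inv by (trivial; lra).
field. trivial.
Qed.

Lemma prefactor_constant (q : R) : 0 < q < 1 ->
  sqrt (kappa q) / (2 * PI) * exp (- (ln q / 2)) * sqrt (2 * PI) = 1 / sqrt (q * ln (/ q)).
Proof.
intros Hq. assert (Hpi := PI_RGT_0).
assert (Hl : 0 < - ln q) by (assert (ln q < 0) by (rewrite <- ln_1; apply ln_increasing; lra); lra).
rewrite ln_Rinv by lra.
assert (Ek : kappa q = 2 * PI / - ln q) by (unfold kappa; field; lra).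
set (m := - ln q) in *.
assert (Ee : exp (- (ln q / 2)) = / sqrt q).
{ rewrite exp_Ropp. f_equal. replace (ln q / 2) with (/ 2 * ln q) by field.
  rewrite <- Rpower_sqrt by lra. reflexivity. }
rewrite Ek, Ee, sqrt_div, (sqrt_mult q m) by lra.
assert (Hm := sqrt_lt_R0 m Hl). assert (Hsq := sqrt_lt_R0 q (proj1 Hq)).
assert (H2 : sqrt (2 * PI) * sqrt (2 * PI) = 2 * PI) by (apply sqrt_sqrt; lra).
replace (sqrt (2 * PI) / sqrt m / (2 * PI) * / sqrt q * sqrt (2 * PI))
  with (sqrt (2 * PI) * sqrt (2 * PI) / (2 * PI) / (sqrt m * sqrt q)) by (field; lra).
rewrite H2. field. lra.
Qed.

Lemma h_as_jump (q a th : R) (g : R -> C) (u lp lm : C) (F : C -> C) (w := (RtoC a * cis th)%C) :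
  0 < q < 1 -> 0 < a -> hankel_contour g ->
  (u + RtoC (- (3 / 2) * ln q - ln (lambda q)) = w / RtoC (lambda q) + (ln (a / lambda q), th))%C ->
  (forall s, is_Cderive F s (saddle_integrand (lambda q) w s)) ->
  end_limit F (PI - th) lp -> end_limit F (- (PI + th)) lm ->
  h q g u = (RtoC (sqrt (kappa q)) / (2 * RtoC PI * Ci) *
    (Cexp (RtoC (- (ln q / 2)) * w ^ 2 + RtoC (1 + ln q) * w) * RtoC (exp (- (ln q / 2)))
     * (lp - lm)))%C.
Proof.
intros Hq Ha Hg Hu HF Hlp Hlm. unfold h. f_equal.
set (c := (Cexp (RtoC (- (ln q / 2)) * w ^ 2 + RtoC (1 + ln q) * w) * RtoC (exp (- (ln q / 2))))%C).
set (d := (ln a, th) : C).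
replace (c * (lp - lm))%C with (c * lp - c * lm)%C by ring.
apply (hankel_integral (fun z => c * F (z - d))%C (hankel_kernel q u) g); trivial.
- intros z. change C in (type of z).
  assert (E := hankel_kernel_saddle q a th u (z - d) Hq Ha Hu). cbv zeta in E. fold w in E. fold c d in E.
  replace (z - d + d)%C with z in E by ring.
  apply is_Cderive_eq with (c * (saddle_integrand (lambda q) w (z - d) * 1))%C.
  + apply (is_Cderive_scal c (fun z => F (z - d))%C).
    apply (is_Cderive_comp F (fun z => z - d)%C); [apply HF|].
    apply is_Cderive_sub_const.
  + rewrite E. ring.
- intros z. eexists. unfold hankel_kernel. repeat Cderive_step.
- now apply end_limit_shift.
- apply end_limit_shift. replace (- PI - Im d) with (- (PI + th)) by (unfold d, Im; simpl; ring).
  exact Hlm.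
Qed.

Theorem theorem8p2 :
  forall (q : R) (g : R -> C) (W sq ell : C -> C) (V : nat -> C),
  0 < q < 1 ->
  hankel_contour g ->
  lambert_on_surface W ->
  sqrt_omega_branch q W sq ->
  ell_germ ell ->
  taylor_coeffs_at_0 (V_fun q ell) V ->
  forall N : nat, (1 <= N)%nat ->
  exists (E : C -> C) (M A : R),
  forall u : C, A < Re u ->
    h q g u =
      (RtoC (1 / sqrt (q * ln (/ q))) *
       Cexp (RtoC (- (ln q / 2)) * omega q W u ^ 2
             + RtoC (1 + ln q) * omega q W u) *
       (1 / sq u) *
       (1 + sum_n_m (G := C_AbelianMonoid)
              (fun n : nat =>
                 RtoC (INR (fact (2 * n)) / (2 ^ n * INR (fact n))) *
                 V (2 * n)%nat * (- (1 / omega q W u)) ^ n) 1 N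
        + E u))%C /\
    Cmod (E u) <= M / Cmod (omega q W u) ^ (N + 1).
Proof.
intros q g W sq ell V Hq Hg HW Hsq Hell HV N _.
assert (Hlam := lambda_pos q Hq).
destruct (local_contribution q ell V N Hell HV) as (rho & K1 & Hrho & HK1 & Hloc).
destruct (upper_tail (lambda q) rho ltac:(lra) Hrho) as (K2 & HK2 & Hup).
destruct (lower_tail (lambda q) rho ltac:(lra) Hrho) as (K3 & HK3 & Hlow).
assert (Hc : 0 < rho ^ 2 / 4) by (assert (0 < rho ^ 2) by (apply pow_lt; lra); lra).
destruct (exp_decay_pow (rho ^ 2 / 4) (S (S N)) Hc) as (K4 & HK4 & Hdec).
assert (Heps : 0 < exp (-12) < 1).
{ split; [apply exp_pos|]. assert (H := exp_m12_small). lra. }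
destruct (omega_polar q W sq Hq HW Hsq (exp (-12)) 1 Heps) as [A HA].
pose (pref := fun u => (RtoC (1 / sqrt (q * ln (/ q))) *
       Cexp (RtoC (- (ln q / 2)) * omega q W u ^ 2 + RtoC (1 + ln q) * omega q W u) *
       (1 / sq u))%C).
exists (fun u => h q g u / pref u - 1 - expansion_sum V (omega q W u) N)%C,
  (K1 * (K4 + 1) + (K2 + K3) * K4), A.
intros u Hu.
destruct (HA u Hu) as (a & th & Ha1 & Ha0 & Hth & Hcos & Hom & Hsqu & Harg).
unfold omega_arg in Harg. rewrite Hom in Harg.
set (w := (RtoC a * cis th)%C) in *.
destruct (saddle_primitive (lambda q) w) as [F HF].
destruct (saddle_end_limit (lambda q) a th F ltac:(lra) Ha0 Hth HF) as [lp Hlp].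
destruct (saddle_end_limit_lower (lambda q) a th F ltac:(lra) Ha0 Hth HF) as [lm Hlm].
destruct (Hloc a th F Ha1 HF) as (sp & sm & Hsp & Hsm & Hmain).
assert (Tp := Hup a th F lp sp Ha1 Hth Hcos HF Hlp Hsp).
assert (Tm := Hlow a th F lm sm Ha1 Hth Hcos HF Hlm Hsm).
set (e := descent_dir th) in *. set (S1 := (1 + expansion_sum V w N)%C) in *.
set (c2 := sqrt (2 * PI)) in *.
set (err := (lp - lm - e * (RtoC (c2 / sqrt a) * S1))%C).
assert (Hpi := PI_RGT_0). assert (HP := PI2_3_2).
assert (Hc2 : 1 <= c2) by (unfold c2; rewrite <- sqrt_1; apply sqrt_le_1_alt; lra).
assert (Hs : 1 <= sqrt a) by (rewrite <- sqrt_1; apply sqrt_le_1_alt; lra).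
assert (Hss : sqrt a <= a) by (assert (H := sqrt_sqrt a ltac:(lra)); nra).
assert (Han : 0 < a ^ S N) by (apply pow_lt; lra).
set (inv := / (sqrt a * a ^ S N)).
assert (Hinv : 0 < inv) by (apply Rinv_0_lt_compat, Rmult_lt_0_compat; lra).
assert (HE4 : exp (- (a * (rho ^ 2 / 4))) <= K4 * inv).
{ specialize (Hdec a ltac:(lra)). rewrite (Rmult_comm _ a) in Hdec.
  unfold inv. apply Rle_div_r; [apply Rmult_lt_0_compat; lra|].
  eapply Rle_trans; [|exact Hdec]. apply Rmult_le_compat_l; [left; apply exp_pos|].
  simpl (a ^ S (S N)). apply Rmult_le_compat_r; [simpl in Han; lra|trivial]. }
assert (HE2 : exp (- (a * rho ^ 2 / 2)) <= K4 * inv).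
{ eapply Rle_trans; [|exact HE4]. apply exp_monotone.
  assert (0 <= a * rho ^ 2) by (apply Rmult_le_pos; [lra|apply pow2_ge_0]). lra. }
assert (Herr : Cmod err <= (K1 * (K4 + 1) + (K2 + K3) * K4) * inv).
{ unfold err.
  replace (lp - lm - e * (RtoC (c2 / sqrt a) * S1))%C with
    ((F sp - F sm - e * (RtoC (c2 / sqrt a) * S1)) + (lp - F sp) + - (lm - F sm))%C by ring.
  Cmod_triangle_le.
  eapply Rle_trans; [apply Rplus_le_compat_r, Cmod_triangle|]. rewrite Cmod_opp.
  fold w in Hmain. fold S1 inv in Hmain.
  assert (K1 * (exp (- (a * rho ^ 2 / 2)) + inv) <= K1 * (K4 * inv + inv))
    by (apply Rmult_le_compat_l; lra).
  assert (K2 * exp (- (a * (rho ^ 2 / 4))) <= K2 * (K4 * inv)) by (apply Rmult_le_compat_l; lra).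
  assert (K3 * exp (- (a * (rho ^ 2 / 4))) <= K3 * (K4 * inv)) by (apply Rmult_le_compat_l; lra).
  lra. }
assert (Hh := h_as_jump q a th g u lp lm F Hq Ha0 Hg Harg HF Hlp Hlm). fold w in Hh.
assert (N2 : RtoC 2 <> RtoC 0) by (apply RtoC_neq_0; lra).
assert (Npi : RtoC PI <> RtoC 0) by (apply RtoC_neq_0; lra).
assert (Nsa : RtoC (sqrt a) <> RtoC 0) by (apply RtoC_neq_0; lra).
assert (Nc2 : RtoC c2 <> RtoC 0) by (apply RtoC_neq_0; lra).
assert (Nci : Ci <> RtoC 0) by (intros E; injection E; lra).
assert (Ncis := cis_neq_0 (th / 2)).
assert (Ee : (e * cis (th / 2))%C = Ci).
{ unfold e. rewrite descent_dir_cis, <- Cmult_assoc, <- cis_plus, Rplus_opp_l, cis_0. ring. }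
assert (Ne : e <> RtoC 0) by (intros E; rewrite E, Cmult_0_l in Ee; now elim Nci).
assert (Epref : (pref u * (lp - lm) * RtoC (sqrt a) / (e * RtoC c2))%C = h q g u).
{ rewrite Hh. unfold pref. rewrite Hom, Hsqu, <- prefactor_constant by trivial. fold c2.
  set (X := Cexp _). rewrite !RtoC_mult, RtoC_div, RtoC_mult by lra. rewrite <- Ee.
  field. repeat split; trivial. }
assert (Hpref0 : pref u <> RtoC 0).
{ unfold pref. rewrite Hom, Hsqu.
  assert (Hq0 : 0 < q * ln (/ q)).
  { rewrite ln_Rinv by lra. apply Rmult_lt_0_compat; [lra|].
    assert (ln q < 0) by (rewrite <- ln_1; apply ln_increasing; lra). lra. }
  assert (Hsq0 := sqrt_lt_R0 _ Hq0).
  apply Cmult_neq_0; [apply Cmult_neq_0|].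
  - intros E. apply RtoC_inj in E. assert (0 < 1 / sqrt (q * ln (/ q))) by (apply Rdiv_lt_0_compat; lra). lra.
  - apply Cexp_neq_0.
  - intros E.
    assert (E1 : (1 / (RtoC (sqrt a) * cis (th / 2)) * (RtoC (sqrt a) * cis (th / 2)))%C = RtoC 1)
      by (field; split; trivial).
    rewrite E, Cmult_0_l in E1. apply RtoC_inj in E1. lra. }
assert (EE : (h q g u / pref u - 1 - expansion_sum V w N)%C
   = (err * RtoC (sqrt a) / (e * RtoC c2))%C).
{ rewrite <- Epref. unfold err, S1. rewrite RtoC_div by lra. field. repeat split; trivial. }
split.
- change (h q g u = (pref u * (1 + expansion_sum V (omega q W u) N
     + (h q g u / pref u - 1 - expansion_sum V (omega q W u) N)))%C).
  field. trivial.
- rewrite Hom. fold w. rewrite EE.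
  replace (Cmod w) with a
    by (unfold w; rewrite Cmod_mult, Cmod_cis, Cmod_R, Rabs_pos_eq; lra).
  rewrite Cmod_div, !Cmod_mult by (now apply Cmult_neq_0).
  unfold e. rewrite Cmod_descent_dir, !Cmod_R, (Rabs_pos_eq (sqrt a)), (Rabs_pos_eq c2) by lra.
  set (K := K1 * (K4 + 1) + (K2 + K3) * K4) in *.
  assert (HK : 0 <= K).
  { unfold K. assert (0 <= K1 * (K4 + 1)) by (apply Rmult_le_pos; lra).
    assert (0 <= (K2 + K3) * K4) by (apply Rmult_le_pos; lra). lra. }
  replace (N + 1)%nat with (S N) by lia.
  apply Rle_trans with (Cmod err * sqrt a).
  + apply Rle_div_l; [lra|]. rewrite Rmult_1_l.
    assert (0 <= Cmod err * sqrt a) by (apply Rmult_le_pos; [apply Cmod_ge_0|lra]). nra.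
  + apply Rle_trans with (K * inv * sqrt a); [apply Rmult_le_compat_r; lra|].
    right. unfold inv. field. lra.
Qed.
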